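(* Let $0<\alpha\le 1$, $0<\kappa<1$ and let $w\in A_1$ be a weight on $\mathbb R^n$. Then there is a constant $C>0$ independent of $f$ such that for all $f\in L^{1,\kappa}(w)$, $$\big\|\mathcal S_\alpha(f)\big\|_{WL^{1,\kappa}(w)}\le C\,\|f\|_{L^{1,\kappa}(w)}.$$
   Context: A weight $w$ is a nonnegative, locally integrable function on $\mathbb R^n$; for measurable $E\subseteq\mathbb R^n$ write $w(E)=\int_E w(x)\,dx$, and $|E|$ for Lebesgue measure. $w\in A_1$ means there is a constant $C$ such that $\frac1{|B|}\int_B w(x)\,dx\le C\,\operatorname{ess\,inf}_{x\in B} w(x)$ for every ball $B\subseteq\mathbb R^n$. Weighted Morrey space: $L^{1,\kappa}(w)$ is the set of $f\in L^1_{loc}(w)$ (i.e. $|f|w$ locally integrable) with $\|f\|_{L^{1,\kappa}(w)}=\sup_B \frac{1}{w(B)^\kappa}\int_B|f(x)|w(x)\,dx<\infty$, supremum over all balls $B$ in $\mathbb R^n$. Weighted weak Morrey space: $WL^{1,\kappa}(w)$ is the set of measurable $h$ with $\|h\|_{WL^{1,\kappa}(w)}=\sup_B\sup_{\sigma>0}\frac{1}{w(B)^{\kappa}}\,\sigma\, w(\{x\in B:|h(x)|>\sigma\})<\infty$. Intrinsic square function: for $0<\alpha\le1$, $\mathcal C_\alpha$ is the family of functions $\varphi$ on $\mathbb R^n$ with support contained in $\{x:|x|\le1\}$, $\int_{\mathbb R^n}\varphi(x)\,dx=0$, and $|\varphi(x)-\varphi(x')|\le|x-x'|^\alpha$ for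 all $x,x'\in\mathbb R^n$. Put $\varphi_t(x)=t^{-n}\varphi(x/t)$, $\mathbb R^{n+1}_+=\mathbb R^n\times(0,\infty)$. For $f\in L^1_{loc}(\mathbb R^n)$ and $(y,t)\in\mathbb R^{n+1}_+$ set $A_\alpha(f)(y,t)=\sup_{\varphi\in\mathcal C_\alpha}|f*\varphi_t(y)|=\sup_{\varphi\in\mathcal C_\alpha}\left|\int_{\mathbb R^n}\varphi_t(y-z)f(z)\,dz\right|$. With $\Gamma(x)=\{(y,t)\in\mathbb R^{n+1}_+:|x-y|<t\}$, define $$\mathcal S_\alpha(f)(x)=\left(\iint_{\Gamma(x)}\big(A_\alpha(f)(y,t)\big)^2\frac{dy\,dt}{t^{n+1}}\right)^{1/2}.$$ *)

(* Defs.v *)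
From HB Require Import structures.
From mathcomp Require Import all_boot all_order all_algebra.
From mathcomp Require Import all_classical all_reals all_analysis.
From mathcomp Require Import measurable_realfun ess_sup_inf.

Set Implicit Arguments.
Unset Strict Implicit.
Unset Printing Implicit Defensive.

Import Order.TTheory GRing.Theory Num.Theory.
Import numFieldNormedType.Exports.

Local Open Scope classical_set_scope.
Local Open Scope ring_scope.
Local Open Scope ereal_scope.

(* Row vectors carry the sigma-algebra generated by the coordinates; for
   'rV[R]_n with R : realType this is the Borel sigma-algebra. *)
Definition measure_row_display : measure_display -> measure_display.
Proof. exact. Qed.

Section measurable_row.
Context {d} {T : measurableType d} (n : nat).

Definition row_coord (i : 'I_n) (x : 'rV[T]_n) : T := x ord0 i.

Let row_set0 : g_sigma_preimage row_coord set0.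
Proof. exact: sigma_algebra0. Qed.

Let row_setC A : g_sigma_preimage row_coord A ->
  g_sigma_preimage row_coord (~` A).
Proof. exact: sigma_algebraC. Qed.

Let row_bigcup (F : _^nat) : (forall i, g_sigma_preimage row_coord (F i)) ->
  g_sigma_preimage row_coord (\bigcup_i (F i)).
Proof. exact: sigma_algebra_bigcup. Qed.

HB.instance Definition _ := @isMeasurable.Build (measure_row_display d)
  'rV[T]_n (g_sigma_preimage row_coord) row_set0 row_setC row_bigcup.

End measurable_row.

Section measurable_fun_row.
Context d d' (X : measurableType d) (T : measurableType d') (n : nat).

Lemma measurable_row_coord (i : 'I_n) :
  measurable_fun [set: 'rV[T]_n] (fun x => x ord0 i).
Proof.
move=> _ Y mY; rewrite setTI; apply: sub_sigma_algebra => /=.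
rewrite -bigcup_seq/=; exists i => /=; first by rewrite mem_index_enum.
by exists Y => //; rewrite setTI.
Qed.

Lemma measurable_fun_rowP (f : X -> 'rV[T]_n) :
  (forall i, measurable_fun [set: X] (fun x => f x ord0 i)) ->
  measurable_fun [set: X] f.
Proof.
move=> mf _ A mA; rewrite setTI.
have : (image_set_system setT f measurable) A.
  move: A mA; apply: smallest_sub.
    by apply: sigma_algebra_image; exact: sigma_algebra_measurable.
  rewrite -bigcup_seq => B [i _ [C mC <-]].
  rewrite /image_set_system/= !setTI.
  by have := mf i measurableT C mC; rewrite setTI.
by rewrite /image_set_system/= setTI.
Qed.

End measurable_fun_row.

Section lebesgue_row.
Context {R : realType}.

Definition row_cons n (p : measurableTypeR R * 'rV[R]_n) : 'rV[R]_n.+1 :=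
  \row_i (if unlift ord0 i is Some j then p.2 ord0 j else p.1).

Definition row_uncons n (v : 'rV[R]_n.+1) : measurableTypeR R * 'rV[R]_n :=
  (v ord0 ord0, \row_j v ord0 (lift ord0 j)).

Lemma row_consK n : cancel (@row_cons n) (@row_uncons n).
Proof.
move=> [x v]; rewrite /row_uncons /row_cons mxE unlift_none; congr pair.
by apply/rowP => j; rewrite !mxE liftK.
Qed.

Lemma measurable_row_cons n : measurable_fun [set: _] (@row_cons n).
Proof.
apply: measurable_fun_rowP => i; rewrite /row_cons.
under eq_fun do rewrite mxE.
case: unliftP => [j _|_]; last exact: measurable_fst.
apply: (@measurableT_comp _ _ _ _ _ _ (fun v : 'rV[R]_n => v ord0 j) _ snd).
  exact: measurable_row_coord.
exact: measurable_snd.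
Qed.

Lemma measurable_row_uncons n : measurable_fun [set: _] (@row_uncons n).
Proof.
apply/measurable_fun_pairP; split; first exact: measurable_row_coord.
apply: measurable_fun_rowP => i /=.
rewrite (_ : (fun _ => _) = (fun v : 'rV[R]_n.+1 => v ord0 (lift ord0 i))).
  exact: measurable_row_coord.
by apply/funext => v; rewrite mxE.
Qed.

Section step.
Context (n : nat) (mu : {sigma_finite_measure set 'rV[R]_n -> \bar R}).

Definition lebesgue_row_step : set 'rV[R]_n.+1 -> \bar R :=
  pushforward (@lebesgue_measure R \x mu) (@row_cons n).

Let m0 : lebesgue_row_step set0 = 0.
Proof. by rewrite /lebesgue_row_step /pushforward preimage_set0 measure0. Qed.

Let m_ge0 A : 0 <= lebesgue_row_step A.
Proof. by rewrite /lebesgue_row_step /pushforward measure_ge0. Qed.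

Let m_sigma_additive : semi_sigma_additive lebesgue_row_step.
Proof.
move=> F mF tF mUF; rewrite /lebesgue_row_step /pushforward preimage_bigcup.
have mpre A : measurable A -> measurable (@row_cons n @^-1` A).
  by move=> mA; rewrite -[X in measurable X]setTI; exact: measurable_row_cons.
apply: measure_semi_sigma_additive.
- by move=> k; exact: mpre.
- apply/trivIsetP => /= i j _ _ ij; rewrite -preimage_setI.
  by move/trivIsetP : tF => /(_ _ _ _ _ ij) ->//; rewrite preimage_set0.
- by rewrite -preimage_bigcup; exact: mpre.
Qed.

HB.instance Definition _ := isMeasure.Build _ _ _ lebesgue_row_step
  m0 m_ge0 m_sigma_additive.

Let m_sigma_finite : sigma_finite setT lebesgue_row_step.
Proof.
have /sigma_finiteP[F [TF ndF Foo]] := sigma_finiteT (@lebesgue_measure R).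
have /sigma_finiteP[G [TG ndG Goo]] := sigma_finiteT mu.
exists (fun k => @row_uncons n @^-1` (F k `*` G k)).
  rewrite -preimage_bigcup (_ : \bigcup_k (F k `*` G k) = setT).
    by rewrite preimage_setT.
  rewrite -setXTT TF TG predeqE => -[x y]; split.
    by move=> [k _ []/= ? ?]; split; exists k.
  move=> [/= [k _ Fkx] [l _ Gly]]; exists (maxn k l) => //; split.
  - by move: x Fkx; exact/subsetPset/ndF/leq_maxl.
  - by move: y Gly; exact/subsetPset/ndG/leq_maxr.
move=> k; have [mF Fk] := Foo k; have [mG Gk] := Goo k; split.
  rewrite -[X in measurable X]setTI.
  by apply: measurable_row_uncons => //; exact: measurableX.
rewrite /lebesgue_row_step /pushforward -comp_preimage.
rewrite (_ : _ \o _ = id); last by rewrite funeqE => x /=; exact: row_consK.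
by rewrite preimage_id product_measure1E// lte_mul_pinfty// ge0_fin_numE.
Qed.

HB.instance Definition _ := Measure_isSigmaFinite.Build _ _ _
  lebesgue_row_step m_sigma_finite.

End step.

(* Lebesgue measure on R^n, as the n-fold product of the Lebesgue measure
   of R *)
Fixpoint lebesgue_row n : {sigma_finite_measure set 'rV[R]_n -> \bar R} :=
  match n with
  | 0%N => @dirac _ 'rV[R]_0 0%R R
  | m.+1 => lebesgue_row_step (lebesgue_row m)
  end.

Lemma lebesgue_row_box n (A : 'I_n -> set R) :
  (forall i, measurable (A i)) ->
  lebesgue_row n [set x | forall i, A i (x ord0 i)] =
  \prod_(i < n) @lebesgue_measure R (A i).
Proof.
elim: n A => [|n IHn] A mA /=.
  by rewrite big_ord0 diracE mem_set// => -[].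
rewrite /lebesgue_row_step /pushforward big_ord_recl/=.
have mB : measurable [set x : 'rV[R]_n | forall i, A (lift ord0 i) (x ord0 i)].
  rewrite [X in measurable X](_ : _ = \bigcap_(i in [set: 'I_n])
      ((fun x : 'rV[R]_n => x ord0 i) @^-1` A (lift ord0 i))).
    apply: fin_bigcap_measurable => // i _.
    rewrite -[X in measurable X]setTI.
    by apply: measurable_row_coord => //; exact: mA.
  by apply/seteqP; split=> x /= Ax i; [move=> _|]; exact: Ax.
rewrite -(IHn (fun i => A (lift ord0 i)))// -product_measure1E//; last exact: mA.
congr (_ _); apply/seteqP; split=> -[x v]/=.
  move=> Axv; split=> /= [|i].
    by have := Axv ord0; rewrite mxE unlift_none.
  by have := Axv (lift ord0 i); rewrite mxE liftK.
by move=> [/= Ax Av] i; rewrite mxE; case: unliftP => [j|] -> /=.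
Qed.

End lebesgue_row.
Arguments lebesgue_row {R} n.

Section morrey.
Context {R : realType} {n : nat}.
Implicit Types (B E K : set 'rV[R]_n) (w f : 'rV[R]_n -> R).
Local Notation mu := (lebesgue_row n).

(* the Euclidean norm: the library's `|x| on 'rV[R]_n is the sup norm *)
Definition enorm (x : 'rV[R]_n) : R :=
  Num.sqrt (\sum_(i < n) x ord0 i ^+ 2)%R.

Definition eball (c : 'rV[R]_n) (r : R) : set 'rV[R]_n :=
  [set x | (enorm (x - c)%R < r)%R].

Definition eballs : set (set 'rV[R]_n) :=
  [set B | exists c r, (0 < r)%R /\ B = eball c r].

(* Measurability with respect to the Lebesgue-measurable sets, the completion
   of the Borel sets of 'rV[R]_n, which is weaker than measurable_fun setT f.
   The integral \int[mu]_(x in E) g x of the library is defined for all g from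
   the Borel simple functions below g^\+ and below g^\-; it is the Lebesgue
   integral as soon as g and E are Lebesgue measurable. *)
Definition lebesgue_measurable_fun f : Prop :=
  forall Y : set R, measurable Y -> completed_algebra_gen mu (f @^-1` Y).

Definition locally_integrable_row f : Prop :=
  lebesgue_measurable_fun f /\
  forall K, compact K -> \int[mu]_(x in K) `|f x|%:E < +oo.

Definition weight w : Prop :=
  (forall x, (0 <= w x)%R) /\ locally_integrable_row w.

Definition wint w E : \bar R := \int[mu]_(x in E) (w x)%:E.

(* w is set to +oo off B, so that only its values on B count *)
Definition ess_inf_on B w : \bar R :=
  ess_inf mu (patch (cst +oo) B (EFin \o w)).

Definition A1 w : Prop :=
  weight w /\
  exists C : R, forall B, eballs B ->
    (mu B)^-1 * wint w B <= C%:E * ess_inf_on B w.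

(* In both norms below, balls with w(B) = 0 contribute 0: the inverse of 0 in
   \bar R is +oo, and +oo * 0 = 0. *)
Definition morrey_norm (kappa : R) w f : \bar R :=
  ereal_sup [set (wint w B `^ kappa)^-1 * \int[mu]_(x in B) (`|f x| * w x)%:E
            | B in eballs].

Definition morrey (kappa : R) w f : Prop :=
  [/\ lebesgue_measurable_fun f,
      locally_integrable_row (fun x => `|f x| * w x)%R &
      morrey_norm kappa w f < +oo].

Definition weak_morrey_norm (kappa : R) w (h : 'rV[R]_n -> \bar R) : \bar R :=
  ereal_sup [set
    ereal_sup [set (wint w B `^ kappa)^-1 *
                   (s%:E * wint w (B `&` [set x | s%:E < `|h x|]))
              | s in [set s : R | (0 < s)%R]]
  | B in eballs].

Definition holder_class (alpha : R) : set ('rV[R]_n -> R) :=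
  [set phi | [/\ closure [set x | phi x != 0%R] `<=`
                   [set x | (enorm x <= 1)%R],
                 \int[mu]_x (phi x)%:E = 0 &
                 forall x x',
                   (`|phi x - phi x'| <= enorm (x - x') `^ alpha)%R]].

Definition dilate (phi : 'rV[R]_n -> R) (t : R) (x : 'rV[R]_n) : R :=
  (t ^- n * phi (t^-1 *: x))%R.

Definition intrinsic_sup (alpha : R) f (y : 'rV[R]_n) (t : R) : \bar R :=
  ereal_sup [set `| \int[mu]_z (dilate phi t (y - z)%R * f z)%:E |
            | phi in holder_class alpha].

Definition cone (x : 'rV[R]_n) : set ('rV[R]_n * R) :=
  [set p | (0 < p.2)%R /\ (enorm (x - p.1)%R < p.2)%R].

Definition intrinsic_square (alpha : R) f (x : 'rV[R]_n) : \bar R :=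
  (\int[mu \x @lebesgue_measure R]_(p in cone x)
     (intrinsic_sup alpha f p.1 p.2 ^+ 2 * (p.2 ^- n.+1)%:E)) `^ (2^-1)%R.

End morrey.

(* Main.v *)
Require Import Defs.
From HB Require Import structures.
From mathcomp Require Import all_boot all_order all_algebra.
From mathcomp Require Import all_classical all_reals all_analysis.
From mathcomp Require Import measurable_realfun ess_sup_inf ring lra zify.

(** Over each dyadic cube Q of side 2^k consider the Whitney box of the points
    (y, t) with y in Q and t between 2^k and 2^(k+1). For such (y, t) and phi in the
    Hoelder class, z |-> phi_t (y - z) is an atom of Q: it is supported near Q,
    bounded by a multiple of 1/|Q|, Hoelder continuous at the scale of Q, and of mean
    zero ([dilate_atom]). Choose for each Q an atom psi_Q whose pairing with f
    is largest up to a factor 2. Then the square of the intrinsic square function at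
    x is at most 4 times the sum of the squares of the pairings of f with psi_Q
    over the cubes Q near x ([area_le]). It remains to bound this sum for finite
    families of cubes with a constant that does not depend on the family, and to pass
    to the limit ([weak_ball]).

    Atoms are almost orthogonal: of two atoms the one of smaller scale has mean zero
    and the other one varies little on its support ([gram]). Schur's test and
    duality give that the sum of |Q| times the squared pairings of h with psi_Q is at
    most a multiple of the integral of h^2 ([bessel]). As psi_Q only sees h near Q,
    slicing the weight by its levels gives a weighted form of this inequality
    ([weighted_bessel]).

    The weak-type (1,1) inequality with an A1 weight ([weak_type]) follows by a
    Calderon-Zygmund decomposition f = g + b at height lambda. By the A1 condition
    the dilates of the cubes where |f| has average above lambda have weight at
    most C / lambda times the integral of |f| w. The good part g is bounded by a
    multiple of lambda, so [weighted_bessel] and Chebyshev's inequality apply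
    ([good_bound]). Off the dilated cubes, an atom psi_Q only meets stopping cubes
    smaller than Q, and the cancellation of b on these gains a power of the
    ratio of the sides, which makes the sums converge ([bad_bound]).

    Finally let B be a ball of radius r and f in the Morrey space. Atoms of scale
    at most r near B only see f on a dilate of B, and the weak-type inequality
    together with the doubling property of w gives the required bound. An atom of
    scale 2^j r has a coefficient of size at most C ||f|| w(2^j B)^(kappa - 1), and by
    reverse doubling w(2^j B) grows geometrically in j; since kappa < 1, the large
    atoms contribute at most C ||f|| w(B)^(kappa - 1) to the square function at every
    point of B ([far_bound], [morrey_fin]).

    The argument runs with Borel functions and sup-norm balls. Borel versions
    of w and f are supplied by [borel_version], and doubling makes cubes and Euclidean
    balls interchangeable. A weight that vanishes almost everywhere is treated
    apart ([weak_morrey_null_weight]). *)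

Set Implicit Arguments.
Unset Strict Implicit.
Unset Printing Implicit Defensive.

Import Order.TTheory GRing.Theory Num.Theory.
Import numFieldNormedType.Exports.

Local Open Scope classical_set_scope.
Local Open Scope ring_scope.

(** * The sup norm and the Euclidean norm *)
Section supnorm.
Context {R : realType} {n : nat}.
Implicit Types (x y c : 'rV[R]_n) (r : R).

(** A boolean predicate, so that the indicator function of a cube is
    [(insq c r x)%:R] and cubes enter integrals as factors. *)
Definition insq c r x : bool := `|x - c| <= r.

Lemma coord_le_norm x (j : 'I_n) : `|x ord0 j| <= `|x|.
Proof.
rewrite [leRHS]mx_normrE.
exact: (@le_bigmax _ R _ 0 (fun ij : 'I_1 * 'I_n => `|x ij.1 ij.2|) (ord0, j)).
Qed.

Lemma norm_leP x r : 0 <= r -> (forall j, `|x ord0 j| <= r) <-> `|x| <= r.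
Proof.
move=> r0; split=> [xr|xr j]; last exact: le_trans (coord_le_norm x j) xr.
rewrite [leLHS]mx_normrE; apply/bigmax_leP; split => //= -[i j] _ /=.
by rewrite ord1; exact: xr.
Qed.

Lemma enorm_ge0 x : 0 <= enorm x.
Proof. exact: sqrtr_ge0. Qed.

Lemma norm_le_enorm x : `|x| <= enorm x.
Proof.
apply/norm_leP; [exact: enorm_ge0|move=> j].
rewrite -sqrtr_sqr ler_wsqrtr// (bigD1 j)//= lerDl.
by apply: sumr_ge0 => i _; exact: sqr_ge0.
Qed.

Lemma enorm_le_norm x : enorm x <= n%:R * `|x|.
Proof.
rewrite -[leRHS]ger0_norm ?mulr_ge0// -sqrtr_sqr ler_wsqrtr//.
apply: (@le_trans _ _ (\sum_(i < n) `|x| ^+ 2)).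
  apply: ler_sum => i _; rewrite -(real_normK (num_real (x _ _))).
  by rewrite lerXn2r ?nnegrE// coord_le_norm.
rewrite sumr_const card_ord -[leLHS]mulr_natl exprMn ler_wpM2r ?sqr_ge0//.
by rewrite -natrX ler_nat; case: (n) => // m; rewrite expnS leq_pmulr ?expn_gt0.
Qed.

Lemma enormN x : enorm (- x) = enorm x.
Proof. by congr Num.sqrt; apply: eq_bigr => i _; rewrite mxE sqrrN. Qed.

Lemma enormZ (a : R) x : enorm (a *: x) = `|a| * enorm x.
Proof.
rewrite -sqrtr_sqr /enorm -sqrtrM ?sqr_ge0//; congr Num.sqrt.
by rewrite mulr_sumr; apply: eq_bigr => i _; rewrite mxE exprMn.
Qed.

End supnorm.

(** * Dyadic cubes *)
Section cells.
Context {R : realType} {n : nat}.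

(** The pair (k, m) stands for the half-open dyadic cube of side 2^k whose
    lower corner is 2^k m. *)
Definition idx : Type := (int * 'rV[int]_n)%type.
HB.instance Definition _ := Countable.on idx.

Implicit Types (i : idx) (k : int) (x : 'rV[R]_n).

Definition side k : R := 2 ^ k.
Definition corner i : 'rV[R]_n := \row_j (side i.1 * (i.2 ord0 j)%:~R).
Definition vol k : R := side k ^+ n.
Definition cell k x : idx := (k, \row_j Num.floor (x ord0 j / side k)).
Definition inQ i x : bool := cell i.1 x == i.

Lemma side_gt0 k : 0 < side k. Proof. exact: exprz_gt0. Qed.
Lemma side_ge0 k : 0 <= side k. Proof. exact/ltW/side_gt0. Qed.
Lemma side_neq0 k : side k != 0. Proof. exact/lt0r_neq0/side_gt0. Qed.
Lemma vol_gt0 k : 0 < vol k. Proof. exact/exprn_gt0/side_gt0. Qed.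
Lemma vol_ge0 k : 0 <= vol k. Proof. exact/ltW/vol_gt0. Qed.
Lemma vol_neq0 k : vol k != 0. Proof. exact/lt0r_neq0/vol_gt0. Qed.

Lemma sideD k l : side (k + l) = side k * side l.
Proof. by rewrite /side expfzDr. Qed.

Lemma sideS k : side (k + 1) = 2 * side k.
Proof. by rewrite sideD mulrC. Qed.

Lemma sideDn k (d : nat) : side (k + d%:Z) = 2 ^+ d * side k.
Proof. by rewrite sideD mulrC. Qed.

Lemma ler_side k l : (side k <= side l) = (k <= l).
Proof. by rewrite /side ler_eXz2l// ltr1n. Qed.

Lemma ltr_side k l : (side k < side l) = (k < l).
Proof. by rewrite /side ltr_eXz2l// ltr1n. Qed.

Lemma inQP i x : reflect
  (forall j, corner i ord0 j <= x ord0 j < corner i ord0 j + side i.1)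
  (inQ i x).
Proof.
have E j : (corner i ord0 j <= x ord0 j < corner i ord0 j + side i.1) =
    (Num.floor (x ord0 j / side i.1) == i.2 ord0 j).
  rewrite floor_eq mxE intrD ler_pdivlMr ?side_gt0// ltr_pdivrMr ?side_gt0//.
  by rewrite mulrDl mul1r mulrC.
apply: (iffP eqP) => [|H].
  by case: i E => k m E [/rowP H] j; rewrite E -(H j) mxE.
case: i E H => k m E H; congr pair; apply/rowP => j.
by rewrite mxE; apply/eqP; rewrite -E.
Qed.

Lemma inQ_cell k x : inQ (cell k x) x.
Proof. by rewrite /inQ. Qed.

Lemma inQ_uniq i j x : inQ i x -> inQ j x -> i.1 = j.1 -> i = j.
Proof. by move=> /eqP <- /eqP <- /= ->. Qed.

Lemma inQ_dist i x : inQ i x -> `|x - corner i| <= side i.1.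
Proof.
move/inQP => H; apply/norm_leP; first exact: side_ge0.
move=> j; have /andP[h1 h2] := H j.
by rewrite !mxE in h1 h2 *; rewrite ger0_norm ?subr_ge0//; lra.
Qed.

End cells.
Arguments idx n : clear implicits.
Arguments vol {R} n k.

(** * Measurability and volume of cubes *)
Section measurability.
Context {R : realType} {n : nat}.
Implicit Types (x y c : 'rV[R]_n) (r : R).
Local Notation mu := (@lebesgue_row R n).

Lemma measurable_box (A : 'I_n -> set R) : (forall i, measurable (A i)) ->
  measurable [set x : 'rV[R]_n | forall i, A i (x ord0 i)].
Proof.
move=> mA; rewrite [X in measurable X](_ : _ = \bigcap_(i in [set: 'I_n])
    ((fun x : 'rV[R]_n => x ord0 i) @^-1` A i)).
  apply: fin_bigcap_measurable => // i _.
  rewrite -[X in measurable X]setTI.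
  by apply: measurable_row_coord => //; exact: mA.
by apply/seteqP; split=> x /= Ax i; [move=> _|]; exact: Ax.
Qed.

Lemma sqE c r : 0 <= r -> [set x | `|x - c| <= r] =
  [set x | forall j, (`[c ord0 j - r, c ord0 j + r]%classic : set R) (x ord0 j)].
Proof.
move=> r0; apply/seteqP; split=> x /=.
  move/(norm_leP _ r0) => H j; have := H j; rewrite !mxE in_itv/=.
  by rewrite ler_distl.
move=> H; apply/norm_leP => // j; have := H j; rewrite !mxE in_itv/=.
by rewrite ler_distl.
Qed.

Lemma measurable_sq c r : measurable [set x | insq c r x].
Proof.
rewrite /insq.
have [r0|r0] := leP 0 r; first rewrite sqE//.
  apply: (@measurable_box (fun j => `[c ord0 j - r, c ord0 j + r]%classic)) => j.
  exact: measurable_itv.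
rewrite (_ : mkset _ = set0)//; apply/seteqP; split => // x /= /le_lt_trans.
by move=> /(_ _ r0); rewrite ltNge normr_ge0.
Qed.

Lemma lebesgue_sq c r : 0 <= r ->
  mu [set x | insq c r x] = ((2 * r) ^+ n)%:E.
Proof.
move=> r0; rewrite /insq sqE// (@lebesgue_row_box _ _
  (fun j => `[c ord0 j - r, c ord0 j + r]%classic)); last first.
  by move=> j; exact: measurable_itv.
transitivity (\prod_(i < n) (2 * r)%:E)%E.
  apply: eq_bigr => i _; rewrite lebesgue_measure_itv/= lte_fin.
  case: ltP => [_|H]; first by congr EFin; lra.
  by congr EFin; lra.
by rewrite prodEFin prodr_const card_ord.
Qed.

Lemma inQ_boxE (i : idx n) : [set x | inQ i x] = [set x : 'rV[R]_n | forall j,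
  (`[corner i ord0 j, corner i ord0 j + side i.1[%classic : set R) (x ord0 j)].
Proof.
apply/seteqP; split=> x /=; first by move/inQP=> H j; rewrite in_itv/=; exact: H.
by move=> H; apply/inQP => j; have := H j; rewrite in_itv.
Qed.

Lemma measurable_inQ (i : idx n) : measurable [set x : 'rV[R]_n | inQ i x].
Proof.
rewrite inQ_boxE; apply: (@measurable_box (fun j =>
  `[corner i ord0 j, corner i ord0 j + side i.1[%classic)) => j.
exact: measurable_itv.
Qed.

Lemma lebesgue_inQ (i : idx n) : mu [set x | inQ i x] = (vol n i.1)%:E.
Proof.
rewrite inQ_boxE (@lebesgue_row_box _ _ (fun j =>
  `[corner i ord0 j, corner i ord0 j + side i.1[%classic)); last first.
  by move=> j; exact: measurable_itv.
transitivity (\prod_(j < n) (side i.1 : R)%:E)%E.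
  apply: eq_bigr => j _; rewrite lebesgue_measure_itv/= lte_fin ltrDl side_gt0.
  by rewrite -EFinB addrC addKr.
by rewrite prodEFin prodr_const card_ord.
Qed.

Lemma exists_side_lt (e : R) : 0 < e -> exists k : int, side k < e.
Proof.
move=> e0; exists (- (Num.trunc e^-1).+1%:Z); rewrite /side -invr_expz.
rewrite -[ltRHS]invrK ltf_pV2 ?posrE ?invr_gt0 ?exprn_gt0//.
have := truncnS_gt e^-1; move/lt_trans; apply.
by rewrite -exprnP -natrX ltr_nat ltn_expl.
Qed.

(** An open set is the union of the countably many dyadic cubes it contains. *)
Lemma open_measurable_row (U : set 'rV[R]_n) : open U -> measurable U.
Proof.
move=> oU.
rewrite (_ : U = \bigcup_(i : idx n)
   (if `[< [set x | inQ i x] `<=` U >] then [set x | inQ i x] else set0)).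
  apply: countable_bigcupT_measurable; first exact: countableP.
  by move=> i; case: ifPn => // _; exact: measurable_inQ.
apply/seteqP; split => [x Ux|x [i _]]; last first.
  by case: ifPn => // /asboolP; exact.
have /nbhs_ballP[e /= e0 xe] := open_nbhs_nbhs (conj oU Ux).
have [k ke] := @exists_side_lt (e / 2) (divr_gt0 e0 (ltr0Sn _ 1)).
exists (cell k x) => //; case: ifPn => [_|/asboolP[]]; first exact: inQ_cell.
move=> y /= yk; apply: xe; rewrite mx_norm_ball /ball_ /=.
have h1 := inQ_dist yk; have h2 := inQ_dist (inQ_cell k x).
rewrite (_ : x - y = (x - corner (cell k x)) - (y - corner (cell k x))); last first.
  by rewrite opprB addrA subrK.
rewrite (le_lt_trans (ler_normB _ _))//; move: h1 h2; rewrite /=; lra.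
Qed.

Lemma continuous_measurable_row (f : 'rV[R]_n -> R) : continuous f ->
  measurable_fun setT f.
Proof.
move=> cf; apply: (measurability _ (RGenOInfty.measurableE R)) => //.
move=> _ [_ [a ->] <-]; rewrite setTI; apply: open_measurable_row.
by move/continuousP : cf; apply; exact: interval_open.
Qed.

End measurability.

(** * The integral as a functional on real functions *)
Section functional.
Context {R : realType} {n : nat}.
Local Notation mu := (@lebesgue_row R n).
Implicit Types (f g h : 'rV[R]_n -> R) (p : 'rV[R]_n -> bool).

Definition itg f : Prop := mu.-integrable setT (EFin \o f).
Definition Int f : R := \int[mu]_x f x.

Lemma itg_mf f : itg f -> measurable_fun setT f.
Proof. by move=> /measurable_int /measurable_EFinP. Qed.

Lemma eq_itg f g : f =1 g -> itg f -> itg g.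
Proof. by move=> /funext ->. Qed.

Lemma eq_Int f g : f =1 g -> Int f = Int g.
Proof. by move=> /funext ->. Qed.

Lemma itgD f g : itg f -> itg g -> itg (fun x => f x + g x).
Proof. by move=> If Ig; exact: integrableD If Ig. Qed.

Lemma itgZ (a : R) f : itg f -> itg (fun x => a * f x).
Proof. by move=> If; exact: integrableZl If. Qed.

Lemma itgB f g : itg f -> itg g -> itg (fun x => f x - g x).
Proof. by move=> If Ig; exact: integrableB If Ig. Qed.

Lemma itg0 : itg (fun=> 0).
Proof. exact: integrable0. Qed.

Lemma itg_sum (I : Type) (s : seq I) (P : pred I) (F : I -> 'rV[R]_n -> R) :
  (forall i, P i -> itg (F i)) -> itg (fun x => \sum_(i <- s | P i) F i x).
Proof.
move=> H; rewrite /itg (_ : EFin \o _ =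
    (fun x => \sum_(i <- s | P i) (F i x)%:E)%E).
  by apply: integrable_sum => // i Pi; exact: H.
by apply/funext => x /=; rewrite sumEFin.
Qed.

Lemma itg_norm f : itg f -> itg (fun x => `|f x|).
Proof. exact: integrable_norm. Qed.

Lemma le_itg f g : measurable_fun setT f -> (forall x, `|f x| <= g x) ->
  itg g -> itg f.
Proof.
move=> mf fg; apply: le_integrable => //; first exact/measurable_EFinP.
by move=> x _ /=; rewrite lee_fin (le_trans (fg x))// ler_norm.
Qed.

Lemma itgMl h f (M : R) : measurable_fun setT h -> (forall x, `|h x| <= M) ->
  itg f -> itg (fun x => h x * f x).
Proof.
move=> mh hM If.
have -> : itg (fun x => h x * f x) = mu.-integrable setT ((EFin \o h) \* (EFin \o f))%E by [].
apply: integrableMr => //.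
exists M; split; first exact: num_real.
by move=> y My x _; apply: le_trans (hM x) _; exact: ltW.
Qed.

Lemma IntD f g : itg f -> itg g -> Int (fun x => f x + g x) = Int f + Int g.
Proof. by move=> If Ig; exact: RintegralD. Qed.

Lemma IntB f g : itg f -> itg g -> Int (fun x => f x - g x) = Int f - Int g.
Proof. by move=> If Ig; exact: RintegralB. Qed.

Lemma IntZ (a : R) f : itg f -> Int (fun x => a * f x) = a * Int f.
Proof. by move=> If; exact: RintegralZl. Qed.

Lemma Int0 : Int (fun=> 0) = 0.
Proof. by rewrite /Int Rintegral_cst// mul0r. Qed.

Lemma Int_sum (I : Type) (s : seq I) (P : pred I) (F : I -> 'rV[R]_n -> R) :
  (forall i, P i -> itg (F i)) ->
  Int (fun x => \sum_(i <- s | P i) F i x) = \sum_(i <- s | P i) Int (F i).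
Proof.
move=> H; elim: s => [|i s IH].
  by rewrite big_nil -[RHS]Int0; apply: eq_Int => x; rewrite big_nil.
rewrite big_cons; case: ifPn => Pi.
  rewrite -IH -IntD//; [|exact: H|exact: itg_sum].
  by apply: eq_Int => x; rewrite big_cons Pi.
by rewrite -IH; apply: eq_Int => x; rewrite big_cons (negbTE Pi).
Qed.

Lemma Int_ge0 f : (forall x, 0 <= f x) -> 0 <= Int f.
Proof. by move=> f0; exact: Rintegral_ge0. Qed.

Lemma le_Int f g : itg f -> itg g -> (forall x, f x <= g x) -> Int f <= Int g.
Proof. by move=> If Ig fg; apply: le_Rintegral. Qed.

Lemma le_norm_Int f : itg f -> `|Int f| <= Int (fun x => `|f x|).
Proof. by move=> If; exact: le_normr_Rintegral. Qed.

Lemma EFin_Int f : itg f -> (Int f)%:E = (\int[mu]_x (f x)%:E)%E.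
Proof. by move=> If; rewrite fineK//; exact: integrable_fin_num. Qed.

Lemma ae_eq_Int f g : itg f -> itg g ->
  (\forall x \ae mu, f x = g x) -> Int f = Int g.
Proof.
move=> If Ig fg; congr fine; apply: ae_eq_integral => //.
- exact: measurable_int If.
- exact: measurable_int Ig.
- by apply: filterS fg => x /= ->.
Qed.

(** Replacing [g] by the maximum of [f] and [g] turns the almost everywhere
    inequality into a pointwise one. *)
Lemma ae_le_Int f g : itg f -> itg g -> (\forall x \ae mu, f x <= g x) ->
  Int f <= Int g.
Proof.
move=> If Ig fg.
have Imax : itg (fun x => Num.max (f x) (g x)).
  apply: le_itg (itgD (itg_norm If) (itg_norm Ig)).
    by apply: measurable_maxr; exact: itg_mf.
  by move=> x; case: (leP (f x) (g x)) => _; rewrite ?lerDl ?lerDr.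
rewrite (@ae_eq_Int g (fun x => Num.max (f x) (g x)))//.
  by apply: le_Int => // x; rewrite le_max lexx.
by apply: filterS fg => x /= /max_idPr ->.
Qed.

Lemma indicE_bool p x : \1_[set x | p x] x = (p x)%:R :> R.
Proof. by rewrite indicE; congr (nat_of_bool _)%:R; apply/idP/idP; rewrite inE. Qed.

Lemma measurable_ind p : measurable [set x | p x] ->
  measurable_fun setT (fun x => (p x)%:R : R).
Proof.
move=> mp; rewrite (_ : (fun _ => _) = \1_[set x | p x]).
  exact: measurable_indic.
by apply/funext => x; rewrite indicE_bool.
Qed.

Lemma ind_norm_le1 p x : `|(p x)%:R : R| <= 1.
Proof. by case: (p x); rewrite ?normr1 ?normr0. Qed.

Lemma itg_ind p : measurable [set x | p x] -> (mu [set x | p x] < +oo)%E ->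
  itg (fun x => (p x)%:R).
Proof.
move=> mp fp; apply/integrableP; split; first by apply/measurable_EFinP; exact: measurable_ind.
rewrite (_ : (fun _ => _) = (fun x => (\1_[set x | p x] x)%:E)).
  by rewrite integral_indic// setIT.
by apply/funext => x; rewrite /= ger0_norm// indicE_bool.
Qed.

Lemma Int_ind p : measurable [set x | p x] ->
  Int (fun x => (p x)%:R) = fine (mu [set x | p x]).
Proof.
move=> mp; rewrite /Int /Rintegral (_ : (fun _ => _) = (fun x => (\1_[set x | p x] x)%:E)).
  by rewrite integral_indic// setIT.
by apply/funext => x; rewrite indicE_bool.
Qed.

Lemma itg_indM p f : measurable [set x | p x] -> itg f ->
  itg (fun x => (p x)%:R * f x).
Proof.
by move=> mp; apply: itgMl; [exact: measurable_ind|exact: ind_norm_le1].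
Qed.

Section sq.
Variables (c : 'rV[R]_n) (r : R) (r0 : 0 <= r).

Lemma itg_sq : itg (fun x => (insq c r x)%:R).
Proof. by apply: itg_ind; [exact: measurable_sq|rewrite lebesgue_sq ?ltry]. Qed.

Lemma Int_sq : Int (fun x => (insq c r x)%:R) = (2 * r) ^+ n.
Proof. by rewrite Int_ind ?lebesgue_sq//; exact: measurable_sq. Qed.

Lemma itg_supp_sq f (M : R) : measurable_fun setT f ->
  (forall x, `|f x| <= M) -> (forall x, f x != 0 -> insq c r x) -> itg f.
Proof.
move=> mf fM fs; apply: le_itg mf _ (itgZ M itg_sq) => x.
have [xc|xc] := boolP (insq c r x); first by rewrite mulr1.
suff -> : f x = 0 by rewrite normr0 mulr0.
by apply: contraNeq xc => /fs.
Qed.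

End sq.

Lemma itg_inQ (i : idx n) : itg (fun x => (inQ i x)%:R).
Proof. by apply: itg_ind; [exact: measurable_inQ|rewrite lebesgue_inQ ?ltry]. Qed.

Lemma Int_inQ (i : idx n) : Int (fun x => (inQ i x)%:R) = vol n i.1.
Proof. by rewrite Int_ind ?lebesgue_inQ//; exact: measurable_inQ. Qed.

End functional.

(** * Affine changes of variables *)
Section affine.
Context {R : realType}.

Local Definition aff (y t a : R) : R := t^-1 * (y - a).

Lemma measurable_aff (y t : R) : measurable_fun setT (aff y t : measurableTypeR R -> measurableTypeR R).
Proof.
rewrite /aff; apply: measurable_funM => //.
exact: measurable_funB.
Qed.

Lemma lebesgue_aff (y t : R) (A : set R) : 0 < t -> measurable A ->
  (@lebesgue_measure R) (aff y t @^-1` A) = (t%:E * (@lebesgue_measure R) A)%E.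
Proof.
move=> t0 mA.
have it0 : 0 <= t^-1 by rewrite invr_ge0 ltW.
pose pm : {measure set (measurableTypeR R) -> \bar R} :=
  measure_function_pushforward__canonical__measure_function_Measure
    (@lebesgue_measure R) (measurable_aff y t).
pose m1 : {measure set (measurableTypeR R) -> \bar R} := mscale (NngNum it0) pm.
rewrite (@lebesgue_measure_unique _ m1 _ A mA).
  rewrite /m1 /= /mscale /= muleA -EFinM mulfV ?gt_eqF// mul1e.
  by rewrite  /pushforward.
move=> _ /ocitvP[->|[[a b] /= ab ->]]; first by rewrite !measure0.
rewrite /m1 /= /mscale /= /pushforward.
rewrite (_ : aff y t @^-1` _ = `[y - t * b, y - t * a[%classic).
  have h : y - t * b < y - t * a by rewrite ltrD2l ltrN2 ltr_pM2l.
  rewrite !lebesgue_measure_itv /= !lte_fin ab h.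
  by rewrite -!EFinB -EFinM; congr EFin; field; rewrite gt_eqF.
apply/seteqP; split => x /=; rewrite !in_itv/= /aff ltr_pdivlMl// ler_pdivrMl//; lra.
Qed.
Context {n : nat}.
Local Notation mu := (@lebesgue_row R n).

Definition box (B : set 'rV[R]_n) : Prop :=
  exists2 A : 'I_n -> set R, (forall i, measurable (A i)) &
    B = [set x | forall i, A i (x ord0 i)].

Lemma boxI : setI_closed box.
Proof.
move=> _ _ [A mA ->] [A' mA' ->]; exists (fun i => A i `&` A' i).
  by move=> i; exact: measurableI.
apply/seteqP; split => x /=; first by move=> [h1 h2] i.
by move=> h; split => i; have [] := h i.
Qed.

Lemma measurable_rowE : @measurable _ 'rV[R]_n = <<s box >>.
Proof.
apply/seteqP; split.
  apply: smallest_sub; first exact: smallest_sigma_algebra.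
  rewrite -bigcup_seq => B [i _ [C mC <-]]; apply: sub_sigma_algebra.
  exists (fun j => if j == i then C else setT).
    by move=> j; case: ifP.
  rewrite setTI; apply/seteqP; split => x /=.
    by move=> Cx j; case: eqP => // ->.
  by move=> /(_ i); rewrite eqxx.
apply: smallest_sub; first exact: sigma_algebra_measurable.
by move=> _ [A mA ->]; exact: measurable_box.
Qed.

Definition affv (y : 'rV[R]_n) (t : R) (x : 'rV[R]_n) : 'rV[R]_n :=
  t^-1 *: (y - x).

Lemma measurable_affv y t : measurable_fun setT (affv y t).
Proof.
apply: measurable_fun_rowP => i.
rewrite (_ : (fun x => _) = aff (y ord0 i) t \o (fun x : 'rV[R]_n => x ord0 i)).
  apply: measurableT_comp; first exact: measurable_aff.
  exact: measurable_row_coord.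
by apply/funext => x; rewrite /= !mxE.
Qed.

(** Both sides are measures in [B] that agree on boxes, by the one-dimensional
    case. *)
Lemma lebesgue_affv y t (B : set 'rV[R]_n) : 0 < t -> measurable B ->
  mu (affv y t @^-1` B) = ((t ^+ n)%:E * mu B)%E.
Proof.
move=> t0 mB.
have tn0 : 0 <= t ^+ n by rewrite exprn_ge0 ?ltW.
pose m1 : {measure set 'rV[R]_n -> \bar R} :=
  measure_function_pushforward__canonical__measure_function_Measure
    mu (measurable_affv y t).
pose m2 : {measure set 'rV[R]_n -> \bar R} := mscale (NngNum tn0) mu.
suff : m1 B = m2 B by [].
have box_eq A : box A -> m1 A = m2 A.
  move=> [A' mA' ->]; rewrite /m1 /m2 /= /mscale /pushforward/=.
  rewrite (@lebesgue_row_box _ _ A')//.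
  rewrite (_ : affv y t @^-1` _ =
    [set x | forall i, (aff (y ord0 i) t @^-1` A' i) (x ord0 i)]); last first.
    by apply/seteqP; split => x /= + i => /(_ i); rewrite !mxE.
  rewrite (@lebesgue_row_box _ _ (fun i => aff (y ord0 i) t @^-1` A' i));
      last first.
    move=> i; rewrite -[X in measurable X]setTI.
    by apply: (measurable_aff (y ord0 i) t) => //; exact: mA'.
  under eq_bigr do rewrite lebesgue_aff//.
  by rewrite big_split/= prodEFin prodr_const card_ord.
pose g (k : nat) : set 'rV[R]_n := [set x | insq 0 k%:R x].
have gbox k : box (g k).
  exists (fun=> `[- k%:R, k%:R]%classic) => [j|]; first exact: measurable_itv.
  rewrite /g /insq sqE//; apply/seteqP.
  by split => x /= + j => /(_ j); rewrite mxE sub0r add0r.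
apply: (measure_unique box g measurable_rowE boxI gbox) => //.
- apply/seteqP; split => // x _; exists (Num.trunc `|x|).+1 => //=.
  by rewrite /g /insq /= subr0 ltW// truncnS_gt.
- move=> k; rewrite box_eq// /m2 /= /mscale /=.
  by rewrite lebesgue_sq// -EFinM ltry.
Qed.

(** The change of variables multiplies the integral by the Jacobian, so that dilates
    of a test function keep mean zero. *)
Lemma Int_affv y t (f : 'rV[R]_n -> R) : 0 < t -> itg f ->
  itg (f \o affv y t) -> Int f = 0 -> Int (f \o affv y t) = 0.
Proof.
move=> t0 If Ifa; rewrite /Int /Rintegral.
have mf : measurable_fun setT (EFin \o f) by exact: measurable_int If.
have tn0 : 0 <= t ^+ n by rewrite exprn_ge0 ?ltW.
pose m1 : {measure set 'rV[R]_n -> \bar R} :=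
  measure_function_pushforward__canonical__measure_function_Measure
    mu (measurable_affv y t).
have E g : measurable_fun setT g -> (forall x, (0 <= g x)%E) ->
    (\int[m1]_x g x = (t ^+ n)%:E * \int[mu]_x g x)%E.
  move=> mg g0; rewrite -(ge0_integral_mscale mu measurableT (NngNum tn0))//.
  apply: (@eq_measure_integral _ _ _ _ (mscale (NngNum tn0) mu) m1) => A mA _.
  exact: lebesgue_affv.
have P : (\int[m1]_x (f x)%:E = \int[mu]_x (f (affv y t x))%:E)%E.
  exact: (integral_pushforward (measurable_affv y t) mf Ifa measurableT).
rewrite -P integralE [in X in _ -> X]integralE.
rewrite !E//; [|exact: measurable_funeneg|exact: measurable_funepos].
have /fineK <- := integrable_pos_fin_num measurableT If.
have /fineK <- := integrable_neg_fin_num measurableT If.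
rewrite -!EFinM -!EFinB /= => /eqP; rewrite subr_eq0 => /eqP ->.
by rewrite subrr.
Qed.

End affine.

(** * Finite sums over scales *)
Section finite_sums.
Context {R : realType}.

Lemma geometric_le (q : R) (D : nat) : 0 <= q < 1 ->
  \sum_(d < D) q ^+ d <= (1 - q)^-1.
Proof.
move=> /andP[q0 q1]; rewrite -[leRHS]mul1r ler_pdivlMr ?subr_gt0//.
have -> : (\sum_(d < D) q ^+ d) * (1 - q) = 1 - q ^+ D.
  by rewrite -[1 - q ^+ D]opprB subrX1; ring.
by rewrite gerBl exprn_ge0.
Qed.

(** A bounded contribution of each scale sums to a bounded total once it is
    damped geometrically in the scale; every sum over scales below is of this
    form. *)
Lemma sum_by_level (I : eqType) (s : seq I) (P : pred I) (lev : I -> nat)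
    (a : I -> R) (A q : R) : 0 <= q < 1 -> 0 <= A ->
  (forall d, \sum_(i <- s | P i && (lev i == d)) a i <= A) ->
  \sum_(i <- s | P i) q ^+ lev i * a i <= A / (1 - q).
Proof.
move=> q01 A0 H; have /andP[q0 q1] := q01.
pose D := (\max_(i <- s) lev i).+1.
rewrite (partition_big (fun i => inord (lev i) : 'I_D) xpredT)//=.
apply: (@le_trans _ _ (\sum_(d < D) q ^+ d * A)); last first.
  by rewrite -mulr_suml mulrC ler_wpM2l// geometric_le.
apply: ler_sum => d _.
have E i : i \in s -> ((inord (lev i) : 'I_D) == d) = (lev i == d).
  move=> si; rewrite -val_eqE/= inordK// ltnS.
  exact: (@leq_bigmax_seq _ s xpredT).
rewrite big_seq_cond.
rewrite (eq_bigl (fun i => (i \in s) && (P i && (lev i == d)))); last first.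
  by move=> i; case si : (i \in s) => //=; rewrite E.
rewrite -big_seq_cond.
apply: (@le_trans _ _ (q ^+ d * \sum_(i <- s | P i && (lev i == d)) a i)).
  by rewrite mulr_sumr; apply: ler_sum => i /andP[_ /eqP ->].
by rewrite ler_wpM2l// exprn_ge0.
Qed.

Lemma ler_sum_cond (I : Type) (s : seq I) (P Q : pred I) (a : I -> R) :
  (forall i, P i -> Q i) -> (forall i, 0 <= a i) ->
  \sum_(i <- s | P i) a i <= \sum_(i <- s | Q i) a i.
Proof.
move=> PQ a0; rewrite big_mkcond [leRHS]big_mkcond/=; apply: ler_sum => i _.
by have := PQ i; case: (P i) => [->|_]//; case: (Q i).
Qed.

End finite_sums.

(** * Disjoint families of dyadic cubes *)
Section disjoint_cells.
Context {R : realType} {n : nat}.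
Implicit Types (s : seq (idx n)) (c : 'rV[R]_n) (r : R).

(** Pairwise disjointness of a list of cubes, said with indicator functions:
    this is the form in which it is integrated. *)
Definition disj s : Prop :=
  forall x : 'rV[R]_n, \sum_(i <- s) (inQ i x)%:R <= 1 :> R.

Lemma disj_level s k : uniq s -> disj [seq i <- s | i.1 == k].
Proof.
move=> us x; rewrite big_filter big_mkcond/=.
apply: (@le_trans _ _ (\sum_(i <- s) (if i == cell k x then 1 else 0))).
  apply: ler_sum => i _; case: ifP => [/eqP ik|_]; last by case: ifP.
  have [E|E] := boolP (inQ i x); last by case: ifP.
  by rewrite (inQ_uniq E (inQ_cell k x) ik) eqxx.
rewrite -big_mkcond/= -big_filter; have := filter_uniq (pred1 (cell k x)) us.
have [|] := boolP (cell k x \in s) => ks.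
  by rewrite filter_pred1_uniq// big_seq1.
by rewrite (@eq_in_filter _ _ pred0) ?filter_pred0 ?big_nil// => i si; apply: contraNF ks => /eqP <-.
Qed.

Lemma disj_Int s (P : pred (idx n)) (p : 'rV[R]_n -> bool) (h : 'rV[R]_n -> R) :
  disj s -> measurable [set x | p x] -> (forall x, 0 <= h x) ->
  (forall i x, i \in s -> P i -> inQ i x -> p x) ->
  (forall i, i \in s -> P i -> itg (fun x => (inQ i x)%:R * h x)) ->
  itg (fun x => (p x)%:R * h x) ->
  \sum_(i <- s | P i) Int (fun x => (inQ i x)%:R * h x) <=
    Int (fun x => (p x)%:R * h x).
Proof.
move=> ds mp h0 H Ih Ip; rewrite big_seq_cond -Int_sum; last first.
  by move=> i /andP[? ?]; exact: Ih.
apply: le_Int => //; first by apply: itg_sum => i /andP[? ?]; exact: Ih.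
move=> x; rewrite -mulr_suml ler_wpM2r// -big_seq_cond.
have [px|px] := boolP (p x).
  apply: le_trans (ds x).
  exact: (@ler_sum_cond R _ s P xpredT (fun i => (inQ i x)%:R)).
rewrite big_seq_cond big1// => i /andP[si Pi].
by case E: (inQ i x) => //; rewrite (H i x) in px.
Qed.

Lemma disj_vol s (P : pred (idx n)) c r : disj s -> 0 <= r ->
  (forall i x, i \in s -> P i -> inQ i x -> insq c r x) ->
  \sum_(i <- s | P i) vol n i.1 <= (2 * r) ^+ n.
Proof.
move=> ds r0 H; rewrite -(Int_sq c r0).
have E p : Int (fun x => (p x)%:R) = Int (fun x => (p x)%:R * 1) :> R.
  by apply: eq_Int => x; rewrite mulr1.
rewrite E; under eq_bigr do rewrite -(@Int_inQ R n) E.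
apply: disj_Int => //; first exact: measurable_sq.
  by move=> i _ _; apply: eq_itg (itg_inQ i) => x; rewrite mulr1.
by apply: eq_itg (itg_sq c r0) => x; rewrite mulr1.
Qed.

(** Cubes of one size with corners near c are few, by volume. *)
Lemma count_near s k c r : uniq s -> 0 <= r ->
  \sum_(i <- s | (i.1 == k) && (`|corner i - c| <= r)) vol n k <=
    (2 * (r + side k)) ^+ n.
Proof.
move=> us r0; rewrite (eq_bigr (fun i => vol n i.1)); last first.
  by move=> i /andP[/eqP -> _].
rewrite -big_filter_cond.
apply: (@disj_vol _ (fun i => `|corner i - c| <= r) c); first exact: disj_level.
  by rewrite addr_ge0 ?side_ge0.
move=> i x; rewrite mem_filter => /andP[/eqP ik _] ir /inQ_dist; rewrite ik => xi.
rewrite /insq (_ : x - c = (corner i - c) + (x - corner i)).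
  by rewrite (le_trans (ler_normD _ _))// lerD.
by rewrite [RHS]addrC addrA subrK.
Qed.

End disjoint_cells.

(** * Atoms *)
Section atoms.
Context {R : realType} {n : nat}.
Local Notation mu := (@lebesgue_row R n).
Variable alpha : R.
Hypothesis alpha01 : 0 < alpha <= 1.
Implicit Types (i j : idx n) (s : seq (idx n)) (f g h psi : 'rV[R]_n -> R).

Let alpha0 : 0 < alpha. Proof. by case/andP: alpha01. Qed.
Let alpha1 : alpha <= 1. Proof. by case/andP: alpha01. Qed.

(** The normalization is the one enjoyed by z |-> phi_t (y - z) when y lies in
    the cube and t is between its side and twice its side: the radius 3 is
    2 (for |y - z| <= t) plus 1 (for the distance from y to the corner), and
    n+1 absorbs the comparison of the Euclidean norm with the sup norm. *)
Definition atom i psi : Prop :=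
  [/\ measurable_fun setT psi,
      forall x, psi x != 0 -> insq (corner i) (3 * side i.1) x,
      forall x, `|psi x| <= 2 / vol n i.1,
      forall x y, `|psi x - psi y| <=
        n.+1%:R / vol n i.1 * (`|x - y| / side i.1) `^ alpha &
      Int psi = 0].

Definition decay : R := 2 `^ (- alpha).

Lemma decay01 : 0 <= decay < 1.
Proof.
rewrite powR_ge0/= /decay powRN invf_lt1 ?powR_gt0//.
have : 1 `^ alpha < 2 `^ alpha :> R by rewrite gt0_ltr_powR ?nnegrE// ltr1n.
by rewrite powR1.
Qed.

Lemma decay_pow (a : R) (d : nat) : 1 <= a -> (a / 2 ^+ d) `^ alpha <= a * decay ^+ d.
Proof.
move=> a1; have a0 : 0 <= a by exact: le_trans a1.
rewrite powRM ?invr_ge0 ?exprn_ge0// ler_pM ?powR_ge0//.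
  by rewrite -[leRHS]powRr1// ler_powR.
rewrite -powR_invn// -powRrM /decay -powR_mulrn ?powR_ge0// -powRrM.
by rewrite mulrC mulrN mulNr.
Qed.

Lemma atom_itg i psi : atom i psi -> itg psi.
Proof.
move=> [m s b _ _]; apply: (itg_supp_sq (c := corner i)) m b s.
by rewrite mulr_ge0 ?side_ge0.
Qed.

Lemma atom_itgM i psi h : atom i psi -> itg h -> itg (fun x => psi x * h x).
Proof. by move=> [m _ b _ _]; exact: itgMl. Qed.

Lemma atom_eq0 i psi x : atom i psi -> ~~ insq (corner i) (3 * side i.1) x -> psi x = 0.
Proof. by move=> [_ s _ _ _]; apply: contraNeq => /s. Qed.

(** For j the larger cube, supports of radius 3 times the sides can only meet
    under this condition. *)
Definition near_idx i j : bool := `|corner i - corner j : 'rV[R]_n| <= 6 * side j.1.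

Definition gram_cst : R := 6 * n.+1%:R * 6 ^+ n.

(** The atom of the smaller cube has mean zero, so the atom of the larger cube may
    be replaced by its oscillation on the support of the smaller one, where
    Hoelder continuity gains a power of the ratio of the sides. *)
Lemma gram i j psi psi' : atom i psi -> atom j psi' -> i.1 <= j.1 ->
  `|Int (fun x => psi x * psi' x)| <=
  gram_cst * (decay ^+ `|j.1 - i.1|%N * (near_idx i j)%:R) / vol n j.1.
Proof.
move=> ai aj ij; have [mi si bi hi ci] := ai; have [mj sj bj hj cj] := aj.
have [nij|nij] := boolP (near_idx i j); last first.
  rewrite (@eq_Int _ _ _ (fun=> 0)) ?Int0 ?normr0 ?mulr0 ?mul0r// => x.
  have [xi|/(atom_eq0 ai) ->] := boolP (insq (corner i) (3 * side i.1) x); last by rewrite mul0r.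
  have [xj|/(atom_eq0 aj) ->] := boolP (insq (corner j) (3 * side j.1) x); last by rewrite mulr0.
  exfalso; move/negP: nij; apply; rewrite /near_idx.
  rewrite /insq in xi xj; rewrite -(subrK x (corner i)) -addrA.
  apply: le_trans (ler_normD _ _) _; rewrite -normrN opprB.
  have : side i.1 <= side j.1 :> R by rewrite ler_side.
  by lra.
rewrite mulr1.
pose phi x := psi x * (psi' x - psi' (corner i)).
have Ipc : itg (fun x => psi' (corner i) * psi x) by apply: itgZ; exact: atom_itg ai.
have Ipp : itg (fun x => psi x * psi' x) by exact: atom_itgM ai (atom_itg aj).
have -> : Int (fun x => psi x * psi' x) = Int phi.
  transitivity (Int (fun x => psi x * psi' x) - Int (fun x => psi' (corner i) * psi x)).
    by rewrite (IntZ _ (atom_itg ai)) ci mulr0 subr0.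
  by rewrite -IntB//; apply: eq_Int => x; rewrite /phi mulrBr [_ * psi x]mulrC.
have Iphi : itg phi.
  by apply: eq_itg (itgB Ipp Ipc) => x; rewrite /phi mulrBr [_ * psi x]mulrC.
apply: le_trans (le_norm_Int Iphi) _.
have s0 : 0 <= 3 * side i.1 :> R by rewrite mulr_ge0 ?side_ge0.
set d := `|_|%N.
have sjE : side j.1 = 2 ^+ d * side i.1 :> R.
  by rewrite -sideDn; congr side; rewrite /d; lia.
pose K := 2 / vol n i.1 * (n.+1%:R / vol n j.1 * (3 * decay ^+ d)).
have KE : K * (2 * (3 * side i.1)) ^+ n = gram_cst * decay ^+ d / vol n j.1.
  rewrite /K /gram_cst (_ : 2 * (3 * side i.1) = 6 * side i.1); last by ring.
  rewrite exprMn -/(vol n i.1); have := vol_neq0 (R := R) (n := n) i.1.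
  have := vol_neq0 (R := R) (n := n) j.1.
  by move=> ? ?; field; apply/andP.
rewrite -KE -(Int_sq (corner i) s0) -IntZ; last exact: itg_sq.
apply: le_Int; [exact: itg_norm|by apply: itgZ; exact: itg_sq|move=> x].
have [xi|/(atom_eq0 ai) E] := boolP (insq (corner i) (3 * side i.1) x); last first.
  by rewrite /phi E mul0r normr0 mulr0.
rewrite mulr1 /phi normrM ler_pM// (le_trans (hj _ _))//.
rewrite ler_wpM2l ?divr_ge0 ?vol_ge0//.
apply: le_trans (decay_pow d _); last by lra.
apply: ge0_ler_powR; first exact: ltW.
- by rewrite nnegrE divr_ge0 ?side_ge0.
- by rewrite nnegrE divr_ge0 ?exprn_ge0.
rewrite sjE invfM mulrA ler_pdivrMr ?side_gt0//.
by rewrite mulrAC ler_wpM2r ?invr_ge0 ?exprn_ge0.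
Qed.

End atoms.
Arguments near_idx R {n} i j.

(** * Almost orthogonality *)
Section almost_orthogonality.
Context {R : realType} {n : nat}.
Variable alpha : R.
Hypothesis alpha01 : 0 < alpha <= 1.
Implicit Types (i j : idx n) (s : seq (idx n)) (f g h : 'rV[R]_n -> R).
Variable psi : idx n -> 'rV[R]_n -> R.
Hypothesis psiP : forall i, atom alpha i (psi i).

Local Notation q := (decay alpha).
Local Notation G := (gram_cst (R := R) (n := n)).

Lemma gram_cst_gt0 : 0 < G.
Proof. by rewrite !mulr_gt0// exprn_gt0. Qed.

(** Fixing one cube, the smaller cubes near it fill a bounded multiple of its
    volume at each scale. *)
Lemma sum_near_le s (j : idx n) : uniq s ->
  \sum_(i <- s | i.1 <= j.1) q ^+ `|j.1 - i.1|%N * ((near_idx R i j)%:R * vol n i.1) <=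
    14 ^+ n * vol n j.1 / (1 - q).
Proof.
move=> us; apply: sum_by_level; first exact: decay01.
  by rewrite mulr_ge0 ?vol_ge0 ?exprn_ge0.
move=> d; apply: (@le_trans _ _ (\sum_(i <- s | (i.1 == j.1 - d%:Z) &&
    (`|corner i - corner j : 'rV[R]_n| <= 6 * side j.1)) vol n (j.1 - d%:Z))).
  rewrite big_mkcond [leRHS]big_mkcond; apply: ler_sum => i _.
  case: ifPn => [/andP[ij /eqP Ed]|_]; last by case: ifP => // _; exact: vol_ge0.
  have -> : i.1 = j.1 - d%:Z by lia.
  by rewrite eqxx /near_idx /=; case: ifP => _; rewrite ?mul1r ?mul0r.
have r0 : 0 <= 6 * side j.1 :> R by rewrite mulr_ge0 ?side_ge0.
apply: le_trans (count_near (j.1 - d%:Z) (corner j) us r0) _.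
rewrite -exprMn lerXn2r ?nnegrE ?mulr_ge0 ?addr_ge0 ?side_ge0//.
have : side (j.1 - d%:Z) <= side j.1 :> R by rewrite ler_side; lia.
lra.
Qed.

(** Fixing one cube, at each larger scale only boundedly many cubes are near
    it. *)
Lemma sum_near_ge s (i : idx n) : uniq s ->
  \sum_(j <- s | i.1 <= j.1) q ^+ `|j.1 - i.1|%N * (near_idx R i j)%:R <=
    14 ^+ n / (1 - q).
Proof.
move=> us; apply: sum_by_level; first exact: decay01.
  by rewrite exprn_ge0.
move=> d; have V0 : 0 < vol n (i.1 + d%:Z) :> R by exact: vol_gt0.
rewrite -(ler_pM2r V0) mulr_suml.
apply: (@le_trans _ _ (\sum_(j <- s | (j.1 == i.1 + d%:Z) &&
    (`|corner j - corner i : 'rV[R]_n| <= 6 * side (i.1 + d%:Z))) vol n (i.1 + d%:Z))).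
  rewrite big_mkcond [leRHS]big_mkcond; apply: ler_sum => j _.
  case: ifPn => [/andP[ij /eqP Ed]|_]; last by case: ifP => // _; exact: vol_ge0.
  have -> : j.1 = i.1 + d%:Z by lia.
  rewrite eqxx /near_idx /= -normrN opprB (_ : j.1 = i.1 + d%:Z); last by lia.
  by case: ifP => _; rewrite ?mul1r ?mul0r.
have r0 : 0 <= 6 * side (i.1 + d%:Z) :> R by rewrite mulr_ge0 ?side_ge0.
apply: le_trans (count_near (i.1 + d%:Z) (corner i) us r0) _.
rewrite -exprMn lerXn2r ?nnegrE ?mulr_ge0 ?addr_ge0 ?side_ge0//.
by have := side_ge0 (R := R) (i.1 + d%:Z); lra.
Qed.

Definition bessel_cst : R := 2 * G * 14 ^+ n / (1 - q).

Lemma bessel_cst_gt0 : 0 < bessel_cst.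
Proof.
have /andP[_ q1] := decay01 alpha01.
by rewrite /bessel_cst !mulr_gt0 ?gram_cst_gt0 ?exprn_gt0 ?invr_gt0 ?subr_gt0.
Qed.

(** Schur test for the Gram matrix. Each product of coefficients is split by
    the inequality of the means; the square of the coefficient of the smaller
    cube is then summed over the larger cubes and conversely, which is what
    [sum_near_ge] and [sum_near_le] provide. *)
Lemma schur s (b : idx n -> R) : uniq s ->
  \sum_(i <- s) \sum_(j <- s)
    (vol n i.1 * b i) * (vol n j.1 * b j) * Int (fun x => psi i x * psi j x) <=
  bessel_cst * \sum_(i <- s) vol n i.1 * b i ^+ 2.
Proof.
move=> us.
pose D i j := q ^+ `|j.1 - i.1|%N * (near_idx R i j)%:R.
pose T i j := (vol n i.1 * b i) * (vol n j.1 * b j) * Int (fun x => psi i x * psi j x).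
pose B i j := vol n i.1 * (b i ^+ 2 + b j ^+ 2) / 2 * G * D i j.
have D0 i j : 0 <= D i j.
  by have /andP[q0 _] := decay01 alpha01; rewrite mulr_ge0// exprn_ge0.
have B0 i j : 0 <= B i j.
  rewrite /B mulr_ge0 ?D0// mulr_ge0 ?(ltW gram_cst_gt0)// divr_ge0//.
  by rewrite mulr_ge0 ?vol_ge0 ?addr_ge0 ?sqr_ge0.
have TB i j : i.1 <= j.1 -> T i j <= B i j.
  move=> ij; have := gram alpha01 (psiP i) (psiP j) ij.
  rewrite -/(D i j); set I := Int _ => gI.
  have gI' : vol n j.1 * `|I| <= G * D i j.
    by rewrite mulrC -ler_pdivlMr ?vol_gt0.
  have bb : `|b i * b j| <= (b i ^+ 2 + b j ^+ 2) / 2.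
    rewrite -(real_normK (num_real (b i))) -(real_normK (num_real (b j))) normrM.
    by have := sqr_ge0 (`|b i| - `|b j|); rewrite sqrrB; lra.
  apply: (@le_trans _ _ (vol n i.1 * `|b i * b j| * (vol n j.1 * `|I|))).
    rewrite /T -/I (_ : _ * I = vol n i.1 * vol n j.1 * (b i * b j * I)); last by ring.
    rewrite [leRHS](_ : _ = vol n i.1 * vol n j.1 * (`|b i * b j| * `|I|)); last by ring.
    by rewrite ler_wpM2l ?mulr_ge0 ?vol_ge0// -normrM ler_norm.
  rewrite /B -[leRHS]mulrA ler_pM//; do ?by rewrite mulr_ge0 ?vol_ge0.
  by rewrite -[leRHS]mulrA ler_wpM2l ?vol_ge0.
have TC i j : T i j = T j i.
  rewrite /T [in RHS](@eq_Int _ _ _ (fun x => psi i x * psi j x)); first by ring.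
  by move=> x; rewrite mulrC.
apply: (@le_trans _ _ (2 * \sum_(i <- s) \sum_(j <- s | i.1 <= j.1) B i j)).
  rewrite [leRHS]mulr_natl mulr2n -[X in X + _]/(\sum_(i <- s) \sum_(j <- s | i.1 <= j.1) B i j).
  have -> : \sum_(i <- s) \sum_(j <- s | i.1 <= j.1) B i j +
      \sum_(i <- s) \sum_(j <- s | i.1 <= j.1) B i j =
      \sum_(i <- s) \sum_(j <- s) ((if i.1 <= j.1 then B i j else 0) +
        (if j.1 <= i.1 then B j i else 0)).
    rewrite [X in _ + X](exchange_big_dep xpredT)//=.
    rewrite -big_split/=; apply: eq_bigr => i _.
    by rewrite big_split/= -!big_mkcond.
  apply: ler_sum => i _; apply: ler_sum => j _; rewrite -/(T i j).
  have [ij|ij] := leP i.1 j.1.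
    by rewrite ler_wpDr ?TB//; case: ifP.
  by rewrite add0r (ltW ij) TC TB// ltW.
rewrite (_ : \sum_(i <- s) \sum_(j <- s | _) _ =
   G / 2 * (\sum_(i <- s) vol n i.1 * b i ^+ 2 * (\sum_(j <- s | i.1 <= j.1) D i j)
     + \sum_(j <- s) b j ^+ 2 * (\sum_(i <- s | i.1 <= j.1) D i j * vol n i.1))); last first.
  have -> : \sum_(j <- s) b j ^+ 2 * (\sum_(i <- s | i.1 <= j.1) D i j * vol n i.1) =
      \sum_(i <- s) \sum_(j <- s | i.1 <= j.1) b j ^+ 2 * (D i j * vol n i.1).
    rewrite [RHS](exchange_big_dep xpredT)//=.
    by apply: eq_bigr => j _; rewrite mulr_sumr.
  rewrite -big_split mulr_sumr/=; apply: eq_bigr => i _.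
  rewrite mulr_sumr -big_split mulr_sumr/=; apply: eq_bigr => j _.
  by rewrite /B; field.
have G0 := gram_cst_gt0.
have -> : bessel_cst * \sum_(i <- s) vol n i.1 * b i ^+ 2 =
    2 * (G / 2 * (\sum_(i <- s) vol n i.1 * b i ^+ 2 * (14 ^+ n / (1 - q)) +
      \sum_(i <- s) b i ^+ 2 * (14 ^+ n * vol n i.1 / (1 - q)))).
  rewrite mulr_sumr -big_split/= !mulr_sumr; apply: eq_bigr => i _.
  rewrite /bessel_cst; field; have /andP[_ q1] := decay01 alpha01.
  by rewrite subr_eq0 eq_sym lt_eqF.
rewrite ler_pM2l// ler_pM2l ?divr_gt0//; apply: lerD; apply: ler_sum => i _.
  apply: ler_wpM2l; first by rewrite mulr_ge0 ?vol_ge0 ?sqr_ge0.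
  exact: sum_near_ge.
apply: ler_wpM2l; first exact: sqr_ge0.
apply: le_trans (sum_near_le i us).
by rewrite le_eqVlt; apply/orP; left; apply/eqP; apply: eq_bigr => j _; rewrite /D mulrA.
Qed.

(** Since the atoms are almost orthogonal, the Schur bound for the Gram matrix
    controls the norm of H, the sum of the atoms with their own coefficients;
    as the left side is the pairing of H with h, half of it can be absorbed. *)
Lemma bessel s h : uniq s -> itg h -> itg (fun x => h x ^+ 2) ->
  \sum_(i <- s) vol n i.1 * Int (fun x => psi i x * h x) ^+ 2 <=
    bessel_cst * Int (fun x => h x ^+ 2).
Proof.
move=> us Ih Ih2.
pose b i := Int (fun x => psi i x * h x).
pose H x := \sum_(i <- s) vol n i.1 * b i * psi i x.
set S := \sum_(i <- s) _.
have IH2 : itg (fun x => H x ^+ 2) /\ Int (fun x => H x ^+ 2) <= bessel_cst * S.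
  have E x : H x ^+ 2 = \sum_(i <- s) \sum_(j <- s)
      (vol n i.1 * b i) * (vol n j.1 * b j) * (psi i x * psi j x).
    rewrite expr2 {1}/H mulr_suml; apply: eq_bigr => i _.
    by rewrite mulr_sumr; apply: eq_bigr => j _; ring.
  have Ipp i j : itg (fun x => psi i x * psi j x).
    exact: atom_itgM (psiP i) (atom_itg (psiP j)).
  split.
    apply: (@eq_itg _ _ _ _ (fun x => esym (E x))).
    by apply: itg_sum => i _; apply: itg_sum => j _; exact: itgZ.
  rewrite (eq_Int E) Int_sum; last first.
    by move=> i _; apply: itg_sum => j _; exact: itgZ.
  apply: le_trans (schur b us); apply: ler_sum => i _.
  rewrite Int_sum; last by move=> j _; exact: itgZ.
  by apply: ler_sum => j _; rewrite IntZ.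
have [iH2 leH2] := IH2.
have Iph i : itg (fun x => psi i x * h x) by exact: atom_itgM (psiP i) Ih.
have EHh x : H x * h x = \sum_(i <- s) vol n i.1 * b i * (psi i x * h x).
  by rewrite /H mulr_suml; apply: eq_bigr => i _; ring.
have IHh : itg (fun x => H x * h x).
  by apply: (@eq_itg _ _ _ _ (fun x => esym (EHh x))); apply: itg_sum => i _; exact: itgZ.
have SE : S = Int (fun x => H x * h x).
  rewrite (eq_Int EHh) Int_sum; last by move=> i _; exact: itgZ.
  by apply: eq_bigr => i _; rewrite IntZ// -/(b i) -mulrA -expr2.
have L0 := bessel_cst_gt0.
(* 2 H h <= L h^2 + H^2 / L, where the second term integrates to at most S. *)
have : Int (fun x => 2 * (H x * h x)) <=
    Int (fun x => bessel_cst * h x ^+ 2 + bessel_cst^-1 * H x ^+ 2).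
  apply: le_Int; [exact: itgZ|by apply: itgD; exact: itgZ|move=> x].
  rewrite -subr_ge0 (_ : _ - _ = bessel_cst^-1 * (bessel_cst * h x - H x) ^+ 2).
    by rewrite mulr_ge0 ?invr_ge0 ?(ltW L0) ?sqr_ge0.
  by field; exact: lt0r_neq0.
rewrite IntD ?IntZ//; [|exact: itgZ|exact: itgZ].
rewrite -SE => H1; have : bessel_cst^-1 * Int (fun x => H x ^+ 2) <= S.
  by rewrite ler_pdivrMl.
lra.
Qed.

End almost_orthogonality.

(** * The weighted Bessel inequality *)
Section weighted_bessel.
Context {R : realType} {n : nat}.
Variable alpha : R.
Hypothesis alpha01 : 0 < alpha <= 1.
Implicit Types (i j : idx n) (s : seq (idx n)) (f g h : 'rV[R]_n -> R).
Variable psi : idx n -> 'rV[R]_n -> R.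
Hypothesis psiP : forall i, atom alpha i (psi i).
Local Notation qst i x := (insq (corner i) (3 * side i.1) x).

Lemma seq_min (I : eqType) (s : seq I) (v : I -> R) : s != [::] ->
  exists2 i : I, i \in s & forall j : I, j \in s -> v i <= v j.
Proof.
elim: s => // a [|b s] IH _; first by exists a; rewrite ?mem_head// => j; rewrite inE => /eqP ->.
have [//|i si H] := IH; have [ai|ia] := leP (v a) (v i).
  exists a; first exact: mem_head.
  by move=> j; rewrite inE => /orP[/eqP ->//|/H]; exact: le_trans.
exists i; first by rewrite inE si orbT.
by move=> j; rewrite inE => /orP[/eqP ->|/H//]; exact: ltW.
Qed.

Lemma measurable_has (I : eqType) (s : seq I) (p : I -> 'rV[R]_n -> bool) :
  (forall i : I, measurable [set x | p i x]) ->
  measurable [set x | has (fun i : I => p i x) s].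
Proof.
move=> mp; elim: s => [|i s IH] /=.
  by rewrite (_ : mkset _ = set0)// -subset0.
rewrite (_ : mkset _ = [set x | p i x] `|` [set x | has (p^~ x) s]).
  exact: measurableU.
by apply/seteqP; split => x /= /orP.
Qed.

(** The pairing of h with an atom only sees h on the support of the atom.
    Peeling off the least of the values [v i], which W dominates on the union E
    of the supports, reduces the claim to the unweighted inequality for h
    restricted to E: a finite layer-cake decomposition of the weight. *)
Lemma weighted_bessel s h (v : idx n -> R) (W : 'rV[R]_n -> R) : uniq s ->
  itg h -> itg (fun x => h x ^+ 2) -> itg (fun x => h x ^+ 2 * W x) ->
  (forall x, 0 <= W x) -> (forall i, i \in s -> 0 <= v i) ->
  (forall i x, i \in s -> qst i x -> v i <= W x) ->
  \sum_(i <- s) vol n i.1 * v i * Int (fun x => psi i x * h x) ^+ 2 <=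
    bessel_cst (n := n) alpha * Int (fun x => h x ^+ 2 * W x).
Proof.
move=> + Ih Ih2; have [m] := ubnP (size s).
elim: m s v W => // m IH s v W sm us IW W0 v0 vW.
have L0 := bessel_cst_gt0 (n := n) alpha01.
have [->|s0] := eqVneq s [::].
  rewrite big_nil mulr_ge0 ?(ltW L0)// Int_ge0// => x.
  by rewrite mulr_ge0 ?sqr_ge0.
have [i0 si0 min0] := seq_min v s0.
pose E (x : 'rV[R]_n) := has (fun i => qst i x) s.
have mE : measurable [set x | E x].
  by apply: measurable_has => i; exact: measurable_sq.
pose b i := Int (fun x => psi i x * h x).
have EhE : (fun x => (E x)%:R * h x ^+ 2) =1 (fun x => ((E x)%:R * h x) ^+ 2).
  by move=> x; case: (E x); rewrite ?mul1r// !mul0r expr0n.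
have h1 : \sum_(i <- s) vol n i.1 * b i ^+ 2 <=
    bessel_cst (n := n) alpha * Int (fun x => (E x)%:R * h x ^+ 2).
  rewrite (eq_Int EhE); have := @bessel R n alpha alpha01 psi psiP s
      (fun x => (E x)%:R * h x) us (itg_indM mE Ih) (eq_itg EhE (itg_indM mE Ih2)).
  apply: le_trans; rewrite le_eqVlt; apply/orP; left; apply/eqP.
  rewrite big_seq [RHS]big_seq; apply: eq_bigr => i si; congr (_ * _ ^+ 2).
  apply: eq_Int => x; have [Ex|Ex] := boolP (E x); first by rewrite mul1r.
  rewrite (atom_eq0 (psiP i)) ?mul0r//; apply: contra Ex => xi.
  by apply/hasP; exists i.
pose W' x := W x - v i0 * (E x)%:R.
have W'0 x : 0 <= W' x.
  rewrite /W'; have [|_] := boolP (E x); last by rewrite mulr0 subr0.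
  move=> /hasP[i si xi]; rewrite mulr1 subr_ge0.
  by apply: le_trans (min0 _ si) _; exact: vW.
have EW' x : h x ^+ 2 * W x = h x ^+ 2 * W' x + v i0 * ((E x)%:R * h x ^+ 2).
  by rewrite /W'; ring.
have IEh2 : itg (fun x => v i0 * ((E x)%:R * h x ^+ 2)).
  by apply: itgZ; exact: itg_indM.
have IW' : itg (fun x => h x ^+ 2 * W' x).
  by apply: eq_itg (itgB IW IEh2) => x; rewrite EW'; ring.
have h2 : \sum_(i <- rem i0 s) vol n i.1 * (v i - v i0) * b i ^+ 2 <=
    bessel_cst (n := n) alpha * Int (fun x => h x ^+ 2 * W' x).
  apply: (IH (rem i0 s) (fun i => v i - v i0)) => //.
  - by rewrite size_rem//; move: sm s0; rewrite -size_eq0; case: (size s).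
  - exact: rem_uniq.
  - by move=> i /mem_rem si; rewrite subr_ge0 min0.
  - move=> i x /mem_rem si xi; rewrite /W' (_ : E x); last by apply/hasP; exists i.
    by rewrite mulr1 lerB// vW.
rewrite (eq_Int EW') IntD// mulrDr IntZ; last exact: itg_indM.
have -> : \sum_(i <- s) vol n i.1 * v i * b i ^+ 2 =
    \sum_(i <- rem i0 s) vol n i.1 * (v i - v i0) * b i ^+ 2 +
    v i0 * \sum_(i <- s) vol n i.1 * b i ^+ 2.
  rewrite (perm_big _ (perm_to_rem si0))/= big_cons.
  rewrite [in RHS](perm_big _ (perm_to_rem si0))/= big_cons.
  rewrite mulrDr mulr_sumr addrCA -big_split/=; congr (_ + _); first by ring.
  by apply: eq_bigr => i _; ring.
apply: lerD => //; rewrite mulrCA; apply: ler_wpM2l h1; exact: v0.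
Qed.

End weighted_bessel.

(** * Muckenhoupt weights on cubes *)
Section A1_weight.
Context {R : realType} {n : nat}.
Local Notation mu := (@lebesgue_row R n).
Implicit Types (c : 'rV[R]_n) (r : R).

Definition loc_itg (w : 'rV[R]_n -> R) : Prop :=
  forall c r, itg (fun x => (insq c r x)%:R * w x).

Definition wsq (w : 'rV[R]_n -> R) c r : R := Int (fun x => (insq c r x)%:R * w x).

(** The Muckenhoupt condition on sup-norm balls, for a Borel weight; the volume of
    the ball is replaced by [r ^+ n], the factor 2^n going into [C1]. *)
Definition A1_sq (w : 'rV[R]_n -> R) (C1 : R) : Prop :=
  [/\ 0 < C1, measurable_fun setT w, forall x, 0 <= w x, loc_itg w &
   forall c r, 0 < r -> \forall x \ae mu, insq c r x ->
     wsq w c r <= C1 * r ^+ n * w x].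

Variables (w : 'rV[R]_n -> R) (C1 : R).
Hypothesis wA1 : A1_sq w C1.

Let C10 : 0 < C1. Proof. by case: wA1. Qed.
Let mw : measurable_fun setT w. Proof. by case: wA1. Qed.
Let w0 x : 0 <= w x. Proof. by case: wA1. Qed.
Let lw : loc_itg w. Proof. by case: wA1. Qed.

Lemma wsq_ge0 c r : 0 <= wsq w c r.
Proof. by apply: Int_ge0 => x; rewrite mulr_ge0. Qed.

Lemma itg_sub_sq (p : 'rV[R]_n -> bool) c r : measurable [set x | p x] ->
  (forall x, p x -> insq c r x) -> itg (fun x => (p x)%:R * w x).
Proof.
move=> mp H; apply: eq_itg (itg_indM mp (lw c r)) => x.
by have := H x; case: (p x) => [->//|_]; rewrite ?mul1r// !mul0r.
Qed.

Lemma le_wsq c r c' r' : (forall x : 'rV[R]_n, insq c r x -> insq c' r' x) ->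
  wsq w c r <= wsq w c' r'.
Proof.
move=> H; apply: le_Int => // x.
by rewrite ler_wpM2r// ler_nat; have := H x; case: insq => // ->.
Qed.

(** The form in which the A1 condition is used: the average of the weight over
    a cube may be moved inside any integral over a part of that cube. *)
Lemma A1_Int c r (p : 'rV[R]_n -> bool) h : 0 < r ->
  (forall x, p x -> insq c r x) -> (forall x, 0 <= h x) ->
  itg (fun x => (p x)%:R * h x) -> itg (fun x => (p x)%:R * (h x * w x)) ->
  wsq w c r * Int (fun x => (p x)%:R * h x) <=
    C1 * r ^+ n * Int (fun x => (p x)%:R * (h x * w x)).
Proof.
move=> r0 pr h0 Ih Ihw; rewrite -!IntZ//; apply: ae_le_Int; [exact: itgZ..|].
have [_ _ _ _ /(_ c r r0)] := wA1; apply: filterS => x H.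
have := pr x; case: (p x) => [/(_ isT)/H xr|_]; last by rewrite !mul0r !mulr0.
rewrite !mul1r [h x * w x]mulrC [leRHS]mulrA; exact: ler_wpM2r.
Qed.

(** The A1 condition on the large cube, tested on the small one. *)
Lemma doubling c r (L : R) : 0 < r -> 1 <= L ->
  wsq w c (L * r) <= C1 * (L / 2) ^+ n * wsq w c r.
Proof.
move=> r0 L1; have L0 : 0 < L by exact: lt_le_trans L1.
have := @A1_Int c (L * r) (insq c r) (fun=> 1) (mulr_gt0 L0 r0).
have E : (fun x => (insq c r x)%:R) =1 (fun x => (insq c r x)%:R * 1 :> R).
  by move=> x; rewrite mulr1.
have E' : (fun x => (insq c r x)%:R * w x) =1 (fun x => (insq c r x)%:R * (1 * w x)).
  by move=> x; rewrite mul1r.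
rewrite -(eq_Int E) -(eq_Int E') (Int_sq _ (ltW r0)) -/(wsq w c r).
move=> /(_ _ _ (eq_itg E (itg_sq c (ltW r0))) (eq_itg E' (lw c r))) H.
have {}H : wsq w c (L * r) * (2 * r) ^+ n <= C1 * (L * r) ^+ n * wsq w c r.
  apply: H => // x; rewrite /insq => /le_trans; apply.
  by rewrite ler_peMl// ltW.
have rn : 0 < (2 * r) ^+ n by rewrite exprn_gt0// mulr_gt0.
rewrite -(ler_pM2r rn); apply: le_trans H _.
rewrite [leRHS](_ : _ = C1 * ((L / 2) ^+ n * (2 * r) ^+ n) * wsq w c r); last by ring.
by rewrite -exprMn (_ : L / 2 * (2 * r) = L * r)//; field.
Qed.

End A1_weight.

(** * Calderon-Zygmund stopping cubes *)
Section stopping.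
Context {R : realType} {n : nat}.
Implicit Types (i : idx n) (x : 'rV[R]_n).

(** The 2^n cubes of side 2^k whose indices exceed [a] by 0 or 1 in each
    coordinate: the children of a cube, or the cubes around the origin. *)
Definition corners (k : int) (a : 'I_n -> int) : seq (idx n) :=
  [seq (k, \row_j (a j + (e j : nat)%:Z)) | e : {ffun 'I_n -> bool}].

Lemma sum_corners k a x : \sum_(i <- corners k a) (inQ i x)%:R =
  [forall j, (Num.floor (x ord0 j / side k) == a j) ||
             (Num.floor (x ord0 j / side k) == a j + 1)]%:R :> R.
Proof.
rewrite big_map enumT.
pose e0 : {ffun 'I_n -> bool} := [ffun j => Num.floor (x ord0 j / side k) == a j + 1].
have E (e : {ffun 'I_n -> bool}) : inQ (k, \row_j (a j + (e j : nat)%:Z)) x =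
    [forall j, (Num.floor (x ord0 j / side k) == a j) ||
               (Num.floor (x ord0 j / side k) == a j + 1)] && (e == e0).
  apply/idP/idP.
    rewrite /inQ /= /cell => /eqP[/rowP H]; apply/andP; split.
      by apply/forallP => j; have := H j; rewrite !mxE => ->; case: (e j); rewrite ?addr0 eqxx ?orbT.
    apply/eqP/ffunP => j; rewrite ffunE; have := H j; rewrite !mxE => ->.
    by rewrite (inj_eq (addrI _)); case: (e j).
  move=> /andP[/forallP H /eqP ->]; rewrite /inQ/= /cell; apply/eqP; congr pair.
  apply/rowP => j; rewrite !mxE ffunE; have := H j; case: eqP => [->|_ /= /eqP ->].
    by rewrite (_ : (a j == a j + 1) = false) ?addr0//; lia.
  by rewrite eqxx.
transitivity (\sum_(e : {ffun 'I_n -> bool} | e == e0)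
    ([forall j, (Num.floor (x ord0 j / side k) == a j) ||
             (Num.floor (x ord0 j / side k) == a j + 1)] : bool)%:R : R).
  rewrite [RHS]big_mkcond/=; apply: eq_bigr => e _.
  by rewrite E; case: (e == e0); rewrite ?andbT ?andbF.
by rewrite big_pred1_eq.
Qed.

Definition children i : seq (idx n) := corners (i.1 - 1) (fun j => 2 * i.2 ord0 j).

Lemma sum_children i x : \sum_(c <- children i) (inQ c x)%:R = (inQ i x)%:R :> R.
Proof.
rewrite sum_corners; congr (nat_of_bool _)%:R.
have sE : side i.1 = 2 * side (i.1 - 1) :> R by rewrite -sideS subrK.
have s0 := side_gt0 (R := R) (i.1 - 1); have s0' := side_gt0 (R := R) i.1.
have F j : (Num.floor (x ord0 j / side (i.1 - 1)) == 2 * i.2 ord0 j) ||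
    (Num.floor (x ord0 j / side (i.1 - 1)) == 2 * i.2 ord0 j + 1) =
    (Num.floor (x ord0 j / side i.1) == i.2 ord0 j).
  set u := x ord0 j / side i.1.
  rewrite (_ : _ / side (i.1 - 1) = 2 * u); last by rewrite /u sE; field; exact: lt0r_neq0.
  rewrite !floor_eq !intrD !intrM.
  apply/orP/idP => [[|]|]; [lra|lra|].
  by move=> /andP[h1 h2]; have [h3|h3] := ltP u ((i.2 ord0 j)%:~R + 2^-1); [left|right]; lra.
apply/forallP/idP => [H|/eqP H j].
  rewrite /inQ /cell; case: i H F {sE s0 s0'} => k m /= H F.
  by apply/eqP; congr pair; apply/rowP => j; rewrite mxE; apply/eqP; rewrite -F H.
by rewrite F -{2}H /= mxE.
Qed.

Lemma mem_corners k a i : i \in corners k a -> i.1 = k.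
Proof. by move=> /mapP[e _ ->]. Qed.

Variables (f : 'rV[R]_n -> R) (lam : R).
Hypothesis itf : itg f.
Hypothesis lam0 : 0 < lam.

Definition mass i : R := Int (fun x => (inQ i x)%:R * `|f x|).
Definition heavy i : bool := lam * vol n i.1 < mass i.

(** Calderon-Zygmund stopping cubes below a cube. The subdivision is cut off
    after [d] steps, so that the family is finite; [d] will be so large that the
    light cubes that remain are no larger than the cubes of the atoms under
    consideration. *)
Fixpoint stopping (d : nat) i : seq (idx n) :=
  if d is d'.+1 then
    flatten [seq (if heavy c then [:: c] else stopping d' c) | c <- children i]
  else [:: i].

Lemma sum_stopping d i x : \sum_(Q <- stopping d i) (inQ Q x)%:R = (inQ i x)%:R :> R.
Proof.
elim: d i => [|d IH] i /=; first by rewrite big_seq1.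
rewrite big_flatten big_map -sum_children; apply: eq_bigr => c _.
by case: ifP => _; rewrite ?big_seq1// IH.
Qed.

Lemma mass_le (p q : 'rV[R]_n -> bool) : measurable [set x | p x] ->
  measurable [set x | q x] -> (forall x, p x -> q x) ->
  Int (fun x => (p x)%:R * `|f x|) <= Int (fun x => (q x)%:R * `|f x|).
Proof.
move=> mp mq pq; apply: le_Int; try by apply: itg_indM => //; exact: itg_norm.
by move=> x; rewrite ler_wpM2r// ler_nat; have := pq x; case: (p x) => // ->.
Qed.

Lemma child_sub i c x : c \in children i -> inQ c x -> inQ i x.
Proof.
move=> ci cx; have := sum_children i x; rewrite (big_rem c)//= cx.
have : 0 <= \sum_(y <- rem c (children i)) (inQ y x)%:R :> R by apply: sumr_ge0.
case: (inQ i x) => // h1 h2; exfalso; move: h2; rewrite mulr1n mulr0n => h2.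
by have : (0 : R) < 0; [lra|rewrite ltxx].
Qed.

(** A heavy stopping cube has a light parent, whose volume is 2^n times larger. *)
Lemma stopping_mass d i : ~~ heavy i -> forall Q, Q \in stopping d i ->
  mass Q <= 2 ^+ n * lam * vol n Q.1.
Proof.
have light j : ~~ heavy j -> mass j <= 2 ^+ n * lam * vol n j.1.
  rewrite /heavy -leNgt => /le_trans; apply.
  by rewrite ler_wpM2r ?vol_ge0// ler_peMl ?(ltW lam0)// exprn_ege1// ler1n.
elim: d i => [|d IH] i hi Q /=; first by rewrite inE => /eqP ->; exact: light.
move=> /flattenP[l /mapP[c ci ->]]; case: ifPn => hc; last exact: IH.
rewrite inE => /eqP ->; apply: (@le_trans _ _ (mass i)).
  by apply: mass_le; [exact: measurable_inQ..|move=> x; exact: child_sub].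
move: hi; rewrite /heavy -leNgt => /le_trans; apply.
have -> : i.1 = c.1 + 1 by rewrite (mem_corners ci) subrK.
by rewrite /vol sideS exprMn; lra.
Qed.

Lemma stopping_level d i Q : Q \in stopping d i -> heavy Q || (Q.1 == i.1 - d%:Z).
Proof.
elim: d i => [|d IH] i /=; first by rewrite inE subr0 => /eqP ->; rewrite eqxx orbT.
move=> /flattenP[l /mapP[c ci ->]]; case: ifPn => hc.
  by rewrite inE => /eqP ->; rewrite hc.
by move=> /IH /orP[->//|/eqP ->]; rewrite (mem_corners ci); apply/orP; right; lia.
Qed.

(** For f integrable and supported in a cube, the 2^n cubes of a sufficiently large
    side around the origin are light, and their stopping cubes form the
    decomposition at height [lam]. *)
Lemma cz_cubes rho (k0 : int) : (0 < n)%N -> (forall x, f x != 0 -> insq 0 rho x) ->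
  exists P : seq (idx n), [/\ disj (R := R) P,
    forall x, f x != 0 -> \sum_(Q <- P) (inQ Q x)%:R = 1 :> R,
    forall Q, Q \in P -> mass Q <= 2 ^+ n * lam * vol n Q.1 &
    forall Q, Q \in P -> heavy Q \/ Q.1 <= k0].
Proof.
move=> n0 fs.
have [N [rN mN kN]] : exists N : int, [/\ rho < side N, Int (fun x => `|f x|) <= lam * vol n N & k0 <= N].
  pose M := Int (fun x => `|f x|) / lam.
  have M0 : 0 <= M by rewrite divr_ge0 ?(ltW lam0)// Int_ge0.
  (* 2^m exceeds m, hence each of the three quantities added up in T. *)
  pose T := `|rho| + M + `|k0|%:~R; pose m := (Num.trunc T).+1.
  have Tm : T < m%:R by exact: truncnS_gt.
  have ms : m%:R <= side m :> R by rewrite /side -exprnP -natrX ler_nat ltnW// ltn_expl.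
  have k00 : 0 <= `|k0|%:~R :> R by rewrite ler0z.
  have rho0 := ler_norm rho; have rho1 := normr_ge0 rho.
  have s1 : 1 <= side m :> R by apply: le_trans ms; rewrite ler1n.
  exists m; split; first by move: Tm ms; rewrite /T; lra.
    rewrite -ler_pdivrMl// mulrC -/M; apply: (@le_trans _ _ (side m)).
      by move: Tm ms; rewrite /T; lra.
    by rewrite /vol -{1}[side m]expr1 ler_weXn2l.
  have : `|k0|%:~R < m%:R :> R by move: Tm ms; rewrite /T; lra.
  by rewrite pmulrn ltr_int; lia.
pose tops := corners N (fun=> -1).
pose P := flatten [seq stopping `|N - k0| t | t <- tops].
have PE x : \sum_(Q <- P) (inQ Q x)%:R = \sum_(t <- tops) (inQ t x)%:R :> R.
  rewrite big_flatten big_map; apply: eq_bigr => t _; exact: sum_stopping.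
have lt t : t \in tops -> ~~ heavy t.
  move=> /mem_corners tN; rewrite /heavy -leNgt tN; apply: le_trans mN.
  apply: le_Int => [||x].
  - by apply: itg_indM; [exact: measurable_inQ|exact: itg_norm].
  - exact: itg_norm.
  - by case: (inQ t x); rewrite ?mul1r ?mul0r.
exists P; split.
- by move=> x; rewrite PE sum_corners; case: [forall _, _].
- move=> x /fs xr; rewrite PE sum_corners (_ : [forall _, _] = true)//.
  apply/forallP => j; rewrite !floor_eq.
  have : `|x ord0 j| < side N.
    by apply: le_lt_trans rN; apply: le_trans (coord_le_norm x j) _; rewrite /insq subr0 in xr.
  have s0 := side_gt0 (R := R) N.
  rewrite ltr_norml !(ler_pdivlMr, ltr_pdivrMr)// => /andP[h1 h2].
  rewrite !intrD !mulrN1z !mulr1z.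
  by have [h|h] := leP 0 (x ord0 j); apply/orP; [right|left]; apply/andP; split; lra.
- by move=> Q /flattenP[l /mapP[t /lt tl ->]]; exact: stopping_mass.
- move=> Q /flattenP[l /mapP[t /mem_corners tN ->]] /stopping_level /orP[|/eqP ->]; first by left.
  by right; rewrite tN; lia.
Qed.

End stopping.

(** * The weak-type inequality for finitely many atoms *)
Section weak_type.
Context {R : realType} {n : nat}.
Local Notation mu := (@lebesgue_row R n).
Variable alpha : R.
Hypothesis alpha01 : 0 < alpha <= 1.
Implicit Types (i j Q : idx n) (s P : seq (idx n)).
Variables (w : 'rV[R]_n -> R) (C1 : R).
Hypothesis wA1 : A1_sq w C1.
Variable psi : idx n -> 'rV[R]_n -> R.
Hypothesis psiP : forall i, atom alpha i (psi i).
Variable f : 'rV[R]_n -> R.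
Hypothesis itf : itg f.
Hypothesis itfw : itg (fun x => `|f x| * w x).
Local Notation q := (decay alpha).

Let C10 : 0 < C1. Proof. by case: wA1. Qed.
Let mw : measurable_fun setT w. Proof. by case: wA1. Qed.
Let w0 x : 0 <= w x. Proof. by case: wA1. Qed.
Let lw : loc_itg w. Proof. by case: wA1. Qed.
Let alpha0 : 0 <= alpha. Proof. by case/andP: alpha01 => /ltW. Qed.

Definition wmass Q : R := Int (fun x => (inQ Q x)%:R * (`|f x| * w x)).
Definition avg Q : R := Int (fun x => (inQ Q x)%:R * f x) / vol n Q.1.
(** If this fails, atoms of [i] vanish on [Q]. *)
Definition touch Q i : bool :=
  `|corner Q - corner i : 'rV[R]_n| <= side Q.1 + 3 * side i.1.

Lemma wmass_ge0 Q : 0 <= wmass Q.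
Proof. by apply: Int_ge0 => x; rewrite !mulr_ge0. Qed.

Lemma mass_ge0 Q : 0 <= mass f Q.
Proof. by apply: Int_ge0 => x; rewrite mulr_ge0. Qed.

Lemma avg_le Q : `|avg Q| <= mass f Q / vol n Q.1.
Proof.
rewrite normrM [`|_^-1|]gtr0_norm ?invr_gt0 ?vol_gt0//.
rewrite ler_wpM2r ?invr_ge0 ?vol_ge0//.
apply: le_trans (le_norm_Int _) _; first by apply: itg_indM => //; exact: measurable_inQ.
apply: le_Int => [||x].
- by apply: itg_norm; apply: itg_indM => //; exact: measurable_inQ.
- by apply: itg_indM; [exact: measurable_inQ|exact: itg_norm].
- by rewrite normrM ger0_norm.
Qed.

Lemma A1_cube Q c r : 0 < r -> (forall x : 'rV[R]_n, inQ Q x -> insq c r x) ->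
  wsq w c r * mass f Q <= C1 * r ^+ n * wmass Q.
Proof.
move=> r0 H; apply: (A1_Int wA1 r0) => //.
- by apply: itg_indM; [exact: measurable_inQ|exact: itg_norm].
- by apply: itg_indM => //; exact: measurable_inQ.
Qed.

Lemma inQ_insq Q c r L : `|corner Q - c| <= r -> r + side Q.1 <= L ->
  forall x : 'rV[R]_n, inQ Q x -> insq c L x.
Proof.
move=> h1 h2 x /inQ_dist h3; rewrite /insq.
rewrite (_ : x - c = (corner Q - c) + (x - corner Q)); last first.
  by rewrite [RHS]addrC addrA subrK.
by apply: le_trans (ler_normD _ _) _; lra.
Qed.

(** As [f - avg Q] has mean zero on Q, the atom may be replaced by its difference
    with its value at the corner of Q. *)
Lemma cancel_cube i Q :
  `|Int (fun x => psi i x * ((inQ Q x)%:R * (f x - avg Q)))| <=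
  (touch Q i)%:R * (n.+1%:R / vol n i.1 * (side Q.1 / side i.1) `^ alpha * (2 * mass f Q)).
Proof.
have [mi si bi hi ci] := psiP i.
pose b x := (inQ Q x)%:R * (f x - avg Q).
have Iqf : itg (fun x => (inQ Q x)%:R * f x).
  by apply: itg_indM => //; exact: measurable_inQ.
have Iqa : itg (fun x => avg Q * (inQ Q x)%:R) by apply: itgZ; exact: itg_inQ.
have bE x : b x = (inQ Q x)%:R * f x - avg Q * (inQ Q x)%:R by rewrite /b; ring.
have Ib : itg b by apply: eq_itg (itgB Iqf Iqa) => x; rewrite bE.
have Ib0 : Int b = 0.
  rewrite (eq_Int bE) IntB// IntZ; last exact: itg_inQ.
  by rewrite Int_inQ /avg divfK ?vol_neq0// subrr.
have Ibabs : Int (fun x => `|b x|) <= 2 * mass f Q.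
  apply: (@le_trans _ _ (Int (fun x => (inQ Q x)%:R * `|f x| + `|avg Q| * (inQ Q x)%:R))).
    apply: le_Int => [||x]; first exact: itg_norm.
      apply: itgD; last by apply: itgZ; exact: itg_inQ.
      by apply: itg_indM; [exact: measurable_inQ|exact: itg_norm].
    rewrite bE; apply: le_trans (ler_normB _ _) _.
    by rewrite !normrM [`|_%:R|]ger0_norm.
  rewrite IntD; last 2 first.
  - by apply: itg_indM; [exact: measurable_inQ|exact: itg_norm].
  - by apply: itgZ; exact: itg_inQ.
  rewrite IntZ; last exact: itg_inQ.
  rewrite Int_inQ -/(mass f Q); have := avg_le Q; rewrite ler_pdivlMr ?vol_gt0//; lra.
have [t|nt] := boolP (touch Q i); last first.
  rewrite mul0r (@eq_Int _ _ _ (fun=> 0)) ?Int0 ?normr0// => x.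
  case E: (inQ Q x); last by rewrite mul0r mulr0.
  rewrite (atom_eq0 (psiP i)) ?mul0r//; apply: contra nt; rewrite /insq /touch => h.
  have := inQ_dist E; rewrite distrC => h2.
  rewrite (_ : corner Q - corner i = (corner Q - x) + (x - corner i)); last first.
    by rewrite addrA subrK.
  by apply: le_trans (ler_normD _ _) _; lra.
rewrite mul1r.
have Ipb : itg (fun x => psi i x * b x) by exact: atom_itgM (psiP i) Ib.
pose phi x := (psi i x - psi i (corner Q)) * b x.
have phiE x : phi x = psi i x * b x - psi i (corner Q) * b x by rewrite /phi; ring.
have Iphi : itg phi.
  by apply: (@eq_itg _ _ _ _ (fun x => esym (phiE x))); apply: itgB => //; exact: itgZ.
have -> : Int (fun x => psi i x * b x) = Int phi.
  by rewrite (eq_Int phiE) IntB ?IntZ ?Ib0 ?mulr0 ?subr0//; exact: itgZ.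
apply: le_trans (le_norm_Int Iphi) _.
set K := n.+1%:R / _ * _.
have K0 : 0 <= K by rewrite mulr_ge0 ?powR_ge0// divr_ge0 ?vol_ge0.
apply: (@le_trans _ _ (K * Int (fun x => `|b x|))); last by rewrite ler_wpM2l.
rewrite -IntZ; last exact: itg_norm.
apply: le_Int => [||x]; [exact: itg_norm|by apply: itgZ; exact: itg_norm|].
rewrite /phi normrM; case E : (inQ Q x); last by rewrite /b E mul0r normr0 !mulr0.
rewrite ler_wpM2r//; apply: le_trans (hi _ _) _.
rewrite ler_wpM2l ?divr_ge0 ?vol_ge0//.
apply: ge0_ler_powR => //; rewrite ?nnegrE ?divr_ge0 ?side_ge0//.
by rewrite ler_pM2r ?invr_gt0 ?side_gt0// inQ_dist.
Qed.

Variables (s : seq (idx n)) (lam : R) (P : seq (idx n)).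
Hypothesis us : uniq s.
Hypothesis lam0 : 0 < lam.
Hypothesis dP : disj (R := R) P.
Hypothesis fP : forall x, f x != 0 -> \sum_(Q <- P) (inQ Q x)%:R = 1 :> R.
Hypothesis mP : forall Q, Q \in P -> mass f Q <= 2 ^+ n * lam * vol n Q.1.

Local Notation F := (Int (fun x => `|f x| * w x)).

Lemma sum_wmass (p : pred (idx n)) : \sum_(Q <- P | p Q) wmass Q <= F.
Proof.
apply: (@le_trans _ _ (Int (fun x => (xpredT x)%:R * (`|f x| * w x)))); last first.
  by rewrite le_eqVlt; apply/orP; left; apply/eqP; apply: eq_Int => x; rewrite mul1r.
apply: disj_Int => //.
- by rewrite (_ : mkset _ = setT)//; apply/seteqP; split.
- by move=> x; rewrite mulr_ge0.
- by move=> Q _ _; apply: itg_indM => //; exact: measurable_inQ.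
- by apply: eq_itg itfw => x; rewrite mul1r.
Qed.

Definition good_part (x : 'rV[R]_n) : R := \sum_(Q <- P) avg Q * (inQ Q x)%:R.

Lemma itg_good : itg good_part.
Proof. by apply: itg_sum => Q _; apply: itgZ; exact: itg_inQ. Qed.

(** Calderon-Zygmund decomposition of f, paired with an atom. *)
Lemma decompose i : Int (fun x => psi i x * f x) = Int (fun x => psi i x * good_part x) +
  \sum_(Q <- P) Int (fun x => psi i x * ((inQ Q x)%:R * (f x - avg Q))).
Proof.
have Ib Q : itg (fun x => (inQ Q x)%:R * (f x - avg Q)).
  have Iqf : itg (fun x => (inQ Q x)%:R * f x).
    by apply: itg_indM => //; exact: measurable_inQ.
  have Iqa : itg (fun x => avg Q * (inQ Q x)%:R) by apply: itgZ; exact: itg_inQ.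
  by apply: eq_itg (itgB Iqf Iqa) => x; ring.
have Ipb Q : itg (fun x => psi i x * ((inQ Q x)%:R * (f x - avg Q))).
  exact: atom_itgM (psiP i) (Ib Q).
rewrite -Int_sum// -IntD; [|exact: atom_itgM (psiP i) itg_good|exact: itg_sum].
apply: eq_Int => x; rewrite -mulr_sumr -mulrDr; congr (_ * _).
rewrite /good_part -big_split/=.
have -> : \sum_(Q <- P) (avg Q * (inQ Q x)%:R + (inQ Q x)%:R * (f x - avg Q)) =
    (\sum_(Q <- P) (inQ Q x)%:R) * f x.
  by rewrite mulr_suml; apply: eq_bigr => Q _; ring.
by have [->|/fP ->] := eqVneq (f x) 0; rewrite ?mulr0 ?mul1r.
Qed.

(** The cubes being disjoint, this is the nonnegativity of a variance. *)
Lemma good_sq x : good_part x ^+ 2 <= \sum_(Q <- P) avg Q ^+ 2 * (inQ Q x)%:R.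
Proof.
have GE : \sum_(Q <- P) avg Q * (inQ Q x)%:R = good_part x by [].
move: (good_part x) GE => G GE.
have : 0 <= \sum_(Q <- P) (avg Q - G) ^+ 2 * (inQ Q x)%:R.
  by apply: sumr_ge0 => Q _; rewrite mulr_ge0 ?sqr_ge0.
have -> : \sum_(Q <- P) (avg Q - G) ^+ 2 * (inQ Q x)%:R =
    \sum_(Q <- P) avg Q ^+ 2 * (inQ Q x)%:R - 2 * G * G +
    G ^+ 2 * \sum_(Q <- P) (inQ Q x)%:R.
  rewrite -[X in 2 * G * X]GE !mulr_sumr -sumrB -big_split/=.
  by apply: eq_bigr => Q _; ring.
have := ler_wpM2l (sqr_ge0 G) (dP x); rewrite mulr1 !expr2; lra.
Qed.

(** One factor [avg Q] is bounded by the height, the other one is moved inside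
    the integral of the weight by the A1 condition. *)
Lemma avg_wmass Q : Q \in P ->
  avg Q ^+ 2 * Int (fun x => (inQ Q x)%:R * w x) <= C1 * (2 ^+ n * lam) * wmass Q.
Proof.
move=> QP; have V0 := vol_gt0 (R := R) (n := n) Q.1.
have a1 := avg_le Q; have m0 := mass_ge0 Q.
have a2 : mass f Q / vol n Q.1 <= 2 ^+ n * lam by rewrite ler_pdivrMr// mP.
have IW : Int (fun x => (inQ Q x)%:R * w x) <= wsq w (corner Q) (side Q.1).
  apply: le_Int => [||x].
  - apply: (itg_sub_sq wA1 (c := corner Q) (r := side Q.1)); first exact: measurable_inQ.
    by move=> x /inQ_dist.
  - exact: lw.
  - rewrite ler_wpM2r// ler_nat; have := @inQ_dist R n Q x.
    by rewrite /insq; case: (inQ Q x) => // ->.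
have IW0 : 0 <= Int (fun x => (inQ Q x)%:R * w x).
  by apply: Int_ge0 => x; rewrite mulr_ge0.
have H := A1_cube (side_gt0 Q.1) (fun x => @inQ_dist R n Q x).
rewrite -/(vol n Q.1) in H.
apply: (@le_trans _ _ ((2 ^+ n * lam) * (mass f Q / vol n Q.1) * wsq w (corner Q) (side Q.1))).
  apply: ler_pM => //; first exact: sqr_ge0.
  rewrite -(real_normK (num_real (avg Q))) expr2 ler_pM//.
  exact: le_trans a2.
rewrite -mulrA [leRHS](_ : _ = 2 ^+ n * lam * (C1 * wmass Q)); last by ring.
rewrite ler_wpM2l ?mulr_ge0 ?exprn_ge0 ?(ltW lam0)//.
by rewrite mulrAC ler_pdivrMr//; move: H; lra.
Qed.

Definition good_cst : R := bessel_cst (n := n) alpha * (C1 * 3 ^+ n) * (C1 * 2 ^+ n).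

(** The good part is bounded by a multiple of the height, so its square is
    dominated by the height times the good part, and the weighted Bessel
    inequality applies. *)
Lemma good_bound s' : uniq s' ->
  \sum_(i <- s') wsq w (corner i) (3 * side i.1) * Int (fun x => psi i x * good_part x) ^+ 2
    <= good_cst * lam * F.
Proof.
move=> us'.
pose v i := wsq w (corner i) (3 * side i.1) / vol n i.1.
have v0 i : 0 <= v i by rewrite divr_ge0 ?vol_ge0// (wsq_ge0 wA1).
have aev : \forall x \ae mu, forall i, i \in s' -> insq (corner i) (3 * side i.1) x ->
    v i <= C1 * 3 ^+ n * w x.
  elim: s' {us'} => [|a l IH]; first exact: nearW.
  have [_ _ _ _ /(_ (corner a) (3 * side a.1))] := wA1.
  have a0 : 0 < 3 * side a.1 :> R by rewrite mulr_gt0 ?side_gt0.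
  move=> /(_ a0); apply: filterS2 IH => x IH H i; rewrite inE => /orP[/eqP -> xa|]; last exact: IH.
  rewrite /v ler_pdivrMr ?vol_gt0//; apply: le_trans (H xa) _.
  by rewrite exprMn -/(vol n a.1); lra.
have [N [mN N0 HN]] := aev.
(* A1 bounds [v i] only almost everywhere; on the exceptional null set N the
   weight is raised by the sum of all [v i]. *)
pose W x := C1 * 3 ^+ n * w x + (\sum_(i <- s') v i) * \1_N x.
have W0 x : 0 <= W x.
  by rewrite addr_ge0 ?mulr_ge0 ?exprn_ge0 ?(ltW C10) ?sumr_ge0.
have mg2 : measurable_fun setT (fun x => good_part x ^+ 2).
  by apply: measurable_funX; exact: itg_mf itg_good.
have Iq2 : itg (fun x => \sum_(Q <- P) avg Q ^+ 2 * (inQ Q x)%:R).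
  by apply: itg_sum => Q _; apply: itgZ; exact: itg_inQ.
have Ig2 : itg (fun x => good_part x ^+ 2).
  apply: le_itg mg2 _ Iq2 => x.
  by rewrite ger0_norm ?sqr_ge0// good_sq.
have IQw Q : itg (fun x => (inQ Q x)%:R * w x).
  apply: (itg_sub_sq wA1 (c := corner Q) (r := side Q.1)); first exact: measurable_inQ.
  by move=> x /inQ_dist.
have Iq2w : itg (fun x => \sum_(Q <- P) avg Q ^+ 2 * ((inQ Q x)%:R * w x)).
  by apply: itg_sum => Q _; exact: itgZ.
have Ig2w : itg (fun x => good_part x ^+ 2 * w x).
  apply: le_itg _ _ Iq2w; first exact: measurable_funM.
  move=> x; rewrite ger0_norm; last by rewrite mulr_ge0 ?sqr_ge0.
  apply: le_trans (ler_wpM2r (w0 x) (good_sq x)) _.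
  by rewrite mulr_suml; apply: ler_sum => Q _; rewrite mulrA.
have IgN : itg (fun x => \1_N x * good_part x ^+ 2).
  have mind : measurable_fun setT (\1_N : 'rV[R]_n -> R) by exact: measurable_indic.
  apply: (itgMl (M := 1) mind _ Ig2) => x.
  by rewrite indicE; case: (x \in N); rewrite ?normr1 ?normr0.
have WE x : good_part x ^+ 2 * W x = C1 * 3 ^+ n * (good_part x ^+ 2 * w x) +
    (\sum_(i <- s') v i) * (\1_N x * good_part x ^+ 2) by rewrite /W; ring.
have IgW : itg (fun x => good_part x ^+ 2 * W x).
  by apply: (@eq_itg _ _ _ _ (fun x => esym (WE x))); apply: itgD; exact: itgZ.
have IN0 : Int (fun x => \1_N x * good_part x ^+ 2) = 0.
  rewrite -[RHS](@Int0 R n); apply: ae_eq_Int => //; first exact: itg0.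
  exists N; split=> // x /= h; apply: contrapT => xN; apply: h.
  by rewrite indicE memNset ?mul0r.
have := @weighted_bessel R n alpha alpha01 psi psiP s' good_part v W us' itg_good Ig2 IgW W0
  (fun i _ => v0 i).
have vW i x : i \in s' -> insq (corner i) (3 * side i.1) x -> v i <= W x.
  move=> si xi; have [xN|xN] := pselect (N x).
    rewrite /W indicE mem_set// mulr1; apply: ler_wpDl.
      by rewrite !mulr_ge0 ?exprn_ge0 ?(ltW C10).
    by rewrite (big_rem i)//= ler_wpDr// sumr_ge0.
  rewrite /W ler_wpDr//; first by rewrite mulr_ge0 ?sumr_ge0.
  by move: si xi; apply: contrapT => h; apply: xN; apply: HN => /= h'; apply: h => ? ?; exact: h'.
move=> /(_ vW) H.
apply: le_trans (le_trans _ H) _.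
  rewrite le_eqVlt; apply/orP; left; apply/eqP; apply: eq_bigr => i _.
  by congr (_ * _); rewrite /v [RHS]mulrC divfK ?vol_neq0.
rewrite (eq_Int WE) IntD; [|exact: itgZ..].
rewrite !IntZ// IN0 mulr0 addr0 /good_cst.
rewrite [leRHS](_ : _ = bessel_cst (n := n) alpha *
  (C1 * 3 ^+ n * (C1 * (2 ^+ n * lam) * F))); last by ring.
apply: ler_wpM2l; first exact/ltW/bessel_cst_gt0.
apply: ler_wpM2l; first by rewrite mulr_ge0 ?exprn_ge0 ?(ltW C10).
apply: (@le_trans _ _ (\sum_(Q <- P) C1 * (2 ^+ n * lam) * wmass Q)); last first.
  rewrite -mulr_sumr; apply: ler_wpM2l; last exact: (sum_wmass xpredT).
  by rewrite !mulr_ge0 ?exprn_ge0 ?(ltW C10) ?(ltW lam0).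
apply: (@le_trans _ _ (Int (fun x => \sum_(Q <- P) avg Q ^+ 2 * ((inQ Q x)%:R * w x)))).
  apply: le_Int => // x.
  apply: le_trans (ler_wpM2r (w0 x) (good_sq x)) _.
  by rewrite mulr_suml; apply: ler_sum => Q _; rewrite mulrA.
rewrite Int_sum; last by move=> Q _; exact: itgZ.
rewrite big_seq [leRHS]big_seq; apply: ler_sum => Q QP.
by rewrite IntZ//; exact: avg_wmass.
Qed.

(** The bound for the coefficient of the bad part obtained by adding up
    [cancel_cube]. *)
Definition bad_coef i : R := \sum_(Q <- P | touch Q i)
  n.+1%:R / vol n i.1 * (side Q.1 / side i.1) `^ alpha * (2 * mass f Q).

Lemma bad_le i :
  `|\sum_(Q <- P) Int (fun x => psi i x * ((inQ Q x)%:R * (f x - avg Q)))| <= bad_coef i.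
Proof.
apply: le_trans (ler_norm_sum _ _ _) _; rewrite /bad_coef [leRHS]big_mkcond/=.
apply: ler_sum => Q _; apply: le_trans (cancel_cube i Q) _.
by case: ifP => _; rewrite ?mul1r ?mul0r.
Qed.

(** The cubes whose atoms gain from the cancellation of the bad part; the dilated
    stopping cubes cover the cubes that fail this. *)
Definition coarse i : bool := all (fun Q => touch Q i ==> (Q.1 <= i.1)) P.

Lemma side_pow Q i : Q.1 <= i.1 ->
  (side Q.1 / side i.1) `^ alpha <= q ^+ `|i.1 - Q.1|%N.
Proof.
move=> Qi; rewrite -[leRHS]mul1r; apply: le_trans (decay_pow alpha01 _ (lexx 1)).
rewrite (_ : side i.1 = 2 ^+ `|i.1 - Q.1|%N * side Q.1 :> R); last first.
  by rewrite -sideDn; congr side; lia.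
by rewrite invfM mulrCA mulfV ?side_neq0// mulr1 mul1r.
Qed.

Lemma touch_sub Q i : touch Q i -> Q.1 <= i.1 ->
  forall x : 'rV[R]_n, inQ Q x -> insq (corner i) (5 * side i.1) x.
Proof.
move=> t Qi; apply: inQ_insq t _.
by have : side Q.1 <= side i.1 :> R; [rewrite ler_side|lra].
Qed.

Definition bad_height : R := n.+1%:R * 2 * 2 ^+ n * 10 ^+ n.

(** The stopping cubes seen by a coarse atom lie in a multiple of its cube, so that
    their total mass is at most a multiple of the height times its volume. *)
Lemma bad_coef_le i : coarse i -> bad_coef i <= bad_height * lam.
Proof.
move=> /allP ci; have V0 := vol_gt0 (R := R) (n := n) i.1.
have r0 : 0 <= 5 * side i.1 :> R by rewrite mulr_ge0 ?side_ge0.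
have H : \sum_(Q <- P | touch Q i) vol n Q.1 <= 10 ^+ n * vol n i.1 :> R.
  have -> : 10 ^+ n * vol n i.1 = (2 * (5 * side i.1)) ^+ n :> R.
    by rewrite -exprMn; congr (_ ^+ n); ring.
  apply: (disj_vol (c := corner i) dP r0) => Q x QP t.
  by apply: touch_sub => //; have := ci _ QP; rewrite t.
apply: (@le_trans _ _ (\sum_(Q <- P | touch Q i)
    (n.+1%:R / vol n i.1 * (2 * (2 ^+ n * lam))) * vol n Q.1)).
  rewrite /bad_coef big_seq_cond [leRHS]big_seq_cond; apply: ler_sum => Q /andP[QP t].
  have Qi : Q.1 <= i.1 by have := ci _ QP; rewrite t.
  have s1 : (side Q.1 / side i.1) `^ alpha <= 1 :> R.
    apply: le_trans (side_pow Qi) _; have /andP[q0 q1] := decay01 alpha01.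
    by rewrite exprn_ile1 // ltW.
  rewrite -!mulrA ler_wpM2l// ler_wpM2l ?invr_ge0 ?vol_ge0//.
  rewrite -[leRHS]mul1r ler_pM ?powR_ge0//; first by rewrite mulr_ge0 ?mass_ge0.
  by rewrite ler_wpM2l// mulrA mP.
rewrite -mulr_sumr /bad_height.
apply: (@le_trans _ _ (n.+1%:R / vol n i.1 * (2 * (2 ^+ n * lam)) * (10 ^+ n * vol n i.1))).
  by rewrite ler_wpM2l// !mulr_ge0 ?invr_ge0 ?vol_ge0 ?exprn_ge0 ?(ltW lam0).
by rewrite le_eqVlt; apply/orP; left; apply/eqP; field; exact: lt0r_neq0.
Qed.

Definition bad_cst : R :=
  bad_height * (2 * n.+1%:R * C1 * 5 ^+ n) * (14 ^+ n / (1 - q)).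

(** One of the two factors of the square is bounded by [bad_coef_le]; in the
    other one the sums are exchanged, and for each stopping cube the sum over
    the larger cubes that see it converges by [sum_near_ge]. *)
Lemma bad_bound s' : uniq s' -> (forall i, i \in s' -> coarse i) ->
  \sum_(i <- s') wsq w (corner i) (3 * side i.1) *
    (\sum_(Q <- P) Int (fun x => psi i x * ((inQ Q x)%:R * (f x - avg Q)))) ^+ 2
    <= bad_cst * lam * F.
Proof.
move=> us' cs'.
have K0 : 0 <= 2 * n.+1%:R * C1 * 5 ^+ n by rewrite !mulr_ge0 ?exprn_ge0 ?(ltW C10).
have H0 : 0 <= bad_height by rewrite !mulr_ge0 ?exprn_ge0.
apply: (@le_trans _ _ (\sum_(i <- s') bad_height * lam *
    (wsq w (corner i) (3 * side i.1) * bad_coef i))).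
  rewrite big_seq [leRHS]big_seq; apply: ler_sum => i si.
  rewrite [leRHS]mulrCA; apply: ler_wpM2l; first exact: (wsq_ge0 wA1).
  rewrite -(real_normK (num_real _)) expr2 ler_pM ?bad_le//.
  by apply: le_trans (bad_le i) _; exact/bad_coef_le/cs'.
rewrite -mulr_sumr [leRHS](_ : _ = bad_height * lam *
  (2 * n.+1%:R * C1 * 5 ^+ n * (14 ^+ n / (1 - q)) * F)); last by rewrite /bad_cst; ring.
apply: ler_wpM2l; first by rewrite mulr_ge0 ?(ltW lam0).
apply: (@le_trans _ _ (\sum_(i <- s') \sum_(Q <- P | touch Q i)
    2 * n.+1%:R * C1 * 5 ^+ n * (q ^+ `|i.1 - Q.1|%N * wmass Q))).
  rewrite big_seq [leRHS]big_seq; apply: ler_sum => i si.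
  rewrite /bad_coef mulr_sumr big_seq_cond [leRHS]big_seq_cond.
  apply: ler_sum => Q /andP[QP t].
  have Qi : Q.1 <= i.1 by have /allP/(_ _ QP) := cs' _ si; rewrite t.
  have V0 := vol_gt0 (R := R) (n := n) i.1.
  have s50 : 0 < 5 * side i.1 :> R by rewrite mulr_gt0 ?side_gt0.
  have h1 : wsq w (corner i) (3 * side i.1) <= wsq w (corner i) (5 * side i.1).
    apply: (le_wsq wA1) => x; rewrite /insq => /le_trans; apply.
    by rewrite ler_wpM2r ?side_ge0// ler_nat.
  have h2 : wsq w (corner i) (3 * side i.1) * mass f Q / vol n i.1 <= C1 * 5 ^+ n * wmass Q.
    rewrite ler_pdivrMr//; apply: le_trans (ler_wpM2r (mass_ge0 Q) h1) _.
    apply: le_trans (A1_cube s50 (touch_sub t Qi)) _.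
    by rewrite exprMn -/(vol n i.1); lra.
  rewrite [leLHS](_ : _ = 2 * n.+1%:R * ((side Q.1 / side i.1) `^ alpha *
    (wsq w (corner i) (3 * side i.1) * mass f Q / vol n i.1))); last first.
    by field; exact: lt0r_neq0.
  rewrite [leRHS](_ : _ = 2 * n.+1%:R * (q ^+ `|i.1 - Q.1|%N * (C1 * 5 ^+ n * wmass Q)));
    last by ring.
  rewrite ler_wpM2l ?mulr_ge0// ler_pM ?powR_ge0 ?side_pow//.
  by rewrite !mulr_ge0 ?invr_ge0 ?vol_ge0 ?mass_ge0 ?(wsq_ge0 wA1).
rewrite (exchange_big_dep xpredT)//=.
apply: (@le_trans _ _ (\sum_(Q <- P) 2 * n.+1%:R * C1 * 5 ^+ n * (14 ^+ n / (1 - q)) * wmass Q)).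
  rewrite big_seq [leRHS]big_seq; apply: ler_sum => Q QP.
  rewrite -mulr_sumr -[leRHS]mulrA ler_wpM2l//.
  rewrite -mulr_suml ler_wpM2r ?wmass_ge0//.
  apply: le_trans (sum_near_ge alpha01 Q us').
  have /andP[q0 q1] := decay01 alpha01.
  rewrite big_seq_cond [leRHS]big_seq_cond big_mkcond [leRHS]big_mkcond/=.
  apply: ler_sum => i _.
  case: (boolP (i \in s')) => si //=; case: ifPn => [t|_]; last first.
    by case: ifP => // _; rewrite mulr_ge0// exprn_ge0.
  have Qi : Q.1 <= i.1 by have /allP/(_ _ QP) := cs' _ si; rewrite t.
  rewrite Qi (_ : near_idx R Q i) ?mulr1//.
  apply: le_trans t _; have : side Q.1 <= side i.1 :> R by rewrite ler_side.
  by have := side_ge0 (R := R) i.1; lra.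
rewrite -mulr_sumr ler_wpM2l//; last exact: (sum_wmass xpredT).
have /andP[_ q1] := decay01 alpha01.
by rewrite mulr_ge0// divr_ge0 ?exprn_ge0// subr_ge0 ltW.
Qed.

Hypothesis levP : forall Q, Q \in P -> heavy f lam Q \/ (forall i, i \in s -> Q.1 <= i.1).

Definition coef i : R := Int (fun x => psi i x * f x).
Definition sqfun (x : 'rV[R]_n) : R :=
  \sum_(i <- s) coef i ^+ 2 * (insq (corner i) (3 * side i.1) x)%:R.
Definition weak_cst : R := C1 * 7 ^+ n + 2 * good_cst + 2 * bad_cst.

Lemma itg_sqfun : itg sqfun.
Proof.
by apply: itg_sum => i _; apply: itgZ; apply: itg_sq; rewrite mulr_ge0 ?side_ge0.
Qed.

Lemma measurable_sqfun a : measurable [set x | a < sqfun x].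
Proof.
rewrite (_ : mkset _ = setT `&` sqfun @^-1` `]a, +oo[%classic); last first.
  by apply/seteqP; split => x /=; rewrite in_itv/= andbT => // -[].
by apply: (itg_mf itg_sqfun) => //; exact: measurable_itv.
Qed.

(** Outside the 7-fold dilates of the heavy cubes only coarse atoms contribute.
    The dilates have small weight by the A1 condition and the definition of
    heaviness; the coarse atoms are handled by the Chebyshev inequality and
    the bounds for the good and the bad part. *)
Lemma weak_type_cubes : Int (fun x => (lam ^+ 2 < sqfun x)%R%:R * w x) <= weak_cst / lam * F.
Proof.
pose s' := [seq i <- s | coarse i].
pose H (x : 'rV[R]_n) : R := \sum_(Q <- P | heavy f lam Q) (insq (corner Q) (7 * side Q.1) x)%:R.
pose T (x : 'rV[R]_n) : R := \sum_(i <- s') coef i ^+ 2 * (insq (corner i) (3 * side i.1) x)%:R.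
have T0 x : 0 <= T x by apply: sumr_ge0 => i _; rewrite mulr_ge0 ?sqr_ge0.
have H0 x : 0 <= H x by exact: sumr_ge0.
have UHT x : (lam ^+ 2 < sqfun x)%R%:R <= H x + lam ^- 2 * T x.
  have lT : 0 <= lam ^- 2 * T x by rewrite mulr_ge0// invr_ge0 sqr_ge0.
  case: ltP => [lx|_]; last by rewrite addr_ge0.
  have [/hasP[Q QP /andP[hQ xQ]]|/hasPn nh] :=
      boolP (has (fun Q => heavy f lam Q && insq (corner Q) (7 * side Q.1) x) P).
    by rewrite ler_wpDr// /H (big_rem Q)//= hQ xQ ler_wpDr// sumr_ge0.
  rewrite ler_wpDl// mulrC ler_pdivlMr ?exprn_gt0// mul1r.
  apply: le_trans (ltW lx) _; rewrite /T big_filter [leRHS]big_mkcond/= /sqfun.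
  rewrite big_seq [leRHS]big_seq; apply: ler_sum => i si.
  case: ifPn => // /allPn[Q QP]; rewrite negb_imply -ltNge => /andP[t iQ].
  rewrite (_ : insq _ _ x = false) ?mulr0//; apply/negP => xi.
  have := nh Q QP; have [->/=|/(_ i si)] := levP QP; last by rewrite leNgt iQ.
  move/negP; apply; rewrite /insq in xi *.
  rewrite (_ : x - corner Q = (x - corner i) - (corner Q - corner i)); last first.
    by rewrite opprB addrA subrK.
  apply: le_trans (ler_normB _ _) _.
  have : side i.1 <= side Q.1 :> R by rewrite ler_side ltW.
  by move: t; rewrite /touch; lra.
have IH : itg (fun x => H x * w x).
  apply: (@eq_itg _ _ (fun x => \sum_(Q <- P | heavy f lam Q)
    (insq (corner Q) (7 * side Q.1) x)%:R * w x)); first by move=> x; rewrite mulr_suml.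
  by apply: itg_sum => Q _; exact: lw.
have IT : itg (fun x => T x * w x).
  apply: (@eq_itg _ _ (fun x => \sum_(i <- s') coef i ^+ 2 *
    ((insq (corner i) (3 * side i.1) x)%:R * w x))).
    by move=> x; rewrite mulr_suml; apply: eq_bigr => i _; rewrite mulrA.
  by apply: itg_sum => i _; apply: itgZ; exact: lw.
have IHT : itg (fun x => H x * w x + lam ^- 2 * (T x * w x)) by apply: itgD => //; exact: itgZ.
have IU : itg (fun x => (lam ^+ 2 < sqfun x)%R%:R * w x).
  apply: le_itg _ _ IHT.
    by apply: measurable_funM => //; apply: measurable_ind; exact: measurable_sqfun.
  move=> x; rewrite ger0_norm ?mulr_ge0//.
  by apply: le_trans (ler_wpM2r (w0 x) (UHT x)) _; rewrite mulrDl mulrA.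
apply: (@le_trans _ _ (Int (fun x => H x * w x + lam ^- 2 * (T x * w x)))).
  apply: le_Int => // x.
  by apply: le_trans (ler_wpM2r (w0 x) (UHT x)) _; rewrite mulrDl mulrA.
rewrite IntD//; last exact: itgZ.
rewrite IntZ//.
have lH : Int (fun x => H x * w x) <= C1 * 7 ^+ n / lam * F.
  rewrite (@eq_Int _ _ _ (fun x => \sum_(Q <- P | heavy f lam Q)
    (insq (corner Q) (7 * side Q.1) x)%:R * w x)); last by move=> x; rewrite mulr_suml.
  rewrite Int_sum; last by move=> Q _; exact: lw.
  apply: (@le_trans _ _ (\sum_(Q <- P | heavy f lam Q) C1 * 7 ^+ n / lam * wmass Q)).
    apply: ler_sum => Q hQ; rewrite -/(wsq w (corner Q) (7 * side Q.1)).
    have V0 := vol_gt0 (R := R) (n := n) Q.1.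
    have s70 : 0 < 7 * side Q.1 :> R by rewrite mulr_gt0 ?side_gt0.
    have QQ (x : 'rV[R]_n) : inQ Q x -> insq (corner Q) (7 * side Q.1) x.
      move/inQ_dist => h; rewrite /insq (le_trans h)// ler_peMl ?side_ge0//.
      by rewrite ler1n.
    have := A1_cube s70 QQ; rewrite exprMn -/(vol n Q.1) => h.
    have W0 := wsq_ge0 wA1 (corner Q) (7 * side Q.1).
    have h2 := ler_wpM2l W0 (ltW hQ).
    rewrite mulrAC ler_pdivlMr// -(ler_pM2r V0); lra.
  rewrite -mulr_sumr ler_wpM2l ?sum_wmass//.
  by rewrite divr_ge0 ?(ltW lam0)// mulr_ge0 ?exprn_ge0 ?(ltW C10).
have lT : Int (fun x => T x * w x) <= (2 * good_cst + 2 * bad_cst) * lam * F.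
  rewrite (@eq_Int _ _ _ (fun x => \sum_(i <- s') coef i ^+ 2 *
    ((insq (corner i) (3 * side i.1) x)%:R * w x))); last first.
    by move=> x; rewrite mulr_suml; apply: eq_bigr => i _; rewrite mulrA.
  rewrite Int_sum; last by move=> i _; apply: itgZ; exact: lw.
  have us' : uniq s' by exact: filter_uniq.
  have cs' i : i \in s' -> coarse i by rewrite mem_filter => /andP[].
  have hg := good_bound us'; have hb := bad_bound us' cs'.
  apply: (@le_trans _ _ (2 * (\sum_(i <- s') wsq w (corner i) (3 * side i.1) *
      Int (fun x => psi i x * good_part x) ^+ 2) + 2 * (\sum_(i <- s')
      wsq w (corner i) (3 * side i.1) * (\sum_(Q <- P) Int (fun x =>
      psi i x * ((inQ Q x)%:R * (f x - avg Q)))) ^+ 2))); last by lra.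
  rewrite !mulr_sumr -big_split/=; apply: ler_sum => i _.
  rewrite IntZ; last exact: lw.
  rewrite -/(wsq w (corner i) (3 * side i.1)) /coef decompose.
  set a := Int _; set b := \sum_(Q <- P) _.
  have W0 := wsq_ge0 wA1 (corner i) (3 * side i.1).
  have h : (a + b) ^+ 2 <= 2 * a ^+ 2 + 2 * b ^+ 2.
    by have := sqr_ge0 (a - b); rewrite sqrrB sqrrD; lra.
  by have := ler_wpM2l W0 h; lra.
have F0 : 0 <= F by apply: Int_ge0 => x; rewrite mulr_ge0.
have l2 : 0 <= lam ^- 2 by rewrite invr_ge0 sqr_ge0.
apply: (le_trans (lerD lH (ler_wpM2l l2 lT))).
rewrite le_eqVlt; apply/orP; left; apply/eqP; rewrite /weak_cst.
by field; exact: lt0r_neq0.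
Qed.

End weak_type.

(** * The Morrey estimate for finitely many atoms *)
Section morrey_discrete.
Context {R : realType} {n : nat}.
Local Notation mu := (@lebesgue_row R n).
Variable alpha : R.
Hypothesis alpha01 : 0 < alpha <= 1.
Hypothesis n0 : (0 < n)%N.
Implicit Types (i j Q : idx n) (s P : seq (idx n)).
Variables (w : 'rV[R]_n -> R) (C1 : R).
Hypothesis wA1 : A1_sq w C1.
Variable psi : idx n -> 'rV[R]_n -> R.
Hypothesis psiP : forall i, atom alpha i (psi i).

Let C10 : 0 < C1. Proof. by case: wA1. Qed.
Let mw : measurable_fun setT w. Proof. by case: wA1. Qed.
Let w0 x : 0 <= w x. Proof. by case: wA1. Qed.
Let lw : loc_itg w. Proof. by case: wA1. Qed.

Lemma exists_level s : exists k0 : int, forall i, i \in s -> k0 <= i.1.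
Proof.
elim: s => [|i s [k Hk]]; first by exists 0.
exists (Order.min i.1 k) => j; rewrite inE => /orP[/eqP ->|/Hk jk]; first by rewrite ge_min lexx.
by rewrite ge_min jk orbT.
Qed.

(** The weak-type (1,1) inequality for finitely many atoms, with a constant
    that depends neither on their number nor on the atoms. *)
Lemma weak_type f s lam rho : itg f -> itg (fun x => `|f x| * w x) ->
  (forall x, f x != 0 -> insq 0 rho x) -> uniq s -> 0 < lam ->
  Int (fun x => (lam ^+ 2 < sqfun psi f s x)%R%:R * w x) <=
    weak_cst (n := n) alpha C1 / lam * Int (fun x => `|f x| * w x).
Proof.
move=> If Ifw fs us lam0; have [k0 Hk0] := exists_level s.
have [P [dP fP mP lP]] := cz_cubes If lam0 k0 n0 fs.
apply: (weak_type_cubes alpha01 wA1 psiP If Ifw us lam0 dP fP mP) => Q QP.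
have [->|Qk] := lP Q QP; first by left.
by right=> i /Hk0; exact: le_trans.
Qed.

Lemma int_log (r : R) : 0 < r -> exists k : int, side k <= r < side (k + 1).
Proof.
move=> r0; have l2 : 0 < ln 2 :> R by rewrite ln_gt0// ltr1n.
have sE (k : int) : side k = expR (k%:~R * ln 2) :> R.
  by rewrite /side -powR_intmul// /powR gt_eqF.
exists (Num.floor (ln r / ln 2)).
have := floor_itv (ln r / ln 2); rewrite !sE.
rewrite ler_pdivlMr// ltr_pdivrMr// => /andP[h1 h2].
by rewrite -{2 3}(lnK (x := r)) ?posrE// ler_expR ltr_expR h1.
Qed.

Definition shell_ratio : R := 1 + C1^-1.

Lemma shell_ratio_gt1 : 1 < shell_ratio.
Proof. by rewrite ltrDl invr_gt0. Qed.

(** The shell between two concentric cubes has at least the volume of the inner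
    cube, hence carries a fixed proportion of the weight. *)
Lemma reverse_doubling c r : 0 < r -> shell_ratio * wsq w c r <= wsq w c (2 * r).
Proof.
move=> r0; have r20 : 0 < 2 * r by rewrite mulr_gt0.
pose p (x : 'rV[R]_n) := insq c (2 * r) x && ~~ insq c r x.
have sub (x : 'rV[R]_n) : insq c r x -> insq c (2 * r) x.
  by rewrite /insq => h; lra.
have mp : measurable [set x | p x].
  rewrite (_ : mkset _ = [set x | insq c (2 * r) x] `\` [set x | insq c r x]).
    by apply: measurableD; exact: measurable_sq.
  apply/seteqP; split => x /=; first by move=> /andP[h /negP].
  by move=> [h /negP h']; apply/andP.
have pE (x : 'rV[R]_n) : (p x)%:R = (insq c (2 * r) x)%:R - (insq c r x)%:R :> R.
  rewrite /p; have := sub x; case: (insq c r x) => [->//|_]; first by rewrite subrr.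
  by rewrite andbT subr0.
have I1 : Int (fun x : 'rV[R]_n => (p x)%:R * 1) = (2 * (2 * r)) ^+ n - (2 * r) ^+ n.
  rewrite (@eq_Int _ _ _ (fun x => (insq c (2 * r) x)%:R - (insq c r x)%:R)).
    by rewrite IntB ?Int_sq ?(ltW r0) ?(ltW r20)//; apply: itg_sq; exact: ltW.
  by move=> x; rewrite mulr1 pE.
have E2 x : (p x)%:R * (1 * w x) = (insq c (2 * r) x)%:R * w x - (insq c r x)%:R * w x.
  by rewrite mul1r pE mulrBl.
have I2 : Int (fun x => (p x)%:R * (1 * w x)) = wsq w c (2 * r) - wsq w c r.
  by rewrite (eq_Int E2) IntB//; exact: lw.
have := @A1_Int _ _ _ _ wA1 c (2 * r) p (fun=> 1) r20.
rewrite I1 I2 => H.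
have {}H : wsq w c (2 * r) * ((2 * (2 * r)) ^+ n - (2 * r) ^+ n) <=
    C1 * (2 * r) ^+ n * (wsq w c (2 * r) - wsq w c r).
  apply: H => //; first by move=> x /andP[].
    apply: (@eq_itg _ _ (fun x => (insq c (2 * r) x)%:R - (insq c r x)%:R)).
      by move=> x; rewrite mulr1 pE.
    by apply: itgB; apply: itg_sq; exact: ltW.
  by apply: (@eq_itg _ _ _ _ (fun x => esym (E2 x))); apply: itgB; exact: lw.
have W0 := wsq_ge0 wA1 c r; have W2 := wsq_ge0 wA1 c (2 * r).
have v0 : 0 < (2 * r) ^+ n by rewrite exprn_gt0.
have W12 : wsq w c r <= wsq w c (2 * r) by exact: (le_wsq wA1).
have v1 : (2 * r) ^+ n <= (2 * (2 * r)) ^+ n - (2 * r) ^+ n.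
  rewrite [X in _ <= X - _]exprMn; have : 2 <= 2 ^+ n :> R.
    by rewrite -{1}[2]expr1 ler_weXn2l// ler1n.
  by move: v0; set V := (2 * r) ^+ n => v0 h2; nra.
(* A1 on the large cube, tested on the shell. *)
have H2 : wsq w c (2 * r) <= C1 * (wsq w c (2 * r) - wsq w c r).
  rewrite -(ler_pM2r v0); apply: le_trans (ler_wpM2l W2 v1) _.
  by apply: le_trans H _; rewrite mulrAC.
rewrite /shell_ratio mulrDl mul1r -lerBrDl mulrC ler_pdivrMr// mulrC.
exact: le_trans W12 H2.
Qed.

Lemma reverse_doubling_iter c r (d : nat) : 0 < r ->
  shell_ratio ^+ d * wsq w c r <= wsq w c (2 ^+ d * r).
Proof.
move=> r0; elim: d => [|d IH]; first by rewrite !expr0 !mul1r.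
rewrite !exprS -!mulrA; apply: le_trans (reverse_doubling c _); last first.
  by rewrite mulr_gt0// exprn_gt0.
by rewrite ler_wpM2l// ltW// (lt_trans _ shell_ratio_gt1).
Qed.

Variable kappa : R.
Hypothesis kappa01 : 0 < kappa < 1.
Variable f : 'rV[R]_n -> R.
Variable N : R.
Hypothesis mf : measurable_fun setT f.
Hypothesis lf : loc_itg (fun x => `|f x|).
Hypothesis lfw : loc_itg (fun x => `|f x| * w x).
Hypothesis N0 : 0 <= N.
Hypothesis fN : forall c r, 0 < r ->
  Int (fun x => (insq c r x)%:R * (`|f x| * w x)) <= N * wsq w c r `^ kappa.
Hypothesis wpos : forall c r, 0 < r -> 0 < wsq w c r.

Let kappa0 : 0 <= kappa. Proof. by case/andP: kappa01 => /ltW. Qed.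
Let kappa1 : kappa < 1. Proof. by case/andP: kappa01. Qed.

Definition far_decay : R := shell_ratio `^ (2 * (kappa - 1)).

Lemma far_decay01 : 0 <= far_decay < 1.
Proof.
rewrite powR_ge0/= /far_decay (_ : _ * _ = - (2 * (1 - kappa))); last by ring.
have t0 : 0 < shell_ratio by exact: lt_trans shell_ratio_gt1.
rewrite powRN invf_lt1 ?powR_gt0//.
have : 1 `^ (2 * (1 - kappa)) < shell_ratio `^ (2 * (1 - kappa)).
  by apply: gt0_ltr_powR; rewrite ?nnegrE ?(ltW t0) ?shell_ratio_gt1// mulr_gt0// subr_gt0.
by rewrite powR1.
Qed.

Lemma powR_anti (a b : R) : 0 < a -> a <= b ->
  b `^ (kappa - 1) <= a `^ (kappa - 1).
Proof.
move=> a0 ab; have b0 : 0 < b by exact: lt_le_trans ab.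
have -> : kappa - 1 = - (1 - kappa) by rewrite opprB.
rewrite 2!powRN lef_pV2 ?posrE ?powR_gt0//.
by apply: ge0_ler_powR; rewrite ?nnegrE ?(ltW a0) ?(ltW b0)// subr_ge0 ltW.
Qed.

(** If an atom is large compared with the cube of radius r around x0 and meets
    it, its support lies in the cube of radius [7 * side i.1] around x0; there
    the A1 condition trades the integral of |f| for the one of |f| w, which
    the Morrey norm controls. *)
Lemma coef_far x0 r x i : insq x0 r x -> r < side i.1 ->
  insq (corner i) (3 * side i.1) x ->
  `|coef psi f i| <= 2 * C1 * 7 ^+ n * N * wsq w x0 (side i.1) `^ (kappa - 1).
Proof.
move=> xr ri xi; have s0 := side_gt0 (R := R) i.1.
have V0 := vol_gt0 (R := R) (n := n) i.1.
have s70 : 0 < 7 * side i.1 :> R by rewrite mulr_gt0.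
have [mi si bi _ _] := psiP i.
have sub (y : 'rV[R]_n) : psi i y != 0 -> insq x0 (7 * side i.1) y.
  move=> /si; rewrite /insq in xr xi * => yi.
  rewrite (_ : y - x0 = (y - corner i) - (x - corner i) + (x - x0)); last first.
    by rewrite opprB !addrA subrK subrK.
  apply: le_trans (ler_normD _ _) _.
  have := ler_normB (y - corner i) (x - corner i); lra.
have Ipf : itg (fun y => psi i y * f y).
  apply: (le_itg (g := fun y => 2 / vol n i.1 * ((insq x0 (7 * side i.1) y)%:R * `|f y|))).
  - exact: measurable_funM.
  - move=> y; have [->|py] := eqVneq (psi i y) 0.
      by rewrite mul0r normr0 !mulr_ge0 ?invr_ge0 ?(ltW V0).
    by rewrite sub// mul1r normrM ler_wpM2r.
  - by apply: itgZ; exact: lf.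
have h1 : `|coef psi f i| <=
    2 / vol n i.1 * Int (fun y => (insq x0 (7 * side i.1) y)%:R * `|f y|).
  apply: le_trans (le_norm_Int Ipf) _; rewrite -IntZ; last exact: lf.
  apply: le_Int; [exact: itg_norm|by apply: itgZ; exact: lf|move=> y].
  have [->|py] := eqVneq (psi i y) 0.
    by rewrite mul0r normr0 !mulr_ge0 ?invr_ge0 ?(ltW V0).
  by rewrite sub// mul1r normrM ler_wpM2r.
have W7 := wpos x0 s70; have W1 := wpos x0 s0.
have h2 : wsq w x0 (7 * side i.1) * Int (fun y => (insq x0 (7 * side i.1) y)%:R * `|f y|)
    <= C1 * (7 * side i.1) ^+ n * (N * wsq w x0 (7 * side i.1) `^ kappa).
  apply: le_trans (A1_Int wA1 s70 (fun y h => h) (fun y => normr_ge0 (f y)) _ _) _.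
  - exact: lf.
  - exact: lfw.
  - by rewrite ler_wpM2l ?fN// mulr_ge0 ?(ltW C10)// exprn_ge0 ?ltW.
have h3 : Int (fun y => (insq x0 (7 * side i.1) y)%:R * `|f y|) <=
    C1 * 7 ^+ n * vol n i.1 * N * wsq w x0 (7 * side i.1) `^ (kappa - 1).
  rewrite powRB; last by apply/implyP => _; exact: lt0r_neq0.
  rewrite powRr1 ?(ltW W7)// mulrA ler_pdivlMr//; move: h2; rewrite exprMn -/(vol n i.1); lra.
have h4 : wsq w x0 (7 * side i.1) `^ (kappa - 1) <= wsq w x0 (side i.1) `^ (kappa - 1).
  apply: powR_anti => //.
  apply: (le_wsq wA1) => y; rewrite /insq => /le_trans; apply.
  by rewrite ler_peMl ?(ltW s0)// ler1n.
apply: le_trans h1 _.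
have h5 : 0 <= 2 / vol n i.1 :> R by rewrite divr_ge0 ?ltW.
apply: le_trans (ler_wpM2l h5 h3) _.
rewrite [leLHS](_ : _ = 2 * C1 * 7 ^+ n * N * wsq w x0 (7 * side i.1) `^ (kappa - 1)); last first.
  by field; exact: lt0r_neq0.
by rewrite ler_wpM2l// !mulr_ge0 ?exprn_ge0 ?(ltW C10).
Qed.

Definition far_count : R := 8 ^+ n / (1 - far_decay).
Definition far_cst : R := 2 * C1 * 7 ^+ n * far_count.

Lemma far_count_ge1 : 1 <= far_count.
Proof.
have /andP[q0 q1] := far_decay01; rewrite ler_pdivlMr ?subr_gt0// mul1r.
apply: (@le_trans _ _ 1); first by rewrite gerBl.
by rewrite exprn_ege1// ler1n.
Qed.

(** By reverse doubling the coefficients of the large atoms decay geometrically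
    in the scale; this is where kappa < 1 enters. *)
Lemma far_bound x0 r x s : 0 < r -> insq x0 r x -> uniq s ->
  (forall i, i \in s -> r < side i.1) ->
  sqfun psi f s x <= (far_cst * N * wsq w x0 r `^ (kappa - 1)) ^+ 2.
Proof.
move=> r0 xr us rs; have [k /andP[kr rk]] := int_log r0.
have W0 := wpos x0 r0.
pose A := 2 * C1 * 7 ^+ n * N * wsq w x0 r `^ (kappa - 1).
have A0 : 0 <= A by rewrite /A !mulr_ge0 ?exprn_ge0 ?powR_ge0 ?(ltW C10).
have t0 : 0 < shell_ratio by exact: lt_trans shell_ratio_gt1.
have H i : i \in s -> insq (corner i) (3 * side i.1) x ->
    coef psi f i ^+ 2 <= A ^+ 2 * far_decay ^+ absz (i.1 - (k + 1))%R.
  move=> si xi; have ri := rs _ si; have := coef_far xr ri xi.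
  have ki : k < i.1 by rewrite -(ltr_side (R := R)); exact: le_lt_trans kr ri.
  set d := `|_|%N.
  have iE : side i.1 = 2 ^+ d * side (k + 1) :> R.
    rewrite -sideDn; congr side; move: ki; rewrite /d; clear; lia.
  have W1 : shell_ratio ^+ d * wsq w x0 r <= wsq w x0 (side i.1).
    rewrite iE; apply: le_trans (reverse_doubling_iter x0 d (side_gt0 _)).
    rewrite ler_wpM2l ?exprn_ge0 ?(ltW t0)//; apply: (le_wsq wA1) => y.
    by rewrite /insq => /le_trans; apply; exact: ltW.
  have W2 : wsq w x0 (side i.1) `^ (kappa - 1) <= (shell_ratio ^+ d * wsq w x0 r) `^ (kappa - 1).
    have tW0 : 0 < shell_ratio ^+ d * wsq w x0 r by rewrite mulr_gt0// exprn_gt0.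
    exact: powR_anti.
  have E : (shell_ratio ^+ d * wsq w x0 r) `^ (kappa - 1) =
      wsq w x0 r `^ (kappa - 1) * shell_ratio `^ ((kappa - 1) * d%:R).
    rewrite powRM ?exprn_ge0 ?(ltW t0) ?(ltW W0)// mulrC; congr (_ * _).
    by rewrite -powR_mulrn ?(ltW t0)// -powRrM mulrC.
  have E2 : far_decay ^+ d = (shell_ratio `^ ((kappa - 1) * d%:R)) ^+ 2.
    rewrite /far_decay -(powR_mulrn d (powR_ge0 _ _)) -(powR_mulrn 2 (powR_ge0 _ _)).
    by rewrite -!powRrM; congr (_ `^ _); ring.
  move=> h; rewrite -(real_normK (num_real (coef _ _ _))) E2 -exprMn lerXn2r ?nnegrE//.
    by apply: mulr_ge0; [exact: A0|exact: powR_ge0].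
  apply: le_trans h _; rewrite /A -[leRHS]mulrA -E ler_wpM2l//.
  by rewrite !mulr_ge0 ?exprn_ge0 ?(ltW C10).
have Hsum : sqfun psi f s x <= A ^+ 2 * far_count.
  apply: (@le_trans _ _ (A ^+ 2 * \sum_(i <- s | k + 1 <= i.1)
     far_decay ^+ absz (i.1 - (k + 1))%R * (insq (corner i) (3 * side i.1) x)%:R)).
    rewrite mulr_sumr /sqfun big_seq [leRHS]big_seq_cond.
    rewrite [leRHS](eq_bigl (fun i => i \in s)); last first.
      move=> i; case si : (i \in s) => //=.
      have ki : k < i.1 by rewrite -(ltr_side (R := R)); apply: le_lt_trans kr _; exact: rs.
      by apply/idP; move: ki; clear; lia.
    apply: ler_sum => i si; have := H _ si.
    by case: (insq _ _ x) => [/(_ isT)|_]; rewrite ?mulr1// !mulr0.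
  rewrite ler_wpM2l ?sqr_ge0//; apply: sum_by_level; first exact: far_decay01.
    by rewrite exprn_ge0.
  move=> d; have V0 : 0 < vol n (k + 1 + d%:Z) :> R by exact: vol_gt0.
  rewrite -(ler_pM2r V0) mulr_suml.
  have r30 : 0 <= 3 * side (k + 1 + d%:Z) :> R by rewrite mulr_ge0 ?side_ge0.
  have -> : 8 ^+ n * vol n (k + 1 + d%:Z) =
      (2 * (3 * side (k + 1 + d%:Z) + side (k + 1 + d%:Z))) ^+ n :> R.
    by rewrite -exprMn; congr (_ ^+ n); ring.
  apply: le_trans (count_near (k + 1 + d%:Z) x us r30).
  rewrite big_mkcond [leRHS]big_mkcond/=; apply: ler_sum => i _.
  case: ifPn => [/andP[ki /eqP Ed]|_]; last by case: ifP => // _; exact: ltW.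
  rewrite (_ : i.1 = k + 1 + d%:Z); last by move: ki Ed; clear; lia.
  rewrite eqxx /= /insq distrC.
  by case: ifP => _; rewrite ?mul1r ?mul0r.
apply: le_trans Hsum _.
have F1 := far_count_ge1.
rewrite (_ : far_cst * N * _ = A * far_count); last by rewrite /A /far_cst; ring.
rewrite [leRHS]exprMn; apply: ler_wpM2l; first exact: sqr_ge0.
by rewrite expr2 ler_peMl//; lra.
Qed.

Lemma weak_cst_ge0 : 0 <= weak_cst (n := n) alpha C1.
Proof.
have /andP[q0 q1] := decay01 alpha01.
have L0 := bessel_cst_gt0 (n := n) alpha01.
have B0 : 0 <= bad_height (R := R) (n := n) by rewrite !mulr_ge0 ?exprn_ge0.
have D0 : 0 <= 14 ^+ n / (1 - decay alpha) :> R.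
  by rewrite divr_ge0 ?exprn_ge0// subr_ge0 ltW.
have C1n (a : R) : 0 <= a -> 0 <= C1 * a ^+ n.
  by move=> a0; rewrite mulr_ge0 ?(ltW C10)// exprn_ge0.
have G0 : 0 <= good_cst (n := n) alpha C1.
  by apply: mulr_ge0; [apply: mulr_ge0; [exact: ltW|exact: C1n]|exact: C1n].
have D1 : 0 <= bad_cst (n := n) alpha C1.
  apply: mulr_ge0; last exact: D0.
  apply: mulr_ge0; first exact: B0.
  by rewrite !mulr_ge0 ?exprn_ge0 ?(ltW C10).
by apply: addr_ge0; [apply: addr_ge0; [exact: C1n|]|]; apply: mulr_ge0.
Qed.

Definition morrey_cst : R :=
  2 * weak_cst (n := n) alpha C1 * (C1 * (7 / 2) ^+ n) `^ kappa + 2 * far_cst.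

Lemma morrey_cst_ge0 : 0 <= morrey_cst.
Proof.
have F1 := far_count_ge1.
apply: addr_ge0; apply: mulr_ge0 => //; last first.
  apply: mulr_ge0; last by lra.
  by rewrite !mulr_ge0 ?exprn_ge0 ?(ltW C10).
  exact: powR_ge0.
by apply: mulr_ge0 => //; exact: weak_cst_ge0.
Qed.

Lemma itg_level g s lam : 0 < lam -> itg (fun x => (lam ^+ 2 < sqfun psi g s x)%R%:R * w x).
Proof.
move=> l0; have l2 : 0 < lam ^+ 2 by rewrite exprn_gt0.
have c0 i x : 0 <= coef psi g i ^+ 2 * (insq (corner i) (3 * side i.1) x)%:R.
  by rewrite mulr_ge0 ?sqr_ge0.
have S0 x : 0 <= sqfun psi g s x by apply: sumr_ge0 => i _; exact: c0.
have IS : itg (fun x => sqfun psi g s x * w x).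
  apply: (@eq_itg _ _ (fun x => \sum_(i <- s) coef psi g i ^+ 2 *
    ((insq (corner i) (3 * side i.1) x)%:R * w x))).
    by move=> x; rewrite mulr_suml; apply: eq_bigr => i _; rewrite mulrA.
  by apply: itg_sum => i _; apply: itgZ; exact: lw.
apply: le_itg _ _ (itgZ (lam ^+ 2)^-1 IS).
  by apply: measurable_funM => //; apply: measurable_ind; exact: measurable_sqfun.
move=> x; rewrite ger0_norm ?mulr_ge0// mulrA ler_wpM2r//.
rewrite mulrC ler_pdivlMr//; case: ltP => [lx|_]; first by rewrite mul1r ltW.
by rewrite mul0r.
Qed.

(** The atoms of scale at most r that meet the cube of radius r only see f on its
    7-fold dilate, where the weak-type inequality applies; the other ones add
    up to at most D^2 at every point. If sigma is at most 2 D, the bound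
    by the weight of the whole cube suffices. *)
Lemma morrey_fin x0 r s sigma : 0 < r -> uniq s -> 0 < sigma ->
  Int (fun x => (insq x0 r x && (sigma ^+ 2 < sqfun psi f s x))%R%:R * w x) <=
    morrey_cst / sigma * N * wsq w x0 r `^ kappa.
Proof.
move=> r0 us sg0.
pose near i : bool := side i.1 <= r :> R.
pose s1 := [seq i <- s | near i]; pose s2 := [seq i <- s | ~~ near i].
have W0 := wpos x0 r0.
have us1 : uniq s1 by exact: filter_uniq.
have us2 : uniq s2 by exact: filter_uniq.
have sE x : sqfun psi f s x = sqfun psi f s1 x + sqfun psi f s2 x.
  by rewrite /sqfun /s1 /s2 !big_filter [LHS](bigID near).
pose f1 x := (insq x0 (7 * r) x)%:R * f x.
have f1s x : f1 x != 0 -> insq x0 (7 * r) x.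
  by rewrite /f1; case: (insq _ _ x) => //; rewrite mul0r eqxx.
have mf1 : measurable_fun setT f1.
  by apply: measurable_funM => //; apply: measurable_ind; exact: measurable_sq.
have If1 : itg f1.
  apply: le_itg mf1 _ (lf x0 (7 * r)) => x.
  by rewrite /f1 normrM ger0_norm.
have E1 x : `|f1 x| * w x = (insq x0 (7 * r) x)%:R * (`|f x| * w x).
  by rewrite /f1 normrM ger0_norm// mulrA.
have If1w : itg (fun x => `|f1 x| * w x).
  by apply: (@eq_itg _ _ _ _ (fun x => esym (E1 x))); exact: lfw.
have s1E x : insq x0 r x -> sqfun psi f s1 x = sqfun psi f1 s1 x.
  move=> xr; rewrite /sqfun big_seq [RHS]big_seq; apply: eq_bigr => i.
  rewrite mem_filter => /andP[ni _]; case xi : (insq (corner i) _ x); last by rewrite !mulr0.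
  congr (_ ^+ 2 * _); apply: eq_Int => y; rewrite /f1.
  have [yi|/(atom_eq0 (psiP i)) ->] := boolP (insq (corner i) (3 * side i.1) y); last by rewrite !mul0r.
  rewrite (_ : insq _ _ y) ?mul1r//.
  rewrite /insq in xr xi yi *; rewrite /near in ni.
  rewrite (_ : y - x0 = (y - corner i) - (x - corner i) + (x - x0)); last first.
    by rewrite opprB !addrA subrK subrK.
  apply: le_trans (ler_normD _ _) _.
  have := ler_normB (y - corner i) (x - corner i); lra.
pose D := far_cst * N * wsq w x0 r `^ (kappa - 1).
have D0 : 0 <= D.
  rewrite /D mulr_ge0 ?powR_ge0// mulr_ge0//; have F1 := far_count_ge1.
  apply: mulr_ge0; last by lra.
  by rewrite !mulr_ge0 ?exprn_ge0 ?(ltW C10).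
have s2D x : insq x0 r x -> sqfun psi f s2 x <= D ^+ 2.
  move=> xr; apply: far_bound => // i; rewrite mem_filter => /andP[+ _].
  by rewrite /near -ltNge.
have Isq (p : 'rV[R]_n -> bool) : measurable [set x : 'rV[R]_n | p x] -> itg (fun x => (insq x0 r x && p x)%:R * w x).
  move=> mp; apply: (itg_sub_sq wA1 (c := x0) (r := r)); last by move=> x /andP[].
  rewrite (_ : mkset _ = [set x | insq x0 r x] `&` [set x | p x]).
    by apply: measurableI => //; exact: measurable_sq.
  by apply/seteqP; split => x /= /andP.
have mU : measurable [set x | sigma ^+ 2 < sqfun psi f s x] by exact: measurable_sqfun.
have wc0 := weak_cst_ge0.
have P0 : 0 <= wsq w x0 r `^ kappa by exact: powR_ge0.
have F0 : 0 <= far_cst.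
  have F1 := far_count_ge1; apply: mulr_ge0; last by lra.
  by rewrite !mulr_ge0 ?exprn_ge0 ?(ltW C10).
have [sD|Ds] := leP sigma (2 * D).
  apply: (@le_trans _ _ (wsq w x0 r)).
    apply: le_Int => [||x]; [exact: Isq|exact: lw|].
    by rewrite ler_wpM2r// ler_nat; case: (insq x0 r x) => //; case: (_ < _)%R.
  have h1 : wsq w x0 r * sigma <= 2 * far_cst * N * wsq w x0 r `^ kappa.
    apply: le_trans (ler_wpM2l (ltW W0) sD) _; rewrite /D.
    have -> : wsq w x0 r `^ (kappa - 1) = wsq w x0 r `^ kappa / wsq w x0 r.
      by rewrite powRB ?powRr1 ?(ltW W0)//; apply/implyP => _; exact: lt0r_neq0.
    by rewrite le_eqVlt; apply/orP; left; apply/eqP; field; exact: lt0r_neq0.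
  rewrite [leRHS](_ : _ = morrey_cst * N * wsq w x0 r `^ kappa / sigma); last by ring.
  rewrite ler_pdivlMr//; apply: le_trans h1 _.
  rewrite ler_wpM2r// ler_wpM2r// /morrey_cst lerDr.
  by apply: mulr_ge0; [exact: mulr_ge0|exact: powR_ge0].
have sg2 : 0 < sigma / 2 by rewrite divr_gt0.
apply: (@le_trans _ _ (Int (fun x => ((sigma / 2) ^+ 2 < sqfun psi f1 s1 x)%R%:R * w x))).
  apply: le_Int => [||x]; first exact: Isq.
    exact: itg_level.
  rewrite ler_wpM2r// ler_nat; case: (boolP (insq x0 r x)) => //= xr.
  case: ltP => //= sx; rewrite lt0b.
  rewrite sE s1E// in sx; have h1 := s2D x xr.
  have h2 : D ^+ 2 <= (sigma / 2) ^+ 2.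
    by rewrite lerXn2r ?nnegrE ?(ltW sg2)//; lra.
  by move: sx h2; rewrite expr_div_n; have := sqr_ge0 sigma; lra.
have fs x : f1 x != 0 -> insq 0 (7 * r + `|x0|) x.
  move=> /f1s; rewrite /insq subr0 => h.
  by have := ler_normD (x - x0) x0; rewrite subrK; lra.
apply: le_trans (weak_type If1 If1w fs us1 sg2) _.
have h1 : Int (fun x => `|f1 x| * w x) <= N * ((C1 * (7 / 2) ^+ n) `^ kappa * wsq w x0 r `^ kappa).
  have r70 : 0 < 7 * r by rewrite mulr_gt0.
  rewrite (eq_Int E1); apply: le_trans (fN x0 r70) _; apply: ler_wpM2l => //.
  rewrite -powRM ?(ltW W0)//; last by rewrite mulr_ge0 ?exprn_ge0 ?divr_ge0 ?(ltW C10).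
  apply: ge0_ler_powR => //; rewrite ?nnegrE.
  - exact/ltW/wpos.
  - by rewrite !mulr_ge0 ?exprn_ge0 ?divr_ge0 ?(ltW C10) ?(ltW W0).
  - by apply: (doubling wA1) => //; rewrite ler1n.
have h2 : 0 <= weak_cst (n := n) alpha C1 / (sigma / 2) by rewrite divr_ge0// ltW.
apply: le_trans (ler_wpM2l h2 h1) _.
rewrite [leLHS](_ : _ = 2 * weak_cst (n := n) alpha C1 * (C1 * (7 / 2) ^+ n) `^ kappa / sigma *
  N * wsq w x0 r `^ kappa); last by field; exact: lt0r_neq0.
rewrite ler_wpM2r// ler_wpM2r// ler_wpM2r ?invr_ge0 ?(ltW sg0)//.
by rewrite /morrey_cst lerDl mulr_ge0.
Qed.

End morrey_discrete.

(** * Integrals of arbitrary functions *)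
Section any_function.
Local Open Scope ereal_scope.
Context d (T : measurableType d) (R : realType).
Variable mu : {measure set T -> \bar R}.
Import HBNNSimple.

(** The integral of a nonnegative function is a supremum over Borel simple
    functions below it, and these may be cut down to vanish on the null set. *)
Lemma ae_le_integral_any (f g : T -> \bar R) (N : set T) :
  (forall x, 0 <= f x) -> (forall x, 0 <= g x) ->
  measurable N -> mu N = 0 -> (forall x, ~ N x -> f x <= g x) ->
  \int[mu]_x f x <= \int[mu]_x g x.
Proof.
move=> f0 g0 mN N0 fg; rewrite [leLHS]ge0_integralTE// [leRHS]ge0_integralTE//.
apply: ge_ereal_sup => _ [h hf <-]; apply: ereal_sup_ubound.
exists (proj_nnsfun h (measurableC mN)).
  move=> x /=; have [xN|xN] := pselect (N x).
    by rewrite mindicE memNset ?mulr0//=; apply.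
  by rewrite mindicE mem_set// mulr1; apply: le_trans (hf x) _; exact: fg.
rewrite -!integralT_nnsfun; apply: ae_eq_integral => //.
- exact/measurable_EFinP.
- exact/measurable_EFinP.
- exists N; split => // x /= H; apply: contrapT => xN; apply: H => _.
  by rewrite mindicE mem_set// mulr1.
Qed.

Lemma ae_le_integral_sets (D E : set T) (f g : T -> \bar R) (N : set T) :
  (forall x, D x -> 0 <= f x) -> (forall x, E x -> 0 <= g x) ->
  measurable N -> mu N = 0 -> D `<=` E ->
  (forall x, D x -> ~ N x -> f x <= g x) ->
  \int[mu]_(x in D) f x <= \int[mu]_(x in E) g x.
Proof.
move=> f0 g0 mN N0 DE fg; rewrite integral_mkcond [leRHS]integral_mkcond.
apply: (@ae_le_integral_any _ _ N) => //.
- by move=> x; rewrite patchE; case: ifPn => // /set_mem; exact: f0.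
- by move=> x; rewrite patchE; case: ifPn => // /set_mem; exact: g0.
- move=> x xN; rewrite !patchE; case: ifPn => [/set_mem xD|_].
    by rewrite mem_set ?fg//; exact: DE.
  by case: ifPn => // /set_mem; exact: g0.
Qed.

Lemma ae_eq_integral_any (f g : T -> \bar R) (N : set T) :
  measurable N -> mu N = 0 -> (forall x, ~ N x -> f x = g x) ->
  \int[mu]_x f x = \int[mu]_x g x.
Proof.
move=> mN N0 fg; rewrite integralE [RHS]integralE; congr (_ - _);
  apply/eqP; rewrite eq_le; apply/andP; split; apply: (@ae_le_integral_any _ _ N) => //.
- by move=> x xN; rewrite !funeposE fg.
- by move=> x xN; rewrite !funeposE fg.
- by move=> x xN; rewrite !funenegE fg.
- by move=> x xN; rewrite !funenegE fg.
Qed.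

End any_function.

(** * Borel versions of Lebesgue measurable functions *)
Section borel_version.
Context {R : realType} {n : nat}.
Local Notation mu := (@lebesgue_row R n).

(** For each rational q the set where f0 exceeds q is Borel up to a null set. The
    union N of Borel null sets containing these exceptional sets works for all
    superlevel sets at once. *)
Lemma borel_version (f0 : 'rV[R]_n -> R) : lebesgue_measurable_fun f0 ->
  exists N : set 'rV[R]_n, [/\ measurable N, mu N = 0 &
    measurable_fun setT (fun x => \1_(~` N) x * f0 x)].
Proof.
move=> mf.
have /choice[A HA] : forall q : rat, exists A : set 'rV[R]_n * set 'rV[R]_n,
    [/\ measurable A.1, measurable A.2, mu A.2 = 0,
      A.1 `<=` f0 @^-1` `]ratr q, +oo[%classic &
      f0 @^-1` `]ratr q, +oo[%classic `<=` A.1 `|` A.2].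
  move=> q; have [A mA [B [M [mM M0 BM]] <-]] := mf _ (measurable_itv `]ratr q, +oo[).
  by exists (A, M); split => //= x; case=> [?|/BM ?]; [left|right].
pose F m := if (unpickle m : option rat) is Some q then (A q).2 else set0.
have mF m : measurable (F m).
  by rewrite /F; case: unpickle => // q; have [] := HA q.
have F0 m : mu (F m) = 0.
  by rewrite /F; case: unpickle => [q|]; [have [] := HA q|rewrite measure0].
pose N := \bigcup_m F m.
have mN : measurable N by exact: bigcup_measurable.
have N0 : mu N = 0.
  have : mu.-negligible N.
    by apply: negligible_bigcup => k; exists (F k); split => //; exact: F0.
  by move/negligibleP => /(_ mN).
exists N; split => //.
apply: (measurability _ (RGenOInfty.measurableE R)) => //.
move=> _ [_ [a ->] <-]; rewrite setTI.
rewrite (_ : _ @^-1` _ = ((\bigcup_q (if a < ratr q then (A q).1 else set0)) `\` N) `|`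
    (if a < 0 then N else set0)).
  apply: measurableU; last by case: ifP.
  apply: measurableD => //; apply: bigcupT_measurable_rat => q.
  by case: ifP => // _; have [] := HA q.
apply/seteqP; split => x /=; rewrite in_itv/= andbT.
  have [xN|xN] := pselect (N x).
    have -> : \1_(~` N) x = 0 :> R by rewrite indicE memNset//; apply.
    by rewrite mul0r => ->; right.
  rewrite indicE mem_set// mul1r => ax; left; split => //.
  have [q] := rat_in_itvoo ax; rewrite in_itv/= => /andP[aq qx].
  exists q => //; rewrite aq; have [_ _ _ _ /(_ x)] := HA q.
  rewrite /= in_itv/= andbT => /(_ qx) [//|xA]; exfalso; apply: xN.
  have Fq : F (pickle q) = (A q).2 by rewrite /F pickleK.
  by exists (pickle q); [exact: I|rewrite Fq].
move=> [[[q _]]|].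
  case: ifP => // aq xA xN; rewrite indicE mem_set// mul1r.
  by have [_ _ _ /(_ _ xA) + _] := HA q; rewrite /= in_itv/= andbT; exact: lt_trans.
case: ifP => // a0 xN.
have -> : \1_(~` N) x = 0 :> R by rewrite indicE memNset//; apply.
by rewrite mul0r.
Qed.

End borel_version.

(** * From test functions to atoms *)
Section holder_atoms.
Context {R : realType} {n : nat}.
Local Notation mu := (@lebesgue_row R n).
Variable alpha : R.
Hypothesis alpha01 : 0 < alpha <= 1.
Hypothesis n0 : (0 < n)%N.
Let alpha0 : 0 < alpha. Proof. by case/andP: alpha01. Qed.
Let alpha1 : alpha <= 1. Proof. by case/andP: alpha01. Qed.

Lemma holder_measurable (f : 'rV[R]_n -> R) (K : R) :
  (forall x y, `|f x - f y| <= K * `|x - y| `^ alpha) -> measurable_fun setT f.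
Proof.
move=> H; apply: continuous_measurable_row => x.
have FF : Filter (nbhs x) := nbhs_filter x.
apply/(@cvgrPdist_lt R R _ (nbhs x) FF f (f x)) => e e0.
have K0 : 0 < `|K| + 1 by rewrite ltr_wpDl.
(* Chosen so that K d^alpha < e. *)
pose d := (e / (`|K| + 1)) `^ alpha^-1.
have d0 : 0 < d by rewrite powR_gt0// divr_gt0.
have dE : d `^ alpha = e / (`|K| + 1).
  by rewrite /d -powRrM mulVf ?lt0r_neq0// powRr1// divr_ge0// ltW.
apply: filterS (nbhsx_ballx x d d0) => y; rewrite mx_norm_ball /ball_ /= => xy.
apply: le_lt_trans (H x y) _.
have h1 : `|x - y| `^ alpha < e / (`|K| + 1).
  by rewrite -dE; apply: gt0_ltr_powR; rewrite ?nnegrE// ltW.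
apply: (@le_lt_trans _ _ (`|K| * `|x - y| `^ alpha)).
  by rewrite ler_wpM2r ?powR_ge0// ler_norm.
apply: (@le_lt_trans _ _ (`|K| * (e / (`|K| + 1)))).
  by rewrite ler_wpM2l// ltW.
by rewrite mulrA ltr_pdivrMr// mulrC ltr_pM2l// ltrDl.
Qed.

Lemma enorm_delta (a : R) (j : 'I_n) : enorm (a *: delta_mx ord0 j) = `|a|.
Proof.
rewrite enormZ /enorm (bigD1 j)//= !mxE !eqxx/= big1 => [|i ij].
  by rewrite addr0 expr1n sqrtr1 mulr1.
by rewrite !mxE (negbTE ij) andbF expr0n.
Qed.

Variable phi : 'rV[R]_n -> R.
Hypothesis phiP : holder_class alpha phi.

Lemma holder_supp x : phi x != 0 -> enorm x <= 1.
Proof. by case: phiP => cs _ _ /= px; apply: cs; exact: subset_closure. Qed.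

(** Moving by 2 away from 0 in a coordinate direction leaves the unit ball, where
    phi vanishes. *)
Lemma holder_bound x : `|phi x| <= 2.
Proof.
have [->|px] := eqVneq (phi x) 0; first by rewrite normr0.
have [_ _ H] := phiP.
pose j : 'I_n := Ordinal n0.
have xj : `|x ord0 j| <= 1.
  exact: le_trans (coord_le_norm x j) (le_trans (norm_le_enorm x) (holder_supp px)).
(* The sign makes the j-th coordinate of x' larger than 1 in absolute value. *)
pose a : R := if 0 <= x ord0 j then 2 else - 2.
have a2 : `|a| = 2 by rewrite /a; case: ifP => _; rewrite ?normrN ger0_norm.
pose x' := x + a *: delta_mx ord0 j.
have px' : phi x' = 0.
  apply/eqP; apply: contraT => /holder_supp h; exfalso.
  have := le_trans (coord_le_norm x' j) (le_trans (norm_le_enorm x') h).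
  rewrite /x' !mxE !eqxx/= mulr1 /a; move: xj; rewrite !ler_norml.
  by case: ifP => h0 /andP[? ?] /andP[? ?]; lra.
have := H x x'; rewrite px' subr0 => /le_trans; apply.
rewrite /x' opprD addrA subrr sub0r enormN enorm_delta a2.
by apply: ler1_powR => //; rewrite ler1n.
Qed.

(** Every dilate of a test function that the Whitney box over a dyadic cube can see
    is an atom of that cube. *)
Lemma dilate_atom y t (i : idx n) : inQ i y -> side i.1 <= t < side (i.1 + 1) ->
  atom alpha i (fun z : 'rV[R]_n => dilate phi t (y - z)).
Proof.
move=> iy /andP[st ts]; have s0 := side_gt0 (R := R) i.1.
have t0 : 0 < t by exact: lt_le_trans st.
have tn0 : 0 < t ^+ n by rewrite exprn_gt0.
have V0 := vol_gt0 (R := R) (n := n) i.1.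
have Vt : vol n i.1 <= t ^+ n by rewrite lerXn2r ?nnegrE ?(ltW t0) ?(ltW s0).
have tV : t ^- n <= (vol n i.1)^-1 by rewrite lef_pV2 ?posrE.
have [_ phi0 H] := phiP.
have hd z z' : `|dilate phi t (y - z) - dilate phi t (y - z')| <=
    n.+1%:R / vol n i.1 * (`|z - z'| / side i.1) `^ alpha.
  rewrite /dilate -mulrBr normrM ger0_norm ?invr_ge0 ?(ltW tn0)//.
  rewrite [n.+1%:R / _]mulrC -mulrA; apply: ler_pM => //; first by rewrite invr_ge0 ltW.
  apply: le_trans (H _ _) _.
  rewrite (_ : t^-1 *: (y - z) - t^-1 *: (y - z') = - (t^-1 *: (z - z'))); last first.
    by rewrite -scalerBr -scalerN !opprB [X in _ *: X]addrC subrKA.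
  rewrite enormN enormZ gtr0_norm ?invr_gt0//.
  apply: (@le_trans _ _ ((n.+1%:R * (`|z - z'| / side i.1)) `^ alpha)).
    apply: ge0_ler_powR; rewrite ?nnegrE ?(ltW alpha0)//.
    - by rewrite mulr_ge0 ?invr_ge0 ?(ltW t0)// enorm_ge0.
    - by rewrite mulr_ge0// divr_ge0// ltW.
    apply: (@le_trans _ _ (t^-1 * (n%:R * `|z - z'|))).
      by rewrite ler_wpM2l ?invr_ge0 ?(ltW t0)// enorm_le_norm.
    rewrite mulrC -mulrA ler_pM ?mulr_ge0 ?invr_ge0 ?(ltW t0)//.
      by rewrite ler_nat.
    by rewrite ler_wpM2l// lef_pV2 ?posrE.
  rewrite powRM ?divr_ge0 ?(ltW s0)// ler_wpM2r ?powR_ge0//.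
  by apply: ler1_powR => //; rewrite ler1n.
have hs z : dilate phi t (y - z) != 0 -> insq (corner i) (3 * side i.1) z.
  rewrite /dilate mulf_eq0 negb_or => /andP[_ /holder_supp h].
  have := le_trans (norm_le_enorm _) h.
  rewrite normrZ gtr0_norm ?invr_gt0// ler_pdivrMl// mulr1 => yz.
  rewrite /insq (_ : z - corner i = (y - corner i) - (y - z)); last first.
    by rewrite opprB [RHS]addrC subrKA.
  apply: le_trans (ler_normB _ _) _.
  by have := inQ_dist iy; move: ts; rewrite sideS; lra.
have hb z : `|dilate phi t (y - z)| <= 2 / vol n i.1.
  rewrite /dilate normrM ger0_norm ?invr_ge0 ?(ltW tn0)// mulrC.
  by apply: ler_pM => //; rewrite ?invr_ge0 ?(ltW tn0)// holder_bound.
have hm : measurable_fun setT (fun z : 'rV[R]_n => dilate phi t (y - z)).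
  apply: (@holder_measurable _ (n.+1%:R / vol n i.1 * ((side i.1)^-1 `^ alpha))) => z z'.
  apply: le_trans (hd _ _) _; rewrite powRM ?invr_ge0 ?(ltW s0)//.
  by rewrite -!mulrA [_ * (side i.1)^-1 `^ _]mulrC.
split => //.
have s30 : 0 <= 3 * side i.1 :> R by rewrite mulr_ge0 ?side_ge0.
have Id := itg_supp_sq s30 hm hb hs.
have mphi : measurable_fun setT phi.
  apply: (@holder_measurable _ (n%:R `^ alpha)) => x x'.
  apply: le_trans (H x x') _; rewrite -powRM//.
  apply: ge0_ler_powR; rewrite ?nnegrE ?(ltW alpha0) ?enorm_ge0 ?mulr_ge0//.
  exact: enorm_le_norm.
have Iphi : itg phi.
  apply: (itg_supp_sq (c := 0) ler01 mphi holder_bound) => x px.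
  by rewrite /insq subr0; apply: le_trans (norm_le_enorm x) (holder_supp px).
have Ia : itg (phi \o affv y t).
  apply: eq_itg (itgZ (t ^+ n) Id) => z.
  by rewrite /dilate mulrA mulfV ?mul1r// lt0r_neq0.
rewrite (_ : (fun z : 'rV[R]_n => dilate phi t (y - z)) = (fun z => t ^- n * (phi \o affv y t) z))//.
by rewrite IntZ// Int_affv ?mulr0// /Int /Rintegral phi0.
Qed.

End holder_atoms.

Section optimal_atoms.
Context {R : realType} {n : nat}.
Variable alpha : R.
Variable f : 'rV[R]_n -> R.
Hypothesis mf : measurable_fun setT f.
Hypothesis lf : loc_itg (fun x => `|f x|).

Lemma loc_atom_itg (i : idx n) psi : atom alpha i psi -> itg (fun x => psi x * f x).
Proof.
move=> [mi si bi _ _]; have V0 := vol_gt0 (R := R) (n := n) i.1.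
apply: (le_itg (g := fun y => 2 / vol n i.1 * ((insq (corner i) (3 * side i.1) y)%:R * `|f y|))).
- exact: measurable_funM.
- move=> y; have [->|py] := eqVneq (psi y) 0.
    by rewrite mul0r normr0 !mulr_ge0 ?invr_ge0 ?(ltW V0).
  by rewrite si// mul1r normrM ler_wpM2r.
- by apply: itgZ; exact: lf.
Qed.

Lemma atom0 (i : idx n) : 0 < alpha -> atom alpha i (fun=> 0).
Proof.
move=> a0; split => //.
- by move=> x; rewrite eqxx.
- by move=> x; rewrite normr0 divr_ge0// vol_ge0.
- by move=> x y; rewrite subrr normr0 mulr_ge0 ?powR_ge0// divr_ge0 ?vol_ge0.
- exact: Int0.
Qed.

(** One atom for each cube that realizes, up to a factor 2, the supremum over
    all atoms of the cube. *)
Lemma optimal_atoms : 0 < alpha -> exists psi : idx n -> 'rV[R]_n -> R,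
  (forall i, atom alpha i (psi i)) /\ forall i psi', atom alpha i psi' ->
    `|Int (fun x => psi' x * f x)| <= 2 * `|coef psi f i|.
Proof.
move=> a0; suff /choice[psi H] : forall i : idx n, exists psi : 'rV[R]_n -> R,
    atom alpha i psi /\ forall psi', atom alpha i psi' ->
    `|Int (fun x => psi' x * f x)| <= 2 * `|Int (fun x => psi x * f x)|.
  by exists psi; split => i; have [] := H i.
move=> i; pose E := [set `|Int (fun x => psi x * f x)| | psi in atom alpha i].
have V0 := vol_gt0 (R := R) (n := n) i.1.
pose M := 2 / vol n i.1 * Int (fun y => (insq (corner i) (3 * side i.1) y)%:R * `|f y|).
have EM : ubound E M.
  move=> _ [psi ap <-]; apply: le_trans (le_norm_Int (loc_atom_itg ap)) _.
  rewrite /M -IntZ; last exact: lf.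
  apply: le_Int; [by apply: itg_norm; exact: loc_atom_itg ap|by apply: itgZ; exact: lf|move=> y].
  have [_ si bi _ _] := ap; have [->|py] := eqVneq (psi y) 0.
    by rewrite mul0r normr0 !mulr_ge0 ?invr_ge0 ?(ltW V0).
  by rewrite si// mul1r normrM ler_wpM2r.
have hE : has_sup E.
  split; first by exists `|Int (fun x => 0 * f x)|; exists (fun=> 0) => //; exact: atom0.
  by exists M.
have supE psi : atom alpha i psi -> `|Int (fun x => psi x * f x)| <= sup E.
  by move=> ap; apply: ub_le_sup; [exists M|exists psi].
have [s0|s0] := leP (sup E) 0.
  exists (fun=> 0); split; first exact: atom0.
  by move=> psi /supE h; apply: le_trans h _; apply: le_trans s0 _; rewrite mulr_ge0.
have [_ [psi ap <-] h] := sup_adherent (divr_gt0 s0 (ltr0Sn R 1)) hE.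
by exists psi; split => // psi' /supE; move: h; rewrite /=; lra.
Qed.

End optimal_atoms.

(** * Discretization of the area integral *)
Section discretization.
Context {R : realType} {n : nat}.
Local Notation mu := (@lebesgue_row R n).
Local Notation leb := (@lebesgue_measure R).
Variable alpha : R.
Hypothesis alpha01 : 0 < alpha <= 1.
Hypothesis n0 : (0 < n)%N.
Variables (f0 f : 'rV[R]_n -> R) (N : set 'rV[R]_n).
Hypothesis mf : measurable_fun setT f.
Hypothesis lf : loc_itg (fun x => `|f x|).
Hypothesis mN : measurable N.
Hypothesis N0 : mu N = 0%E.
Hypothesis f0f : forall x, ~ N x -> f0 x = f x.
Variable psi : idx n -> 'rV[R]_n -> R.
Hypothesis opt : forall (i : idx n) psi', atom alpha i psi' ->
  `|Int (fun x => psi' x * f x)| <= 2 * `|coef psi f i|.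
Let alpha0 : 0 < alpha. Proof. by case/andP: alpha01. Qed.

Lemma holder_class0 : holder_class alpha (fun=> 0 : R) (n := n).
Proof.
split.
- rewrite (_ : mkset _ = set0) ?closure0//; apply/seteqP.
  by split => // x /=; rewrite eqxx.
- by rewrite integral0.
- by move=> x x'; rewrite subrr normr0 powR_ge0.
Qed.

Lemma intrinsic_sup_ge0 y t : (0 <= intrinsic_sup alpha f0 y t)%E.
Proof.
apply: le_trans (abse_ge0 _) (ereal_sup_ubound _).
by exists (fun=> 0) => //; exact: holder_class0.
Qed.

Lemma intrinsic_sup_le y t (i : idx n) : inQ i y -> side i.1 <= t < side (i.1 + 1) ->
  (intrinsic_sup alpha f0 y t <= (2 * `|coef psi f i|)%:E)%E.
Proof.
move=> iy it; apply: ge_ereal_sup => _ [phi phiP <-].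
have ap := dilate_atom alpha01 n0 phiP iy it.
rewrite (@ae_eq_integral_any _ _ _ mu _
  (fun z => (dilate phi t (y - z) * f z)%:E) N)//; last by move=> z /f0f ->.
rewrite -EFin_normr_Rintegral//; last exact: loc_atom_itg ap.
by rewrite lee_fin; exact: opt.
Qed.

Definition first_cubes (M : nat) : seq (idx n) := pmap pickle_inv (iota 0 M).

Lemma first_cubes_uniq M : uniq (first_cubes M).
Proof. by apply: (pmap_uniq (@pickle_invK (idx n))); exact: iota_uniq. Qed.

Definition whitney (i : idx n) : set ('rV[R]_n * R) :=
  [set y | inQ i y] `*` `[side i.1, side (i.1 + 1)[%classic.

Lemma measurable_whitney i : measurable (whitney i).
Proof. by apply: measurableX; [exact: measurable_inQ|exact: measurable_itv]. Qed.

Lemma measure_whitney i : (mu \x leb)%E (whitney i) = (vol n i.1 * side i.1)%:E.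
Proof.
rewrite product_measure1E; [|exact: measurable_inQ|exact: measurable_itv].
rewrite [X in (X * _)%E](_ : _ = (vol n i.1)%:E); last exact: lebesgue_inQ.
rewrite [X in (_ * X)%E](_ : _ = (side i.1)%:E); first by rewrite -EFinM.
have := lebesgue_measure_itv (`[side i.1 : R, side (i.1 + 1)[).
rewrite /= lte_fin ltr_side ltrDl ltr01 => ->.
by rewrite -EFinB sideS; congr EFin; ring.
Qed.

Definition box_term (x : 'rV[R]_n) (m : nat) : R :=
  if pickle_inv m is Some i then
    4 * (coef psi f i ^+ 2 * (insq (corner i) (3 * side i.1) x)%:R) else 0.

Lemma box_term_ge0 x m : 0 <= box_term x m.
Proof.
rewrite /box_term; case: pickle_inv => // i.
by apply: mulr_ge0 => //; apply: mulr_ge0 => //; exact: sqr_ge0.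
Qed.

Lemma sum_box_term x M :
  \sum_(0 <= m < M) box_term x m = 4 * sqfun psi f (first_cubes M) x.
Proof.
rewrite /sqfun /first_cubes /index_iota subn0; elim: (iota 0 M) => [|m l IH] /=.
  by rewrite !big_nil mulr0.
rewrite big_cons IH /box_term; case: pickle_inv => [i|]/=; last by rewrite add0r.
by rewrite big_cons mulrDr.
Qed.

(** On each Whitney box the supremum over test functions is bounded by a constant,
    and a box meets the cone over x only if x is within 3 sides of the corner of
    its cube. The majorant is a step function, hence Borel. *)
Lemma area_le x : (\int[mu \x leb]_(p in cone x)
    (intrinsic_sup alpha f0 p.1 p.2 ^+ 2 * (p.2 ^- n.+1)%:E) <=
  \sum_(0 <= m <oo) (box_term x m)%:E)%E.
Proof.
pose u m (p : 'rV[R]_n * R) : \bar R :=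
  if pickle_inv m is Some i then
    ((box_term x m * side i.1 ^- n.+1)%:E * (\1_(whitney i) p)%:E)%E else 0%E.
have s0 k := side_gt0 (R := R) k.
have u0 m p : (0 <= u m p)%E.
  rewrite /u; case: pickle_inv => // i; apply: mule_ge0; rewrite lee_fin//.
  by rewrite mulr_ge0 ?box_term_ge0// invr_ge0 exprn_ge0// ltW.
have mu_ m : measurable_fun setT (u m).
  rewrite /u; case: pickle_inv => [i|]; last exact: measurable_cst.
  apply: emeasurable_funM; first exact: measurable_cst.
  by apply/measurable_EFinP; apply: measurable_indic; exact: measurable_whitney.
apply: (@le_trans _ _ (\int[mu \x leb]_p \sum_(0 <= m <oo) u m p)%E).
  apply: (@ae_le_integral_sets _ _ _ _ _ _ _ _ set0) => //.
  - move=> p [t0 _]; apply: mule_ge0; last by rewrite lee_fin invr_ge0 exprn_ge0// ltW.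
    by rewrite expe2; apply: mule_ge0; exact: intrinsic_sup_ge0.
  - by move=> p _; apply: nneseries_ge0 => m _ _; exact: u0.
  move=> [y t] [/= t0 xyt] _.
  have [k kt] := int_log t0; pose i := cell k y.
  have iy : inQ i y by exact: inQ_cell.
  have Ai := intrinsic_sup_le iy kt.
  apply: (@le_trans _ _ (u (pickle i) (y, t))); last first.
    apply: le_trans (nneseries_lim_ge (pickle i).+1 _); last by move=> *; exact: u0.
    rewrite big_nat_recr//=; apply: leeDr; apply: sume_ge0 => m _; exact: u0.
  have xi : insq (corner i) (3 * side i.1) x.
    rewrite /insq (_ : x - corner i = (x - y) + (y - corner i)); last by rewrite addrA subrK.
    apply: le_trans (ler_normD _ _) _.
    have := inQ_dist iy; have := le_lt_trans (norm_le_enorm _) xyt.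
    by case/andP: kt => _; rewrite sideS /=; lra.
  have w1 : \1_(whitney i) (y, t) = 1 :> R.
    by rewrite indicE mem_set//; split => //=; rewrite in_itv.
  have pK : pickle_inv (pickle i) = Some i by exact: pickleK_inv.
  rewrite /u /box_term pK w1 mule1 xi mulr1.
  have A0 := intrinsic_sup_ge0 y t.
  apply: (@le_trans _ _ (((2 * `|coef psi f i|) ^+ 2)%:E * (t ^- n.+1)%:E)%E).
    apply: lee_wpmul2r; first by rewrite lee_fin invr_ge0 exprn_ge0// ltW.
    by rewrite expr2 EFinM; apply: lee_pmul.
  rewrite -EFinM lee_fin exprMn real_normK ?num_real//.
  rewrite (_ : 2 ^+ 2 = 4 :> R); last by ring.
  apply: ler_wpM2l; first by rewrite mulr_ge0 ?sqr_ge0.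
  case/andP: kt => kt _; rewrite lef_pV2 ?posrE ?exprn_gt0//.
  by rewrite lerXn2r ?nnegrE ?(ltW t0) ?(ltW (s0 _)).
rewrite integral_nneseries//.
apply: lee_nneseries => [m *|m *]; first by apply: integral_ge0 => p _; exact: u0.
rewrite /u /box_term; case: pickle_inv => [i|]; last by rewrite integral0.
set c := 4 * _; have c0 : 0 <= c by apply: mulr_ge0 => //; apply: mulr_ge0 => //; exact: sqr_ge0.
rewrite ge0_integralZl//=.
- rewrite integral_indic//; last exact: measurable_whitney.
  rewrite setIT; move: (measure_whitney i); rewrite /= => ->.
  rewrite -EFinM lee_fin -mulrA /vol -exprSr mulVf ?mulr1//.
  by rewrite expf_neq0// lt0r_neq0.
- by apply/measurable_EFinP; apply: measurable_indic; exact: measurable_whitney.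
- by rewrite lee_fin mulr_ge0// invr_ge0 exprn_ge0// ltW.
Qed.

(** The factor 4 in [box_term] is the square of the loss in [optimal_atoms];
    it is traded for sigma / 2. *)
Lemma square_gt x sigma : 0 < sigma -> (sigma%:E < `|intrinsic_square alpha f0 x|)%E ->
  exists M, (sigma / 2) ^+ 2 < sqfun psi f (first_cubes M) x.
Proof.
move=> s0 h; apply: contrapT => /forallNP H.
have {}H M : sqfun psi f (first_cubes M) x <= (sigma / 2) ^+ 2.
  by rewrite leNgt; apply/negP; exact: H.
move: h; apply/negP; rewrite -leNgt gee0_abs; last exact: poweR_ge0.
have B : (\sum_(0 <= m <oo) (box_term x m)%:E <= (sigma ^+ 2)%:E)%E.
  apply: lime_le; first by apply: is_cvg_nneseries => m _ _; rewrite lee_fin box_term_ge0.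
  apply: nearW => M; rewrite sumEFin lee_fin sum_box_term.
  by have := H M; rewrite expr_div_n; lra.
have I0 : (0 <= \int[mu \x leb]_(p in cone x)
    (intrinsic_sup alpha f0 p.1 p.2 ^+ 2 * (p.2 ^- n.+1)%:E))%E.
  apply: integral_ge0 => p [t0 _]; apply: mule_ge0; last by rewrite lee_fin invr_ge0 exprn_ge0// ltW.
  by rewrite expe2; apply: mule_ge0; exact: intrinsic_sup_ge0.
have -> : sigma%:E = ((sigma ^+ 2)%:E `^ 2^-1)%E.
  by rewrite poweR_EFin powR12_sqrt ?sqr_ge0// sqrtr_sqr gtr0_norm.
apply: gt0_ler_poweR => //.
- by rewrite in_itv/= I0 leey.
- by rewrite in_itv/= lee_fin sqr_ge0 leey.
- exact: le_trans (area_le x) B.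
Qed.

End discretization.

(** * Euclidean balls and cubes *)
Section balls.
Context {R : realType} {n : nat}.
Local Notation mu := (@lebesgue_row R n).
Implicit Types (c x : 'rV[R]_n) (r : R).

Definition inball c r x : bool := enorm (x - c) < r.

Lemma measurable_inball c r : 0 < r -> measurable [set x | inball c r x].
Proof.
move=> r0; pose S x := \sum_(i < n) (x ord0 i - c ord0 i) ^+ 2.
have mS : measurable_fun setT S.
  rewrite /S; apply: measurable_sum => i; apply: measurable_funX.
  by apply: measurable_funB; [exact: measurable_row_coord|exact: measurable_cst].
rewrite (_ : mkset _ = setT `&` S @^-1` `]-oo, (r ^+ 2)[%classic).
  by apply: mS => //; exact: measurable_itv.
have E x : enorm (x - c) = Num.sqrt (S x).
  by congr Num.sqrt; apply: eq_bigr => i _; rewrite !mxE.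
have S0 x : 0 <= S x by apply: sumr_ge0 => i _; exact: sqr_ge0.
apply/seteqP; split => x /=; rewrite in_itv/= /inball E.
  move=> h; split => //; rewrite -(sqr_sqrtr (S0 x)).
  by rewrite ltr_pXn2r ?nnegrE ?sqrtr_ge0 ?(ltW r0).
move=> [_]; rewrite -{1}(sqr_sqrtr (S0 x)).
by rewrite ltr_pXn2r ?nnegrE ?sqrtr_ge0 ?(ltW r0).
Qed.

Lemma insq_inball c r x : 0 < r -> insq c r x -> inball c (n.+1%:R * r) x.
Proof.
rewrite /insq /inball => r0 h; apply: le_lt_trans (enorm_le_norm _) _.
apply: (@le_lt_trans _ _ (n%:R * r)); first by rewrite ler_wpM2l.
by rewrite ltr_pM2r// ltr_nat.
Qed.

Lemma inball_insq c r x : inball c r x -> insq c r x.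
Proof. by move=> /ltW; exact: le_trans (norm_le_enorm _). Qed.

Lemma compact_sq c r : 0 <= r -> compact [set x | insq c r x].
Proof.
move=> r0; rewrite /insq sqE//.
apply: (@rV_compact R n (fun j => `[c ord0 j - r, c ord0 j + r]%classic)) => j.
exact: segment_compact.
Qed.

Lemma integral_set_version (g0 g : 'rV[R]_n -> R) (N : set 'rV[R]_n)
    (p : 'rV[R]_n -> bool) :
  measurable N -> mu N = 0%E -> (forall x, ~ N x -> g0 x = g x) ->
  itg (fun x => (p x)%:R * g x) ->
  (\int[mu]_(x in [set x | p x]) (g0 x)%:E = (Int (fun x => (p x)%:R * g x))%:E)%E.
Proof.
move=> mN N0 gg Ig; rewrite EFin_Int// integral_mkcond.
apply: (ae_eq_integral_any mN N0) => x /gg gx; rewrite patchE.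
have [px|px] := boolP (p x); first by rewrite mem_set// mul1r gx.
by rewrite memNset ?mul0r//; exact/negP.
Qed.

(** Sup-norm balls are compact. *)
Lemma loc_itg_version (g0 g : 'rV[R]_n -> R) (N : set 'rV[R]_n) :
  measurable N -> mu N = 0%E -> (forall x, ~ N x -> g0 x = g x) ->
  measurable_fun setT g ->
  (forall K, compact K -> \int[mu]_(x in K) `|g0 x|%:E < +oo)%E -> loc_itg g.
Proof.
move=> mN N0 gg mg H c r; have [r0|r0] := leP 0 r; last first.
  apply: (@eq_itg _ _ (fun=> 0)); last exact: itg0.
  move=> x; rewrite (_ : insq c r x = false) ?mul0r//; apply/negbTE.
  by rewrite /insq -ltNge (lt_le_trans r0).
apply/integrableP; split.
  apply/measurable_EFinP; apply: measurable_funM => //.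
  by apply: measurable_ind; exact: measurable_sq.
apply: le_lt_trans (H _ (compact_sq (c := c) r0)).
rewrite [leRHS]integral_mkcond; apply: (ae_le_integral_any _ _ mN N0) => //.
- by move=> x; rewrite patchE; case: ifP => // _; rewrite lee_fin.
- move=> x /gg gx; rewrite patchE /=; have [xr|xr] := boolP (insq c r x).
    by rewrite mem_set// mul1r gx.
  by rewrite memNset ?mul0r ?normr0//; exact/negP.
Qed.

End balls.

Section A1_version.
Context {R : realType} {n : nat}.
Local Notation mu := (@lebesgue_row R n).
Implicit Types (c x : 'rV[R]_n) (r : R).

(** A cube lies in a Euclidean ball of comparable volume. *)
Lemma A1_sq_version (w0 w : 'rV[R]_n -> R) (N : set 'rV[R]_n) :
  measurable N -> mu N = 0%E -> (forall x, ~ N x -> w0 x = w x) ->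
  measurable_fun setT w -> (forall x, 0 <= w x) -> A1 w0 ->
  exists C1, A1_sq w C1.
Proof.
move=> mN N0 ww mw wge [[w00 [_ lw0]] [C HC]].
have lw : loc_itg w by exact: loc_itg_version mN N0 ww mw lw0.
pose C' := Num.max C 1.
have C'0 : 0 < C' by rewrite lt_max ltr01 orbT.
exists (C' * (2 * n.+1%:R) ^+ n); split => //.
  by rewrite mulr_gt0// exprn_gt0// mulr_gt0.
move=> c r r0; pose rho := n.+1%:R * r.
have rho0 : 0 < rho by rewrite mulr_gt0.
have mB := measurable_inball c rho0.
have IB1 : itg (fun x => (inball c rho x)%:R).
  apply: (le_itg _ _ (itg_sq c (ltW rho0))); first exact: measurable_ind.
  move=> x; rewrite ger0_norm// ler_nat; have := @inball_insq _ _ c rho x.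
  by case: inball => // ->.
have muB : mu (eball c rho) = (Int (fun x => (inball c rho x)%:R))%:E.
  rewrite Int_ind// fineK//; have : (mu (eball c rho) <= mu [set x | insq c rho x])%E.
    by apply: le_measure; rewrite ?inE//; [exact: measurable_sq|move=> x; exact: inball_insq].
  rewrite lebesgue_sq ?(ltW rho0)// ge0_fin_numE// => h.
  by apply: le_lt_trans h _; rewrite ltry.
set m := Int _ in muB.
have m_le : m <= (2 * rho) ^+ n.
  rewrite -(Int_sq c (ltW rho0)); apply: le_Int => //; first exact: itg_sq (ltW rho0).
  by move=> x; rewrite ler_nat; have := @inball_insq _ _ c rho x; case: inball => // ->.
have m_gt0 : 0 < m.
  apply: (@lt_le_trans _ _ ((2 * r) ^+ n)); first by rewrite exprn_gt0// mulr_gt0.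
  rewrite -(Int_sq c (ltW r0)); apply: le_Int => //; first exact: itg_sq (ltW r0).
  by move=> x; rewrite ler_nat; have := @insq_inball _ _ c r x r0; case: insq => // ->.
have IBw : itg (fun x => (inball c rho x)%:R * w x).
  apply: eq_itg (itg_indM mB (lw c rho)) => x; have := @inball_insq _ _ c rho x.
  by case: inball => [->//|_]; rewrite ?mul1r// !mul0r.
have wB : wint w0 (eball c rho) = (Int (fun x => (inball c rho x)%:R * w x))%:E.
  exact: (integral_set_version mN N0 ww IBw).
have := HC (eball c rho) (ex_intro _ c (ex_intro _ rho (conj rho0 erefl))).
rewrite muB wB inver gt_eqF// -EFinM => H.
set E := ess_inf_on _ _ in H.
have E0 : (0 <= E)%E.
  apply/ess_infP; apply: nearW => x; rewrite /patch; case: ifP => _ //=.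
  by rewrite lee_fin.
have := ess_inf_le mu (patch (cst +oo%E) (eball c rho) (EFin \o w0)).
have NN : \forall x \ae mu, ~ N x.
  exists N; split => // x /= h; exact: contrapT.
apply: filterS2 NN => x xN Ex0 xr.
have xB : eball c rho x by exact: insq_inball.
have Ex : (E <= (w x)%:E)%E.
  by apply: le_trans Ex0 _; rewrite /patch mem_set//= ww.
have h1 : ((m^-1 * Int (fun x => (inball c rho x)%:R * w x))%:E <= (C' * w x)%:E)%E.
  apply: le_trans H _; apply: (@le_trans _ _ (C'%:E * E)%E).
    by apply: lee_wpmul2r => //; rewrite lee_fin le_max lexx.
  by rewrite EFinM; apply: lee_wpmul2l => //; rewrite lee_fin ltW.
rewrite lee_fin ler_pdivrMl// in h1.
apply: (@le_trans _ _ (Int (fun x => (inball c rho x)%:R * w x))).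
  apply: le_Int => [||y]; [exact: lw|exact: IBw|].
  by rewrite ler_wpM2r// ler_nat; have := @insq_inball _ _ c r y r0; case: insq => // ->.
apply: le_trans h1 _; apply: le_trans (ler_wpM2r _ m_le) _.
  by rewrite mulr_ge0 ?(ltW C'0).
by rewrite /rho mulrA exprMn; lra.
Qed.

End A1_version.

(** * The weak Morrey bound *)
Section morrey_bound.
Context {R : realType} {n : nat}.
Local Notation mu := (@lebesgue_row R n).
Hypothesis n0 : (0 < n)%N.
Variables (alpha kappa : R).
Hypothesis alpha01 : 0 < alpha <= 1.
Hypothesis kappa01 : 0 < kappa < 1.
Variables (w0 w : 'rV[R]_n -> R) (Nw : set 'rV[R]_n) (C1 : R).
Hypothesis mNw : measurable Nw.
Hypothesis Nw0 : mu Nw = 0%E.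
Hypothesis ww : forall x, ~ Nw x -> w0 x = w x.
Hypothesis w0ge : forall x, 0 <= w0 x.
Hypothesis wA1 : A1_sq w C1.
Implicit Types (c x : 'rV[R]_n) (r : R).

Let C10 : 0 < C1. Proof. by case: wA1. Qed.
Let mw : measurable_fun setT w. Proof. by case: wA1. Qed.
Let wge x : 0 <= w x. Proof. by case: wA1. Qed.
Let lw : loc_itg w. Proof. by case: wA1. Qed.

Definition wball c r : R := Int (fun x => (inball c r x)%:R * w x).

Lemma itg_ball (g : 'rV[R]_n -> R) c r : 0 < r -> loc_itg g ->
  itg (fun x => (inball c r x)%:R * g x).
Proof.
move=> r0 lg; apply: eq_itg (itg_indM (measurable_inball c r0) (lg c r)) => x.
have := @inball_insq _ _ c r x.
by case: inball => [->//|_]; rewrite ?mul1r// !mul0r.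
Qed.

Lemma wint_ball c r : 0 < r -> wint w0 (eball c r) = (wball c r)%:E.
Proof. by move=> r0; exact: (integral_set_version mNw Nw0 ww (itg_ball c r0 lw)). Qed.

Lemma wball_le c r : 0 < r -> wball c r <= wsq w c r.
Proof.
move=> r0; apply: le_Int => [||x]; [exact: itg_ball|exact: lw|].
by rewrite ler_wpM2r// ler_nat; have := @inball_insq _ _ c r x; case: inball => // ->.
Qed.

Lemma wsq_le_ball c r : 0 < r -> wsq w c r <= wball c (n.+1%:R * r).
Proof.
move=> r0; have r1 : 0 < n.+1%:R * r by rewrite mulr_gt0.
apply: le_Int => [||x]; [exact: lw|exact: itg_ball|].
by rewrite ler_wpM2r// ler_nat; have := @insq_inball _ _ c r x r0; case: insq => // ->.
Qed.

Lemma wball_ge0 c r : 0 <= wball c r.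
Proof. by apply: Int_ge0 => x; rewrite mulr_ge0. Qed.

Lemma wint_le c r (D : set 'rV[R]_n) : D `<=` eball c r -> (wint w0 D <= wint w0 (eball c r))%E.
Proof.
move=> DB; apply: (ae_le_integral_sets (N := set0)) => //.
by move=> x _; rewrite lee_fin.
by move=> x _; rewrite lee_fin.
Qed.

Lemma morrey_norm_ge0 f0 : (0 <= morrey_norm kappa w0 f0)%E.
Proof.
have B0 : eballs (eball (0 : 'rV[R]_n) 1) by exists 0, 1.
apply: le_trans (ereal_sup_ubound (imageP _ B0)).
apply: mule_ge0; first by rewrite inve_ge0 poweR_ge0.
by apply: integral_ge0 => x _; rewrite lee_fin mulr_ge0.
Qed.

(** For a weight that vanishes almost everywhere every term of the weak norm is
    a product with 0. *)
Lemma weak_morrey_null_weight f0 h : (forall c r, 0 < r -> wsq w c r = 0) ->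
  (weak_morrey_norm kappa w0 h <= 1%:E * morrey_norm kappa w0 f0)%E.
Proof.
move=> W0; rewrite mul1e; apply: le_trans (morrey_norm_ge0 f0).
apply: ge_ereal_sup => _ [_ [c [r [r0 ->]]] <-].
apply: ge_ereal_sup => _ [s _ <-].
have h0 : wint w0 (eball c r) = 0%E.
  rewrite wint_ball//; congr EFin; apply/eqP; rewrite eq_le wball_ge0 andbT.
  by rewrite -(W0 c r r0) wball_le.
rewrite [X in (_ * (_ * X))%E](_ : _ = 0%E) ?mule0//.
apply/eqP; rewrite eq_le; apply/andP; split.
  by rewrite -h0; apply: wint_le; exact: subIsetl.
by apply: integral_ge0 => x _; rewrite lee_fin.
Qed.

(** By doubling, a cube of weight 0 would make all concentric cubes have
    weight 0. *)
Lemma wsq_pos : (exists c r, 0 < r /\ 0 < wsq w c r) ->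
  forall c r, 0 < r -> 0 < wsq w c r.
Proof.
move=> [c1 [r1 [r10 W1]]] c r r0.
rewrite lt_neqAle (wsq_ge0 wA1) andbT eq_sym; apply/negP => /eqP W.
(* The cube of radius [L * r] around c contains the one of radius r1 around c1. *)
pose L := 1 + (r1 + `|c1 - c|) / r.
have L1 : 1 <= L.
  by rewrite /L lerDl; apply: divr_ge0; [rewrite addr_ge0// ltW|exact: ltW].
have := doubling wA1 c r0 L1; rewrite W mulr0; apply/negP; rewrite -ltNge.
apply: lt_le_trans W1 _; apply: (le_wsq wA1) => x; rewrite /insq => h.
rewrite (_ : x - c = (x - c1) + (c1 - c)); last by rewrite addrA subrK.
apply: le_trans (ler_normD _ _) _.
have -> : L * r = r + r1 + `|c1 - c| by rewrite /L; field; exact: lt0r_neq0.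
by lra.
Qed.

Definition ball_cst : R := (C1 * (n.+1%:R / 2) ^+ n) `^ kappa.
Definition weak_morrey_cst : R := 2 * morrey_cst (n := n) alpha C1 kappa * ball_cst * ball_cst.

Let kappa0 : 0 <= kappa. Proof. by case/andP: kappa01 => /ltW. Qed.

Lemma wsq_powR c r : 0 < r -> wsq w c (n.+1%:R * r) `^ kappa <= ball_cst * wsq w c r `^ kappa.
Proof.
move=> r0; have k0 : 0 <= C1 * (n.+1%:R / 2) ^+ n.
  by rewrite mulr_ge0 ?(ltW C10)// exprn_ge0// divr_ge0.
rewrite /ball_cst -powRM ?(wsq_ge0 wA1)//.
apply: ge0_ler_powR => //; rewrite ?nnegrE.
- exact: (wsq_ge0 wA1).
- by apply: mulr_ge0 => //; exact: (wsq_ge0 wA1).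
- by apply: (doubling wA1) => //; rewrite ler1n.
Qed.

Variables (f0 f : 'rV[R]_n -> R) (Nf : set 'rV[R]_n).
Hypothesis mNf : measurable Nf.
Hypothesis Nf0 : mu Nf = 0%E.
Hypothesis ff : forall x, ~ Nf x -> f0 x = f x.
Hypothesis mf : measurable_fun setT f.
Hypothesis f0P : morrey kappa w0 f0.
Hypothesis wpos : forall c r, 0 < r -> 0 < wsq w c r.

Let N := Nw `|` Nf.

Lemma measurable_null : measurable N. Proof. exact: measurableU. Qed.

Lemma null_null : mu N = 0%E.
Proof.
apply/eqP; rewrite eq_le measure_ge0 andbT.
apply: le_trans (measureU2 mu mNw mNf) _.
by rewrite [X in (X + _)%E]Nw0 [X in (_ + X)%E]Nf0 adde0.
Qed.

Lemma fw_version x : ~ N x -> `|f0 x| * w0 x = `|f x| * w x.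
Proof. by move=> /not_orP[h1 h2]; rewrite ww// ff. Qed.

Lemma loc_itg_fw : loc_itg (fun x => `|f x| * w x).
Proof.
apply: (loc_itg_version measurable_null null_null fw_version).
  by apply: measurable_funM => //; apply: measurableT_comp.
by case: f0P => _ [].
Qed.

(** An A1 weight of positive mass is bounded below on cubes, so that |f| is
    dominated there by a multiple of |f| w. *)
Lemma loc_itg_f : loc_itg (fun x => `|f x|).
Proof.
suff H c r : 0 < r -> itg (fun x => (insq c r x)%:R * `|f x|).
  move=> c r; have [r0|r0] := ltP 0 r; first exact: H.
  apply: eq_itg (itg_indM (measurable_sq c r) (H c 1 ltr01)) => x.
  have [xr|_] := boolP (insq c r x); last by rewrite !mul0r.
  by rewrite (_ : insq c 1 x) ?mul1r//; apply: le_trans xr (le_trans r0 ler01).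
move=> r0; have W0 := wpos c r0.
have mfn : measurable_fun setT (fun x => `|f x|) by exact: measurableT_comp.
have m1 : measurable_fun setT (fun x => (insq c r x)%:R * `|f x|).
  by apply: measurable_funM => //; apply: measurable_ind; exact: measurable_sq.
apply/integrableP; split; first exact/measurable_EFinP.
have I2 := itgZ (C1 * r ^+ n / wsq w c r) (loc_itg_fw c r).
have /integrableP[m2] := I2; apply: le_lt_trans.
apply: ae_ge0_le_integral => //.
- by apply: measurableT_comp => //; exact/measurable_EFinP.
- by apply: measurableT_comp.
have [_ _ _ _ /(_ c r r0)] := wA1; apply: filterS => x H _ /=.
rewrite lee_fin; have [xr|_] := boolP (insq c r x); last by rewrite !mul0r mulr0 normr0.
rewrite !mul1r normr_id; have h := ler_wpM2r (normr_ge0 (f x)) (H xr).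
apply: le_trans (ler_norm _).
rewrite [leRHS](_ : _ = C1 * r ^+ n * w x * `|f x| / wsq w c r); last by ring.
by rewrite ler_pdivlMr// mulrC.
Qed.

Let Nm : R := fine (morrey_norm kappa w0 f0).

Lemma NmE : morrey_norm kappa w0 f0 = Nm%:E.
Proof.
rewrite /Nm fineK// ge0_fin_numE ?morrey_norm_ge0//.
by case: f0P.
Qed.

Lemma Nm_ge0 : 0 <= Nm.
Proof. by rewrite -lee_fin -NmE morrey_norm_ge0. Qed.

Lemma wball_gt0 c r : 0 < r -> 0 < wball c r.
Proof.
move=> r0; have r1 : 0 < r / n.+1%:R by rewrite divr_gt0.
apply: lt_le_trans (wpos c r1) _; apply: le_trans (wsq_le_ball c r1) _.
by rewrite mulrCA mulfV ?mulr1// pnatr_eq0.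
Qed.

Lemma morrey_ball c r : 0 < r ->
  Int (fun x => (inball c r x)%:R * (`|f x| * w x)) <= Nm * wball c r `^ kappa.
Proof.
move=> r0; have : (((wint w0 (eball c r) `^ kappa)^-1 *
    \int[mu]_(x in eball c r) (`|f0 x| * w0 x)%:E) <= Nm%:E)%E.
  by rewrite -NmE; apply: ereal_sup_ubound; exists (eball c r) => //; exists c, r.
have P0 : 0 < wball c r `^ kappa by rewrite powR_gt0// wball_gt0.
rewrite (integral_set_version measurable_null null_null fw_version (itg_ball c r0 loc_itg_fw)).
rewrite wint_ball// poweR_EFin inver gt_eqF// -EFinM lee_fin.
by rewrite ler_pdivrMl// mulrC.
Qed.

Lemma morrey_sq c r : 0 < r ->
  Int (fun x => (insq c r x)%:R * (`|f x| * w x)) <= Nm * ball_cst * wsq w c r `^ kappa.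
Proof.
move=> r0; have r1 : 0 < n.+1%:R * r by rewrite mulr_gt0.
apply: (@le_trans _ _ (Int (fun x => (inball c (n.+1%:R * r) x)%:R * (`|f x| * w x)))).
  apply: le_Int => [||x]; [exact: loc_itg_fw|by apply: itg_ball => //; exact: loc_itg_fw|].
  by rewrite ler_wpM2r ?mulr_ge0// ler_nat; have := @insq_inball _ _ c r x r0; case: insq => // ->.
apply: le_trans (morrey_ball c r1) _; rewrite -mulrA; apply: ler_wpM2l; first exact: Nm_ge0.
apply: le_trans (wsq_powR c r0).
apply: ge0_ler_powR; first exact: kappa0.
- by rewrite nnegrE; exact: wball_ge0.
- by rewrite nnegrE; exact: (wsq_ge0 wA1).
- exact: wball_le.
Qed.

(** The level sets for the first M cubes increase to the level set for all cubes;
    the bound of [morrey_fin] does not depend on M and passes to the limit. *)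
Lemma weak_ball c r s : 0 < r -> 0 < s ->
  (wint w0 (eball c r `&` [set x | s%:E < `|intrinsic_square alpha f0 x|]) <=
   (weak_morrey_cst / s * Nm * wball c r `^ kappa)%:E)%E.
Proof.
move=> r0 s0; have alpha0 : 0 < alpha by case/andP: alpha01.
have [psi [psiP opt]] := optimal_atoms mf loc_itg_f alpha0.
have s20 : 0 < s / 2 by rewrite divr_gt0.
pose F M x := sqfun psi f (first_cubes M) x.
pose p M x := insq c r x && ((s / 2) ^+ 2 < F M x).
pose E M := [set x | p M x].
have mE M : measurable (E M).
  rewrite (_ : E M = [set x | insq c r x] `&` [set x | (s / 2) ^+ 2 < F M x]).
    by apply: measurableI; [exact: measurable_sq|exact: measurable_sqfun].
  by apply/seteqP; split => x /= /andP.
have Fmono M M' x : (M <= M')%N -> F M x <= F M' x.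
  move=> MM; suff : 4 * F M x <= 4 * F M' x by rewrite ler_pM2l.
  rewrite /F -!sum_box_term (big_cat_nat _ MM)//= lerDl.
  by apply: sumr_ge0 => m _; exact: box_term_ge0.
have Emono : {homo E : M M' / (M <= M')%N >-> (M <= M')%O}.
  move=> M M' MM; apply/subsetPset => x /= /andP[xr h].
  by apply/andP; split => //; apply: lt_le_trans h _; exact: Fmono.
apply: (@le_trans _ _ (\int[mu]_(x in \bigcup_M E M) (w x)%:E)%E).
  apply: (ae_le_integral_sets (N := Nw)) => //.
  - by move=> x _; rewrite lee_fin.
  - by move=> x _; rewrite lee_fin.
  - move=> x /= [xB xs].
    have [M hM] := square_gt alpha01 n0 mf loc_itg_f mNf Nf0 ff opt s0 xs.
    by exists M => //=; apply/andP; split => //; exact: inball_insq.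
  - by move=> x _ xN; rewrite ww.
have cvgE : (\int[mu]_(x in E M) (w x)%:E)%E @[M --> \oo] -->
    (\int[mu]_(x in \bigcup_M E M) (w x)%:E)%E.
  apply: ge0_nondecreasing_set_cvg_integral => //.
  - by move=> M; apply: measurable_funTS; exact/measurable_EFinP.
  - by move=> M x _; rewrite lee_fin.
rewrite -(cvg_lim _ cvgE)//; apply: lime_le; first by apply/cvg_ex; eexists; exact: cvgE.
apply: nearW => M.
have Ip : itg (fun x => (p M x)%:R * w x).
  by apply: (itg_sub_sq wA1 (c := c) (r := r)); [exact: mE|move=> x /andP[]].
rewrite (integral_set_version mNw Nw0 _ Ip)// lee_fin.
have := morrey_fin alpha01 n0 wA1 psiP kappa01 mf loc_itg_f loc_itg_fw
  (mulr_ge0 Nm_ge0 (powR_ge0 _ _)) morrey_sq wpos c r0 (first_cubes_uniq M) s20.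
move=> /le_trans; apply.
have mc0 := morrey_cst_ge0 alpha01 wA1 kappa01.
have W1 : wsq w c r `^ kappa <= ball_cst * wball c r `^ kappa.
  have r1 : 0 < r / n.+1%:R by rewrite divr_gt0.
  have rE : n.+1%:R * (r / n.+1%:R) = r by rewrite mulrCA mulfV ?mulr1// pnatr_eq0.
  have := wsq_powR c r1; rewrite rE => /le_trans; apply.
  apply: ler_wpM2l; first exact: powR_ge0.
  apply: ge0_ler_powR; first exact: kappa0.
  - by rewrite nnegrE; exact: (wsq_ge0 wA1).
  - by rewrite nnegrE; exact: wball_ge0.
  - by have := wsq_le_ball c r1; rewrite rE.
rewrite [leRHS](_ : _ = morrey_cst (n := n) alpha C1 kappa / (s / 2) * (Nm * ball_cst) *
  (ball_cst * wball c r `^ kappa)); last by rewrite /weak_morrey_cst; field; exact: lt0r_neq0.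
apply: ler_wpM2l W1; apply: mulr_ge0; first by rewrite divr_ge0// ltW.
by apply: mulr_ge0; [exact: Nm_ge0|exact: powR_ge0].
Qed.

Lemma weak_morrey_bound : (weak_morrey_norm kappa w0 (intrinsic_square alpha f0) <=
  weak_morrey_cst%:E * morrey_norm kappa w0 f0)%E.
Proof.
rewrite NmE; apply: ge_ereal_sup => _ [_ [c [r [r0 ->]]] <-].
apply: ge_ereal_sup => _ [s /= s0 <-].
have P0 : 0 < wball c r `^ kappa by rewrite powR_gt0// wball_gt0.
rewrite wint_ball// poweR_EFin inver gt_eqF//.
apply: (@le_trans _ _ ((wball c r `^ kappa)^-1%:E *
    (s%:E * (weak_morrey_cst / s * Nm * wball c r `^ kappa)%:E))%E).
  apply: lee_wpmul2l; first by rewrite lee_fin invr_ge0 ltW.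
  by apply: lee_wpmul2l; [rewrite lee_fin ltW|exact: weak_ball].
rewrite -!EFinM lee_fin le_eqVlt; apply/orP; left; apply/eqP.
by field; apply/andP; split; exact: lt0r_neq0.
Qed.

End morrey_bound.

Theorem theorem1p1 (R : realType) (n : nat) (alpha kappa : R)
    (w : 'rV[R]_n -> R) :
  (0 < n)%N -> 0 < alpha <= 1 -> 0 < kappa < 1 -> A1 w ->
  exists C : R, 0 < C /\
    forall f : 'rV[R]_n -> R, morrey kappa w f ->
      (weak_morrey_norm kappa w (intrinsic_square alpha f)
        <= C%:E * morrey_norm kappa w f)%E.
Proof.
move=> n0 alpha01 kappa01 wA1.
have [[w0ge [mw0 _]] _] := wA1.
have [Nw [mNw Nw0 mw]] := borel_version mw0.
set w' := fun x => _ in mw.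
have ww x : ~ Nw x -> w x = w' x by move=> xN; rewrite /w' indicE mem_set// mul1r.
have w'0 x : 0 <= w' x by rewrite mulr_ge0.
have [C1 w'A1] := A1_sq_version mNw Nw0 ww mw w'0 wA1.
have [W|W] := pselect (exists c r, 0 < r /\ 0 < wsq w' c r); last first.
  exists 1; split => // f fP; apply: (weak_morrey_null_weight kappa mNw Nw0 ww w0ge w'A1).
  move=> c r r0; apply/eqP; rewrite eq_le (wsq_ge0 w'A1) andbT leNgt.
  by apply/negP => h; apply: W; exists c, r.
have wpos := wsq_pos w'A1 W.
have T0 : 0 <= weak_morrey_cst (n := n) alpha kappa C1.
  by rewrite !mulr_ge0 ?powR_ge0// (morrey_cst_ge0 alpha01 w'A1).
exists (weak_morrey_cst (n := n) alpha kappa C1 + 1); split; first by rewrite ltr_wpDl.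
move=> f fP; have [mf0 _ _] := fP.
have [Nf [mNf Nf0 mf]] := borel_version mf0.
have ff x : ~ Nf x -> f x = \1_(~` Nf) x * f x by move=> xN; rewrite indicE mem_set// mul1r.
apply: (le_trans (weak_morrey_bound n0 alpha01 kappa01 mNw Nw0 ww w0ge w'A1 mNf Nf0 ff mf fP wpos)).
apply: lee_wpmul2r; first exact: morrey_norm_ge0.
by rewrite lee_fin lerDl.
Qed.
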